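(* Assume Jensen's principle $\diamondsuit_{\omega_1}$. Then there exists a compact Hausdorff zero-dimensional space $K$ which is separable, crowded (has no isolated points), has weight $\aleph_1$ and cardinality $2^{\aleph_1}$, and is such that $C_p(K)$ has no infinite-dimensional Hausdorff separable linear quotient, and hence no infinite-dimensional Hausdorff metrisable linear quotient. In particular, $K$ is an Efimov space.
   Context: $\diamondsuit_{\omega_1}$ asserts that there is a sequence $(d_\alpha)_{\alpha<\omega_1}$ with $d_\alpha\subseteq\alpha$ such that for every $E\subseteq\omega_1$ the set $\{\alpha<\omega_1: d_\alpha=E\cap\alpha\}$ is stationary in $\omega_1$. For a Tychonoff space $X$, $C_p(X)$ is the real vector space $C(X)$ of continuous functions $X\to\mathbb R$ with the topology of pointwise convergence. A linear quotient of $C_p(X)$ is a quotient vector space $C_p(X)/Z$ by a linear subspace $Z$, with the quotient topology (it is Hausdorff exactly when $Z$ is closed). The quotient is separable (metrisable) if it is separable (metrisable) as a topological space. An Efimov space is an infinite compact Hausdorff space containing neither a nontrivial convergent sequence nor a homeomorphic copy of $\beta\mathbb N$. *)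

(* Defs.v *)
From HB Require Import structures.
From mathcomp Require Import all_boot all_order all_algebra generic_quotient.
From mathcomp Require Import ring_quotient.
From mathcomp Require Import all_classical all_reals all_analysis.
From mathcomp Require wochoice.

Set Implicit Arguments.
Unset Strict Implicit.
Unset Printing Implicit Defensive.

Import Order.TTheory GRing.Theory Num.Theory.
Import numFieldNormedType.Exports.

Local Open Scope classical_set_scope.
Local Open Scope ring_scope.

Section omega1.
Context {d : Order.disp_t} (W : orderType d).

(* W is a copy of the first uncountable ordinal: it is well-ordered and
   uncountable, and its proper initial segments are countable.  Any two such
   orders are isomorphic. *)
Definition is_omega1 :=
  [/\ wochoice.well_order (<=%O : rel W),
      ~ countable [set: W]
    & forall a : W, countable [set b : W | (b < a)%O]].

Definition unbounded (C : set W) := forall a, exists2 c, C c & (a < c)%O.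

(* The hypotheses on [a] say that it is a nonzero limit and a limit of elements
   of [C]. *)
Definition order_closed (C : set W) :=
  forall a : W, (exists b, (b < a)%O) ->
    (forall b, (b < a)%O -> exists2 c, C c & (b < c)%O /\ (c < a)%O) -> C a.

Definition stationary (S : set W) :=
  forall C : set W, order_closed C -> unbounded C -> S `&` C !=set0.

Definition diamond :=
  exists D : W -> set W,
    (forall a, D a `<=` [set b | (b < a)%O]) /\
    forall E : set W, stationary [set a | D a = E `&` [set b | (b < a)%O]].

End omega1.

Section spaces.
Implicit Types T U : topologicalType.

(* The library's [zero_dimensional] only asks that points be separated by
   clopen sets. *)
Definition has_clopen_basis T :=
  exists2 B : set (set T), basis B & B `<=` clopen.

Definition separable_space T := exists2 A : set T, countable A & dense A.

Definition crowded T := isolated [set: T] = set0.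

(* The weight of T is the cardinality of the type I. *)
Definition weight_eq T (I : Type) :=
  (exists2 B : set (set T), basis B & (B #= [set: I])%card) /\
  forall B : set (set T), basis B -> ([set: I] #<= B)%card.

Definition metrisable (R : realType) T :=
  exists dist : T -> T -> R,
    [/\ forall x y, dist x y = 0 <-> x = y,
        forall x y, dist x y = dist y x,
        forall x y z, dist x z <= dist x y + dist y z
      & forall (x : T) (A : set T), nbhs x A <->
          exists2 e : R, 0 < e & [set y | dist x y < e] `<=` A].

Definition embeds T U :=
  exists f : T -> U,
    injective f /\
    forall A : set T, open A <-> exists2 B : set U, open B & A = f @^-1` B.

Definition has_nontrivial_cvg_seq T :=
  exists (u : nat -> T) (x : T),
    u @ \oo --> x /\ ~ (\forall n \near \oo, u n = x).

End spaces.

(* The Stone-Cech compactification of the discrete space nat, as the space of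
   ultrafilters on nat: the topology is generated by the sets of all
   ultrafilters that contain a given set. *)
Record betaN := BetaN {
  beta_filter : set_system nat;
  beta_ultra : UltraFilter beta_filter }.

HB.instance Definition _ := gen_eqMixin betaN.
HB.instance Definition _ := gen_choiceMixin betaN.
HB.instance Definition _ := @isSubBaseTopological.Build betaN
  (set nat) [set: set nat] (fun A => [set F | beta_filter F A]).

Definition efimov (K : topologicalType) :=
  [/\ infinite_set [set: K], compact [set: K], hausdorff_space K,
      ~ has_nontrivial_cvg_seq K & ~ embeds betaN K].

Section Cp.
Context (R : realType) (X : topologicalType).

Definition Cp : Type := continuousType X R.

HB.instance Definition _ := Choice.copy Cp (continuousType X R).
HB.instance Definition _ := Topological.copy Cp
  (initial_topology (id : continuousType X R -> {ptws X -> R})).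

Let mk (f : X -> R) (cf : continuous f) : Cp := mkcts cf : continuousType X R.

Let fn (f : Cp) : X -> R := (f : continuousType X R).

Let fn_inj (f g : Cp) : fn f =1 fn g -> f = g.
Proof. by move=> fg; apply/continuousEP. Qed.

Let fn_cts (f : Cp) : continuous (fn f).
Proof. exact: cts_fun. Qed.

Let add_cts (f g : Cp) : continuous (fn f \+ fn g).
Proof. by move=> x; apply: cvgD; exact: fn_cts. Qed.

Let opp_cts (f : Cp) : continuous (fun x => - fn f x).
Proof. by move=> x; apply: cvgN; exact: fn_cts. Qed.

Let scale_cts (a : R) (f : Cp) : continuous (fun x => a * fn f x).
Proof. by move=> x; apply: cvgMr; exact: fn_cts. Qed.

Let zero : Cp := mk (@cst_continuous X R 0).
Let add (f g : Cp) : Cp := mk (@add_cts f g).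
Let opp (f : Cp) : Cp := mk (@opp_cts f).
Let scale (a : R) (f : Cp) : Cp := mk (@scale_cts a f).

Let addA : associative add.
Proof. by move=> f g h; apply: fn_inj => x; exact: addrA. Qed.
Let addC : commutative add.
Proof. by move=> f g; apply: fn_inj => x; exact: addrC. Qed.
Let add0 : left_id zero add.
Proof. by move=> f; apply: fn_inj => x; exact: add0r. Qed.
Let addN : left_inverse zero opp add.
Proof. by move=> f; apply: fn_inj => x; exact: addNr. Qed.

HB.instance Definition _ := GRing.isZmodule.Build Cp addA addC add0 addN.

Let scaleA (a b : R) (f : Cp) : scale a (scale b f) = scale (a * b) f.
Proof. by apply: fn_inj => x; exact: mulrA. Qed.
Let scale1 : left_id 1 scale.
Proof. by move=> f; apply: fn_inj => x; exact: mul1r. Qed.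
Let scaleDr : right_distributive scale +%R.
Proof. by move=> a f g; apply: fn_inj => x; exact: mulrDr. Qed.
Let scaleDl (f : Cp) : {morph scale^~ f : a b / a + b}.
Proof. by move=> a b; apply: fn_inj => x; exact: mulrDl. Qed.

HB.instance Definition _ :=
  GRing.Zmodule_isLmodule.Build R Cp scaleA scale1 scaleDr scaleDl.

End Cp.

Section linear_quotient.
Context (R : realType) (V : preTopologicalLmodType R) (Z : submodClosed V).
Local Open Scope quotient_scope.

(* [Quotient.quot] wants a [zmodClosed], which [submodClosed] does not inherit
   from since it makes sense over semirings. *)
Let in_submod : V -> bool := fun v => v \in Z.

Let in_submod_zmod_closed : zmod_closed in_submod.
Proof.
split=> [|u v Zu Zv]; first exact: (rpred0 Z).
by rewrite -scaleN1r; exact: (rpredD Zu (rpredZ (-1) Zv)).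
Qed.

Definition submod_zmod : zmodClosed V :=
  HB.pack in_submod (GRing.isZmodClosed.Build V in_submod in_submod_zmod_closed).

Local Notation Q0 := (@Quotient.quot V submod_zmod).

Definition linear_quotient : Type := quotient_topology Q0.

Local Notation Q := linear_quotient.

HB.instance Definition _ := Topological.copy Q (quotient_topology Q0).
HB.instance Definition _ := GRing.isZmodule.Build Q
  (@addrA Q0) (@addrC Q0) (@add0r Q0) (@addNr Q0).

Let pi (v : V) : Q := \pi_Q0 v.

Let scale (a : R) (q : Q) : Q := pi (a *: repr (q : Q0)).

Let pi_surj (q : Q) : exists v, q = pi v.
Proof. by exists (repr (q : Q0)); rewrite /pi reprK. Qed.

Let piD u v : pi (u + v) = pi u + pi v.
Proof. exact: (@Quotient.pi_add V submod_zmod). Qed.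

Let piP u v : pi u = pi v <-> u - v \in Z.
Proof.
rewrite -[u - v \in Z]/((u - v) \in (submod_zmod : {pred V})).
by rewrite Quotient.idealrBE; split=> [uv|/eqP]; [apply/eqP; exact: uv|].
Qed.

Let pi_scale a v : scale a (pi v) = pi (a *: v).
Proof.
apply/piP; rewrite -scalerBr; apply: (rpredZ (s := Z) a).
by apply/piP; rewrite /pi reprK.
Qed.

Let scaleA a b q : scale a (scale b q) = scale (a * b) q.
Proof. by have [v ->] := pi_surj q; rewrite !pi_scale scalerA. Qed.
Let scale1 : left_id 1 scale.
Proof. by move=> q; have [v ->] := pi_surj q; rewrite pi_scale scale1r. Qed.
Let scaleDr : right_distributive scale +%R.
Proof.
move=> a q r; have [v ->] := pi_surj q; have [w ->] := pi_surj r.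
by rewrite -piD !pi_scale scalerDr piD.
Qed.
Let scaleDl q : {morph scale^~ q : a b / a + b}.
Proof.
by move=> a b; have [v ->] := pi_surj q; rewrite !pi_scale scalerDl piD.
Qed.

HB.instance Definition _ :=
  GRing.Zmodule_isLmodule.Build R Q scaleA scale1 scaleDr scaleDl.

End linear_quotient.

Definition finite_dimensional (R : realType) (V : lmodType R) :=
  exists (n : nat) (e : 'I_n -> V),
    forall v : V, exists c : 'I_n -> R, v = \sum_(i < n) c i *: e i.

(* Main.v *)
(** K is a closed subspace of the cube of 0-1 sequences indexed by nat + W, built
    by recursion along W.  Stage b adds disjoint open sets U and V: a point of K has
    b-th coordinate 1 on U and 0 on V, and splits into twins elsewhere.  Diamond
    guesses at stage b a sequence of points and linearly independent, finitely
    supported signed measures on them.  These have combinations lambda_n of norm 1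
    that tend to 0 on the clopen sets seen so far, while |lambda_n| tends to a
    probability measure tau.  With U and V generic for a forcing that adds little
    mass, the complement F of their union keeps positive tau-measure, and U takes
    the positive part of the lambda_n over a clopen set O.  In the new space the
    lambda_n then approach half the difference of the two copies of tau restricted
    to F and O, and for small O these copies concentrate near twins p and q.  As
    later stages preserve all this, f(p) = f(q) for every continuous function f on
    K that all the guessed measures kill, where p and q agree below b.

    If C_p(K)/Z is Hausdorff and infinite-dimensional, then Z is annihilated by such
    a sequence of measures, so Z fails to separate two points that agree on any
    prescribed countable set of coordinates; but a countable dense subset of the
    quotient, or a countable base at 0, involves only countably many coordinates.
    Dirac measures as guesses show that countable closed sets are finite, so K has no
    nontrivial convergent sequence, and sums of three Dirac measures rule out a copy
    of the Stone-Cech compactification of nat.  Splitting nonconvergent sequences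
    along the binary tree of height W gives 2^W points. *)
From HB Require Import structures.
Require Import Defs.
From mathcomp Require Import all_boot all_order all_algebra.
From mathcomp Require Import all_classical all_reals all_analysis.
From mathcomp Require Import ring lra zify.

Import numFieldNormedType.Exports.
Import Order.TTheory GRing.Theory Num.Theory.

Set Implicit Arguments.
Unset Strict Implicit.
Unset Printing Implicit Defensive.

Local Open Scope classical_set_scope.
Local Open Scope ring_scope.

(** * The first uncountable ordinal *)

(** The guess fixes the atoms below its stage only, so every estimate has to hold for all their
    lifts to points of K. At each later stage the atoms of infinitely many of the combinations must
    therefore land in [U] or [V]: elsewhere a lift could take either value. This is affordable
    because the n-th combination also vanishes at the first n points. Fibres over distinct atoms are
    disjoint, so late ones have small mass, and their neighbourhoods fit into any mass budget. The
    factor one half arises because a combination that is nearly null on clopen sets has positive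
    part close to [tau / 2]. One pair [U], [V] must serve all O; it does so along different
    subsequences, one for each O. A single O only yields two measures of equal mass that give f the
    same integral; equality at two points needs O to shrink to a point in the support of [tau] on F.
    For separability and the absence of isolated points, each stage puts cylinders into both [U] and
    [V], which keeps the projection of K to the Cantor set of the coordinates in [nat]
    irreducible. *)

Lemma card_le_fun T U (A : set T) (B : set U) (f : T -> U) :
  (forall x, A x -> B (f x)) ->
  (forall x y, A x -> A y -> f x = f y -> x = y) -> (A #<= B)%card.
Proof.
move=> AB fi; suff /injfunPex[g] : exists2 f : T -> U, set_fun A B f & set_inj A f.
  exact: inj_card_le.
by exists f => // x y /set_mem Ax /set_mem Ay; exact: fi.
Qed.

Definition select T (x0 : T) (P : set T) : T :=
  if pselect (exists x, P x) is left h then projT1 (cid h) else x0.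

Lemma selectP T (x0 : T) (P : set T) : (exists x, P x) -> P (select x0 P).
Proof. by rewrite /select; case: pselect => // h _; exact: (projT2 (cid h)). Qed.

Lemma countable_enum T (A : set T) : A !=set0 -> countable A ->
  exists e : nat -> T, range e = A.
Proof.
move=> [a Aa] /countable_injP[f fi].
exists (fun n => if pselect (exists x, A x /\ f x = n) is left h then projT1 (cid h) else a).
apply/seteqP; split=> x /=.
  by move=> [n _ <-]; case: pselect => // h; case: (projT2 (cid h)).
move=> Ax; exists (f x) => //; case: pselect => [h|[]]; last by exists x.
by case: (projT2 (cid h)) => Ay fy; apply: fi; rewrite ?inE.
Qed.

Section omega1_theory.
Context {d : Order.disp_t} (W : orderType d) (w1 : is_omega1 W).
Implicit Types a b c : W.

Lemma omega1_min (A : set W) : A !=set0 ->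
  exists2 a, A a & forall b, A b -> (a <= b)%O.
Proof.
case=> x Ax; have [wo _ _] := w1.
have [|z [[Az zmin] _]] := wo (fun x => `[< A x >]).
  by exists x; apply/asboolP.
exists z; first by move/asboolP: Az.
by move=> b Ab; apply: zmin; apply/asboolP.
Qed.

Lemma omega1_ind (P : W -> Prop) :
  (forall a, (forall b, (b < a)%O -> P b) -> P a) -> forall a, P a.
Proof.
move=> step a; apply: contrapT => nPa.
have [|z nPz zmin] := @omega1_min (fun b => ~ P b); first by exists a.
apply: nPz; apply: step => b bz; apply: contrapT => nPb.
by have := zmin b nPb; rewrite leNgt bz.
Qed.

Lemma omega1_wf : well_founded (fun a b : W => (a < b)%O).
Proof. by move=> a; elim/omega1_ind: a => a ih; constructor. Qed.

Lemma countable_below a : countable [set b | (b < a)%O].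
Proof. by case: w1. Qed.

(** Otherwise the initial segments given by [A] would cover W, and W would be a countable union of
    countable sets. *)
Lemma countable_ub (A : set W) : countable A ->
  exists a, forall b, A b -> (b < a)%O.
Proof.
move=> cA; apply: contrapT => nub; have [_ ncW cW] := w1; apply: ncW.
have -> : [set: W] = \bigcup_(b in A) [set c | (c <= b)%O].
  apply/seteqP; split=> // x _; apply: contrapT => xn; apply: nub.
  by exists x => b Ab; rewrite ltNge; apply/negP => xb; apply: xn; exists b.
apply: bigcup_countable => // b _.
have -> : [set c | (c <= b)%O] = \bigcup_(i in [set: bool])
    (if i then [set c | (c < b)%O] else [set b]).
  apply/seteqP; split=> [x /=|x /= [[] _ /=]].
  - by rewrite le_eqVlt => /orP[/eqP ->|xb]; [exists false|exists true].
  - exact: ltW.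
  - by move=> ->.
by apply: bigcup_countable => // -[] _; [exact: cW|exact: countable1].
Qed.

Lemma omega1_unbounded a : exists b, (a < b)%O.
Proof.
have [b h] := countable_ub (countable1 a).
by exists b; apply: h.
Qed.

Lemma stationary_gt (S : set W) a : stationary S ->
  exists2 b, S b & (a < b)%O.
Proof.
move=> /(_ [set b | (a < b)%O]) [| |b [Sb ab]].
- move=> b [c cb] /(_ c cb)[e /= ae [_ eb]]; exact: lt_trans eb.
- move=> b; have [c hc] := omega1_unbounded (Order.max a b).
  by exists c; rewrite //=; move: hc; rewrite gt_max => /andP[].
- by exists b.
Qed.

(** Transfinite recursion with choice. By the hypothesis [P a h] depends on [h] below [a] only, so
    specifications can speak of total functions. Existence is asked for the constructed [f] alone,
    which lets users prove it afterwards by induction; where it fails the value is [x0]. *)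
Lemma omega1_choice T (x0 : T) (P : W -> (W -> T) -> T -> Prop) :
  (forall a h k, (forall b, (b < a)%O -> h b = k b) -> P a h `<=` P a k) ->
  exists f, forall a, (exists x, P a f x) -> P a f (f a).
Proof.
move=> Ploc.
pose ex a (r : forall b, (b < a)%O -> T) b :=
  if pselect (b < a)%O is left h then r b h else x0.
pose F a r := select x0 (P a (ex a r)).
pose f := Fix omega1_wf (fun _ => T) F.
have Pex a (r : forall b, (b < a)%O -> T) g :
    (forall b (h : (b < a)%O), r b h = g b) -> P a (ex a r) = P a g.
  move=> rg; apply/seteqP; split; apply: Ploc => b ba; rewrite /ex.
    by case: pselect.
  by case: pselect.
have fE a : f a = select x0 (P a f).
  rewrite /f Fix_eq /F; first by rewrite (Pex _ _ f).
  by move=> c g h gh; congr select; rewrite (Pex _ _ (ex c h)) // => b bc;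
     rewrite /ex; case: pselect => // bc'; rewrite gh; congr h; exact: Prop_irrelevance.
exists f => a Pf; rewrite [X in P a f X]fE; exact: selectP.
Qed.

Lemma omega1_card_le T (A : set T) :
  (forall B : set T, countable B -> exists2 x, A x & ~ B x) ->
  ([set: W] #<= A)%card.
Proof.
move=> cA; have [x0 _ _] := cA set0 (countable0 _).
have [|f fP] := @omega1_choice T x0
    (fun a f x => A x /\ forall b, (b < a)%O -> x <> f b).
  by move=> a h k hk x [Ax xh]; split=> // b ba; rewrite -hk //; exact: xh.
have {}fP a : A (f a) /\ forall b, (b < a)%O -> f a <> f b.
  apply: fP; have [|x Ax nx] := cA (f @` [set b | (b < a)%O]).
    by apply: card_le_trans (card_image_le _ _) _; exact: countable_below.
  by exists x; split=> // b ba xE; apply: nx; exists b.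
apply: (@card_le_fun _ _ _ _ f) => [a _|a b _ _ fab]; first by case: (fP a).
by case: (ltgtP a b) => // ab; [have [_ /(_ a ab)] := fP b|have [_ /(_ b ab)] := fP a];
   rewrite fab.
Qed.

(** Each [a] receives an injective sequence that avoids the sequences of smaller elements; one
    exists above all of them. This serves to code a set of naturals at each point of W into one
    subset of W. *)
Lemma omega1_pairing : exists j : nat -> W -> W,
  forall m n a b, j m a = j n b -> m = n /\ a = b.
Proof.
have [w _] : [set: W] !=set0.
  by apply/set0P/eqP => W0; have [_ []] := w1; rewrite W0; exact: countable0.
have [|f fP] := @omega1_choice (nat -> W) (fun=> w) (fun a f h => injective h /\
    forall b, (b < a)%O -> forall m n, h m <> f b n).
  by move=> a h k hk x [Ax xh]; split=> // b ba; rewrite -hk //; exact: xh.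
have {}fP a : injective (f a) /\ forall b, (b < a)%O -> forall m n, f a m <> f b n.
  apply: fP.
  have [|u uP] := @countable_ub (\bigcup_(b in [set b | (b < a)%O]) range (f b)).
    apply: bigcup_countable => [|b _]; first exact: countable_below.
    by apply: card_le_trans (card_image_le _ _) _; exact: countableP.
  have [s sP] := choice omega1_unbounded.
  have slt m n : (m < n)%N -> (iter m s u < iter n s u)%O.
    elim: n => // n ih; rewrite ltnS leq_eqVlt => /orP[/eqP ->|/ih mn]; first exact: sP.
    exact: lt_trans mn (sP _).
  exists (fun n => iter n s u); split=> [m n mn|b ba m n E].
    by case: (ltngtP m n) => // /slt; rewrite mn ltxx.
  have : (f b n < u)%O by apply: uP; exists b => //; exists n.
  rewrite -E; case: m {E} => [|m]; first by rewrite ltxx.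
  by move=> h; have := lt_trans (slt 0%N m.+1 isT) h; rewrite ltxx.
exists (fun n a => f a n) => m n a b E.
have ab : a = b.
  by case: (ltgtP a b) => // h; [have [_ /(_ a h n m)] := fP b|have [_ /(_ b h m n)] := fP a];
     rewrite E.
by move: E; rewrite ab; have [fi _] := fP b => /fi.
Qed.

(** A function [X] into sets of naturals is coded by the set [E] of all [j n b] with [n] in [X b].
    If [a] is closed under [j], the trace of [E] below [a] determines [X] below [a], and such [a]
    form a closed unbounded set. *)
Lemma diamond_fun S (s0 : S) : diamond W -> ([set: S] #<= [set: set nat])%card ->
  exists G : W -> W -> S, forall X : W -> S,
    stationary [set a | forall b, (b < a)%O -> G a b = X b].
Proof.
move=> [D [Dsub DP]] /pcard_injP[h hi].
have {}hi : injective h by move=> x y; apply: hi; rewrite inE.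
have [j ji] := omega1_pairing.
exists (fun a b => select s0 [set s | h s = [set n | D a (j n b)]]) => X C Cc Cu.
pose E := [set c | exists n b, h (X b) n /\ c = j n b].
have jE n b : E (j n b) <-> h (X b) n.
  split=> [[m [c [hm /ji[-> ->]]]]//|hn]; by exists n, b.
(* Closure under [j] ensures that the codes of the values below [a] lie below [a], where [D a] can
   see them. *)
pose C' := C `&` [set a | forall n b, (b < a)%O -> (j n b < a)%O].
have [| |a [/= Da [Ca ja]]] := DP E C'.
- move=> a ha hC; split.
    by apply: Cc => // b /hC[c [Cc' _] bca]; exists c.
  by move=> n b /hC[c [_ jc] [bc ca]]; apply: lt_trans (jc n b bc) ca.
- have ub a : exists b, (a < b)%O /\ C b /\ forall n c, (c <= a)%O -> (j n c < b)%O.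
    have [|b bP] := @countable_ub (\bigcup_(n in [set: nat]) (j n @` [set c | (c <= a)%O])).
      apply: bigcup_countable => // n _; apply: card_le_trans (card_image_le _ _) _.
      have [a' aa'] := omega1_unbounded a.
      apply: sub_countable (countable_below a'); apply: subset_card_le => c /= ca.
      exact: le_lt_trans aa'.
    have [c Cc' bc] := Cu (Order.max a b); exists c; move: bc; rewrite gt_max => /andP[ac bc].
    by split=> //; split=> // n e ea; apply: lt_trans bc; apply: bP; exists n => //; exists e.
  have [s sP] := choice ub.
  (* The least strict upper bound [l] of the iterates of [s] is a limit of elements of [C] and
     closed under [j]. *)
  move=> a; pose u n := iter n s a.
  have [|v vu] := @countable_ub (range u).
    by apply: card_le_trans (card_image_le _ _) _; exact: countableP.
  have [|l lu lmin] := @omega1_min [set l | forall n, (u n < l)%O].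
    by exists v => n; apply: vu; exists n.
  have below b : (b < l)%O -> exists n, (b < u n)%O.
    move=> bl; apply: contrapT => nb; have := lmin b; rewrite leNgt bl => /(_ _)/negP; apply=> //.
    move=> n; apply: contrapT => /negP; rewrite -leNgt => bn.
    by apply: nb; exists n.+1; apply: le_lt_trans bn _; have [] := sP (u n).
  exists l; last exact: (lu 0%N).
  split; last first.
    move=> n b /below[m bm]; apply: lt_trans (lu m.+1).
    by have [_ [_ h']] := sP (u m); apply: h'; exact: ltW.
  apply: Cc; first by exists a; exact: (lu 0%N).
  move=> b /below[n bn]; exists (u n.+1); first by have [_ []] := sP (u n).
  by split=> //; apply: lt_trans bn _; have [] := sP (u n).
exists a; split=> //= b ba.
have hb : h (X b) = [set n | D a (j n b)].
  rewrite Da; apply/seteqP; split=> n /=; first by move=> hn; split; [apply/jE|exact: ja].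
  by move=> [/jE].
have := @selectP _ s0 [set s | h s = [set n | D a (j n b)]] (ex_intro _ (X b) hb).
by move=> /= hs; apply: hi; rewrite hs hb.
Qed.

End omega1_theory.

(** * Cubes and their measures *)

Section cube.
Variable I : choiceType.
Implicit Types (i : I) (J : seq I) (S : set I) (x y : I -> bool)
  (A B C : set (I -> bool)).

Definition agree S x y := forall i, S i -> x i = y i.

Definition dep J A := forall x y, agree [set` J] x y -> A x -> A y.

(** By compactness these are the clopen subsets of the cube that depend on the coordinates in [S]
    only. The finite support makes them countably many when [S] is countable. *)
Definition clop S A := exists2 J : seq I, [set` J] `<=` S & dep J A.

Lemma agree_sym S x y : agree S x y -> agree S y x.
Proof. by move=> xy i Si; rewrite xy. Qed.

Lemma agree_trans S x y z : agree S x y -> agree S y z -> agree S x z.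
Proof. by move=> xy yz i Si; rewrite xy ?yz. Qed.

Lemma agree_sub S S' x y : S `<=` S' -> agree S' x y -> agree S x y.
Proof. by move=> SS xy i /SS/xy. Qed.

Lemma agree_cat J J' x y : agree [set` J ++ J'] x y -> agree [set` J] x y /\ agree [set` J'] x y.
Proof. by move=> xy; split=> i /= iJ; apply: xy; rewrite /= mem_cat iJ ?orbT. Qed.

Lemma agree_cons i J x y : agree [set` i :: J] x y -> x i = y i /\ agree [set` J] x y.
Proof. by move=> xy; split=> [|j /= jJ]; apply: xy; rewrite /= inE ?eqxx ?jJ ?orbT. Qed.

Lemma clop_sub S S' A : S `<=` S' -> clop S A -> clop S' A.
Proof. by move=> SS [J JS dA]; exists J => // i /JS/SS. Qed.

Lemma clop_agree S A x y : clop S A -> agree S x y -> A x -> A y.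
Proof. by move=> [J JS dA] xy; apply: dA; exact: agree_sub xy. Qed.

Lemma clop_agreeE S A x y : clop S A -> agree S x y -> A x <-> A y.
Proof.
by move=> cA xy; split; apply: clop_agree cA _ => //; exact: agree_sym.
Qed.

Lemma clopT S : clop S setT.
Proof. by exists [::]. Qed.

Lemma clopC S A : clop S A -> clop S (~` A).
Proof.
move=> [J JS dA]; exists J => // x y xy nAx Ay; apply: nAx.
by apply: dA Ay; exact: agree_sym.
Qed.

Lemma clopI S A B : clop S A -> clop S B -> clop S (A `&` B).
Proof.
move=> [J JS dA] [J' JS' dB]; exists (J ++ J').
  by move=> i /=; rewrite mem_cat => /orP[/JS|/JS'].
by move=> x y /agree_cat[xy xy'] [Ax Bx]; split; [exact: dA Ax|exact: dB Bx].
Qed.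

Lemma clopU S A B : clop S A -> clop S B -> clop S (A `|` B).
Proof.
by move=> cA cB; rewrite -[A `|` B]setCK setCU; apply/clopC/clopI; exact: clopC.
Qed.

Lemma clopD S A B : clop S A -> clop S B -> clop S (A `\` B).
Proof. by move=> cA cB; rewrite setDE; apply: clopI => //; exact: clopC. Qed.

Lemma clop0 S : clop S set0.
Proof. by rewrite -setCT; exact/clopC/clopT. Qed.

Lemma clop_coord S i b : S i -> clop S [set x | x i = b].
Proof.
move=> Si; exists [:: i] => [j|x y xy /= <-]; first by rewrite /= inE => /eqP ->.
by rewrite (xy i) //= inE.
Qed.

Lemma clop_agrees S J x : [set` J] `<=` S -> clop S [set y | agree [set` J] x y].
Proof. by move=> JS; exists J => // y z yz xy; exact: agree_trans yz. Qed.

Lemma clop_bigcup S (T : eqType) (s : seq T) (F : T -> set (I -> bool)) :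
  (forall t, clop S (F t)) -> clop S [set x | exists2 t, t \in s & F t x].
Proof.
move=> cF; elim: s => [|t s ih].
  by rewrite (_ : [set x | _] = set0); [exact: clop0|apply/seteqP; split=> x // []].
rewrite (_ : [set x | _] = F t `|` [set x | exists2 t, t \in s & F t x]); first exact: clopU.
apply/seteqP; split=> x /=.
  by move=> [u]; rewrite inE => /orP[/eqP ->|us]; [left|right; exists u].
by move=> [|[u us]] Fx; [exists t|exists u]; rewrite // inE ?eqxx ?us ?orbT.
Qed.

(** A set that depends on [i :: J] is determined by its two sections at coordinate [i], and these
    depend on [J]. *)
Lemma finite_dep J : finite_set [set A | dep J A].
Proof.
elim: J => [|i J ih].
  apply: (@sub_finite_set _ _ [set set0; setT]); last exact: finite_set2.
  move=> A /= dA; have [->|/set0P[x Ax]] := eqVneq A set0; first by left.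
  by right; apply/seteqP; split=> // y _; apply: dA Ax => j.
pose up (b : bool) x j := if j == i then b else x j.
pose f (AB : set (I -> bool) * set (I -> bool)) :=
  [set x | if x i then AB.1 x else AB.2 x].
apply: (@sub_finite_set _ _ (f @` ([set A | dep J A] `*` [set A | dep J A]))); last first.
  exact/finite_image/finite_setX.
move=> A /= dA; exists ([set x | A (up true x)], [set x | A (up false x)]).
  have dup b : dep J [set x | A (up b x)].
    move=> x y xy /=; apply: dA => j /=; rewrite /up inE; case: eqVneq => //= _.
    exact: xy.
  by split; exact: dup.
have upE x b : x i = b -> up b x = x.
  by move=> xi; apply/funext => j; rewrite /up; case: eqVneq => // ->.
by apply/seteqP; split=> x; rewrite /f /=; case E: (x i); rewrite upE.
Qed.

Lemma countable_seqs S : countable S -> countable [set J : seq I | [set` J] `<=` S].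
Proof.
move=> /countable_injP[f fi].
apply/countable_injP; exists (fun J => choice.pickle (map f J)) => J J' /set_mem /= JS /set_mem /= JS'.
move=> /(pcan_inj choice.pickleK).
elim: J J' JS JS' => [|i J ih] [|i' J'] //= JS JS' [] ff fJ.
have iS : S i by apply: JS; rewrite /= inE eqxx.
have iS' : S i' by apply: JS'; rewrite /= inE eqxx.
rewrite (fi i i') ?inE // (ih J') // => j jJ; [apply: JS|apply: JS'];
  by rewrite /= inE (jJ : _ \in _) orbT.
Qed.

Lemma countable_clop S : countable S -> countable [set A | clop S A].
Proof.
move=> cS; rewrite (_ : [set A | _] =
    \bigcup_(J in [set J : seq I | [set` J] `<=` S]) [set A | dep J A]).
  apply: bigcup_countable => [|J _]; first exact: countable_seqs.
  exact/finite_set_countable/finite_dep.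
by apply/seteqP; split=> A [J JS dA]; exists J.
Qed.

(** Compactness of the cube in terms of finite sets of coordinates: [y] is the coordinatewise
    ultralimit. *)
Lemma cube_ulim T (F : set_system T) (u : T -> I -> bool) : UltraFilter F ->
  exists y, forall J, F [set t | agree [set` J] (u t) y].
Proof.
move=> UF; pose y i := `[< F [set t | u t i] >].
have Fi i : F [set t | u t i = y i].
  rewrite /y; have [Fu|nFu] := pselect (F [set t | u t i]).
    by rewrite asboolT //; apply: filterS Fu => t.
  rewrite asboolF //; have [//|] := in_ultra_setVsetC [set t | u t i] UF.
  by apply: filterS => t /= /negP; apply: contraNF => /= ->.
exists y; elim=> [|i J ih]; first by apply: filterS filterT => t _ i.
apply: filterS2 (Fi i) ih => t /= ut utJ j /=; rewrite inE => /orP[/eqP -> //|jJ].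
exact: utJ.
Qed.

Lemma clop_decr_nonempty (A : nat -> set (I -> bool)) : (forall n, clop setT (A n)) ->
  (forall n, A n.+1 `<=` A n) -> (forall n, A n !=set0) -> \bigcap_n A n !=set0.
Proof.
move=> cA Adec A0; have [u uA] := choice A0.
have Adec' m n : (m <= n)%N -> A n `<=` A m.
  elim: n => [|n ih]; first by rewrite leqn0 => /eqP ->.
  by rewrite leq_eqVlt => /orP[/eqP -> //|/ih mn]; exact: subset_trans (Adec n) mn.
have [F [UF Foo]] := ultraFilterLemma (@eventually_filter : ProperFilter \oo).
have [y yP] := cube_ulim u UF.
exists y => k _; have [J _ dA] := cA k.
have [n [un nk]] : [set n | agree [set` J] (u n) y] `&` [set n | (k <= n)%N] !=set0.
  by apply: (@filter_ex _ F); apply: filterI; [exact: yP|apply: Foo; exact: nbhs_infty_ge].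
by apply: dA un _; apply: Adec' nk _ _.
Qed.

(** The Baire sets of the cube. *)
Definition msr := <<s [set A | clop setT A] >>.

Lemma msrC A : msr A -> msr (~` A).
Proof. by rewrite -setTD; have [_ h _] := @smallest_sigma_algebra _ setT [set A | clop setT A]; exact: h. Qed.

Lemma msr_clop S A : clop S A -> msr A.
Proof. by move=> cA; apply: sub_sigma_algebra; exact: clop_sub cA. Qed.

Lemma msr_bigcup (F : nat -> set (I -> bool)) : (forall n, msr (F n)) -> msr (\bigcup_n F n).
Proof. by have [_ _ h] := @smallest_sigma_algebra _ setT [set A | clop setT A]; exact: h. Qed.

Lemma msr0 : msr set0.
Proof. exact: msr_clop (clop0 setT). Qed.

Lemma msrT : msr setT.
Proof. exact: msr_clop (clopT setT). Qed.

Lemma msrU A B : msr A -> msr B -> msr (A `|` B).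
Proof.
move=> mA mB; rewrite (_ : A `|` B = \bigcup_n (if n is 0%N then A else B)).
  by apply: msr_bigcup => -[].
apply/seteqP; split=> x /=; first by move=> [] ?; [exists 0%N|exists 1%N].
by move=> [[|n] _]; [left|right].
Qed.

Lemma msrI A B : msr A -> msr B -> msr (A `&` B).
Proof.
by move=> mA mB; rewrite -[A `&` B]setCK setCI; apply: msrC; apply: msrU; apply: msrC.
Qed.

Lemma msrD A B : msr A -> msr B -> msr (A `\` B).
Proof. by move=> mA mB; rewrite setDE; apply: msrI => //; exact: msrC. Qed.

Lemma msr_bigcap (F : nat -> set (I -> bool)) : (forall n, msr (F n)) -> msr (\bigcap_n F n).
Proof.
move=> mF; rewrite -[X in msr X]setCK setC_bigcap.
by apply: msrC; apply: msr_bigcup => n; apply: msrC; exact: mF.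
Qed.

(** Clopen sets are finite Boolean combinations of coordinates; the induction on the support splits
    along one coordinate at a time. *)
Lemma msr_preimage (f : (I -> bool) -> I -> bool) :
  (forall i, msr [set x | f x i]) -> forall A, msr A -> msr (f @^-1` A).
Proof.
move=> mf A mA.
suff : <<s [set A | clop setT A] >> `<=` [set A | msr (f @^-1` A)] by exact.
apply: smallest_sub => {A mA} [|A].
  split => [|A mA|F mF] /=; first exact: msr0.
    by rewrite setTD; exact: msrC.
  by rewrite preimage_bigcup; exact: msr_bigcup.
move=> -[J _] /=; elim: J A => [|i J ih] A dA.
  have [->|/set0P[x Ax]] := eqVneq A set0; first exact: msr0.
  suff -> : A = setT by exact: msrT.
  by apply/seteqP; split=> // y _; apply: dA Ax => j.
pose up (b : bool) x j := if j == i then b else x j.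
have mup b : msr (f @^-1` [set x | A (up b x)]).
  apply: ih => x y xy /=; apply: dA => j /=; rewrite /up inE; case: eqVneq => //= _.
  exact: xy.
rewrite (_ : _ @^-1` _ =
    (([set x | f x i] `&` f @^-1` [set x | A (up true x)])
    `|` ((~` [set x | f x i]) `&` f @^-1` [set x | A (up false x)]))).
  by apply: msrU; apply: msrI => //; exact: msrC.
have upE x b : x i = b -> up b x = x.
  by move=> xi; apply/funext => j; rewrite /up; case: eqVneq => // ->.
apply/seteqP; split=> x /=; last first.
  by move=> [[fx]|[/negP/negbTE fx]]; rewrite upE.
by case E: (f x i) => Afx; [left|right]; rewrite upE.
Qed.

End cube.

(** * Finite measures on the Baire sets *)

Section finite_measures.
Context (R : realType) (I : choiceType).
Local Notation X := (I -> bool).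
Implicit Types (A B C : set X) (m : set X -> R).

(** Finite positive measures as real functions on all sets, with arbitrary values off [msr]. Finite
    additivity and continuity at the empty set together amount to countable additivity. *)
Record fmeas m : Prop := FMeas {
  fm_ge0 : forall A, msr A -> 0 <= m A ;
  fm_U : forall A B, msr A -> msr B -> A `&` B = set0 -> m (A `|` B) = m A + m B ;
  fm_cvg : forall A : nat -> set X, (forall n, msr (A n)) ->
    (forall n, A n.+1 `<=` A n) -> \bigcap_n A n = set0 ->
    forall e : R, 0 < e -> exists n, m (A n) < e }.

Section theory.
Variables (m : set X -> R) (fm : fmeas m).

Lemma fm_IC A B : msr A -> msr B -> m A = m (A `&` B) + m (A `\` B).
Proof.
move=> mA mB; rewrite -(fm_U fm) ?setUIDK //; [exact: msrI|exact: msrD|].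
by rewrite setDE setIACA setICr setI0.
Qed.

Lemma fm0 : m set0 = 0.
Proof.
have := fm_U fm (@msr0 I) (@msr0 I) (setI0 _); rewrite setU0 => h.
by apply: (addrI (m set0)); rewrite -h addr0.
Qed.

Lemma fm_le A B : msr A -> msr B -> A `<=` B -> m A <= m B.
Proof.
move=> mA mB AB; rewrite (fm_IC mB mA) (setIidr AB) lerDl.
by apply: (fm_ge0 fm); exact: msrD.
Qed.

Lemma fm_leU A B : msr A -> msr B -> m (A `|` B) <= m A + m B.
Proof.
move=> mA mB; rewrite (fm_IC (msrU mA mB) mA) lerD //.
  by apply: fm_le; [by apply: msrI => //; exact: msrU|done|exact: subIsetr].
apply: fm_le => //; first by apply: msrD => //; exact: msrU.
by move=> x [[]].
Qed.

Lemma fm_D A B : msr A -> msr B -> B `<=` A -> m (A `\` B) = m A - m B.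
Proof.
by move=> mA mB AB; rewrite (fm_IC mA mB) (setIidr AB) addrC addKr.
Qed.

Lemma fm_cvgE (A : nat -> set X) B : (forall n, msr (A n)) ->
  (forall n, A n.+1 `<=` A n) -> \bigcap_n A n = B ->
  forall e : R, 0 < e -> exists n, m (A n) < m B + e.
Proof.
move=> mA Adec AB e e0.
have mB : msr B by rewrite -AB; exact: msr_bigcap.
have [|||n n_lt] := fm_cvg fm (A := fun n => A n `\` B) _ _ _ e0.
- by move=> n; exact: msrD.
- by move=> n x [/Adec].
- apply/seteqP; split=> // x h; have [_ []] := h 0%N Logic.I.
  by rewrite -AB => n _; case: (h n Logic.I).
exists n; move: n_lt; rewrite fm_D //; first by rewrite ltrBlDl.
by rewrite -AB; exact: bigcap_inf.
Qed.

Lemma fm_cvg_up (A : nat -> set X) : (forall n, msr (A n)) ->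
  (forall n, A n `<=` A n.+1) ->
  forall e : R, 0 < e -> exists n, m (\bigcup_k A k `\` A n) < e.
Proof.
move=> mA Ainc e e0.
apply: (fm_cvg fm (A := fun n => \bigcup_k A k `\` A n) _ _ _ e0) => [n|n x [Ax nA]|].
- by apply: msrD => //; exact: msr_bigcup.
- by split=> // /Ainc.
- by apply/seteqP; split=> // x h; have [[k _ Ak] _] := h 0%N Logic.I; have [] := h k Logic.I.
Qed.

(** The tails decrease to the empty set, since a point lies in at most one of the sets. All
    smallness in the forcing comes from here. *)
Lemma fm_tail (A : nat -> set X) : (forall k, msr (A k)) -> (forall j k x, A j x -> A k x -> j = k) ->
  forall e : R, 0 < e -> exists n, m (\bigcup_k A (n + k)%N) < e.
Proof.
move=> mA disj e e0.
apply: (fm_cvg fm (A := fun n => \bigcup_k A (n + k)%N) _ _ _ e0) => [n|n x [k _ xk]|].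
- exact: msr_bigcup.
- by exists k.+1; rewrite // addnS -addSn.
- apply/seteqP; split=> // x h; have [k _ xk] := h 0%N Logic.I; have [l _ xl] := h k.+1 Logic.I.
  by have := disj _ _ _ xk xl; lia.
Qed.

Lemma fm_bigcup_le (A : nat -> set X) B (e : R) : msr B -> (forall n, msr (A n)) ->
  (forall n, A n `<=` A n.+1) -> (forall n, m (A n `\` B) <= e) ->
  m (\bigcup_k A k `\` B) <= e.
Proof.
move=> mB mA Ainc Ae; apply/ler_addgt0Pr => r r0.
have mU : msr (\bigcup_k A k) by exact: msr_bigcup.
have [n nr] := fm_cvg_up mA Ainc r0.
apply: le_trans (_ : m ((A n `\` B) `|` (\bigcup_k A k `\` A n)) <= _).
  apply: fm_le; [exact: msrD|apply: msrU; exact: msrD|].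
  by move=> x [Ux nBx]; have [Anx|nAnx] := pselect (A n x); [left|right].
apply: le_trans (fm_leU _ _) _; [exact: msrD|exact: msrD|].
by rewrite lerD // ltW.
Qed.

(** Restriction to [B] followed by the image under [f]; the measures in a promise have this form. *)
Lemma fm_restr (B : set X) (f : X -> X) : msr B -> (forall i : I, msr [set x : X | f x i]) ->
  fmeas (fun A => m (B `&` f @^-1` A)).
Proof.
move=> mB mf; have mp A : msr A -> msr (B `&` f @^-1` A).
  by move=> mA; apply: msrI => //; exact: (msr_preimage mf).
split=> [A mA|A C mA mC AC|A mA Adec A0 e e0]; first by apply: (fm_ge0 fm); exact: mp.
  rewrite preimage_setU setIUr (fm_U fm) //; [exact: mp|exact: mp|].
  by rewrite setIACA -preimage_setI AC preimage_set0 setI0.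
apply: (fm_cvg fm (A := fun n => B `&` f @^-1` A n) _ _ _ e0) => [n|n x [Bx /Adec]|] //.
  exact: mp.
apply/seteqP; split=> // x h.
have : (\bigcap_n A n) (f x); last by rewrite A0.
by move=> n _; case: (h n Logic.I).
Qed.

End theory.

Lemma fm_zero : fmeas (fun=> 0 : R).
Proof. by split=> [//|A B _ _ _|A _ _ _ e e0]; [rewrite addr0|exists 0%N]. Qed.

Lemma fm_add m1 m2 : fmeas m1 -> fmeas m2 -> fmeas (fun A => m1 A + m2 A).
Proof.
move=> fm fs; split=> [A mA|A B mA mB AB|A mA Adec A0 e e0].
- by rewrite addr_ge0 // ?(fm_ge0 fm) // (fm_ge0 fs).
- by rewrite (fm_U fm) // (fm_U fs) // addrACA.
- have e2 : 0 < e / 2 by rewrite divr_gt0.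
  have [n1 h1] := fm_cvg fm mA Adec A0 e2.
  have [n2 h2] := fm_cvg fs mA Adec A0 e2.
  have Adec' k n : (k <= n)%N -> A n `<=` A k.
    elim: n => [|n ih]; first by rewrite leqn0 => /eqP ->.
    by rewrite leq_eqVlt => /orP[/eqP -> //|/ih kn]; exact: subset_trans (Adec n) kn.
  exists (maxn n1 n2); rewrite [ltRHS](splitr e) ltrD //.
    by apply: le_lt_trans h1; apply: (fm_le fm) => //; apply: Adec'; rewrite leq_maxl.
  by apply: le_lt_trans h2; apply: (fm_le fs) => //; apply: Adec'; rewrite leq_maxr.
Qed.

End finite_measures.

(** An alias that carries the algebra of clopen sets, on which contents are extended to measures. *)
Definition cube_algebra (I : choiceType) : Type := I -> bool.

Section cube_algebra.
Variable I : choiceType.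
Local Notation X := (cube_algebra I).

HB.instance Definition _ := Pointed.copy X (I -> bool).

Let clop_U : setU_closed (@clop I setT).
Proof. by move=> A B; exact: clopU. Qed.
Let clop_C : setC_closed (@clop I setT).
Proof. by move=> A; exact: clopC. Qed.

HB.instance Definition _ := @isAlgebraOfSets.Build default_measure_display X
  (@clop I setT) (clop0 setT) clop_U clop_C.
End cube_algebra.

Section content_extension.
Context (R : realType) (I : choiceType).
Local Notation X := (I -> bool).
Variable T : set X -> R.
Hypothesis T_ge0 : forall A, clop setT A -> 0 <= T A.
Hypothesis T_U : forall A B, clop setT A -> clop setT B -> A `&` B = set0 ->
  T (A `|` B) = T A + T B.

Let cT (A : set (cube_algebra I)) : \bar R := (if `[< clop setT A >] then T A else 0)%:E.

Let cTE (A : set X) : clop setT A -> cT A = (T A)%:E.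
Proof. by move=> cA; rewrite /cT asboolT. Qed.

Let T0 : T set0 = 0.
Proof.
have := T_U (clop0 setT) (clop0 setT) (setI0 _); rewrite setU0 => h.
by apply: (addrI (T set0)); rewrite -h addr0.
Qed.

Let cT0 : cT set0 = 0%E.
Proof. by rewrite cTE ?T0 //; exact: clop0. Qed.

Let cT_ge0 A : (0 <= cT A)%E.
Proof. by rewrite lee_fin; case: asboolP => // cA; exact: T_ge0. Qed.

(* By compactness a disjoint union of clopen sets that is clopen is finite. *)
Let cT_sigma : semi_sigma_additive cT.
Proof.
move=> F mF tF mU.
pose B n : set X := \big[setU/set0]_(i < n) F i.
have cF i : clop setT (F i : set X) by exact: mF.
have cB n : clop setT (B n).
  by rewrite /B; elim/big_ind : _ => //; [exact: clop0|exact: clopU].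
have [N BN] : exists N, \bigcup_n F n `<=` B N.
  apply: contrapT => nex.
  have [|n|n|x xD] := @clop_decr_nonempty I (fun n => \bigcup_n F n `\` B n).
  - by move=> n; apply: clopD.
  - by move=> x [Fx nB]; split=> // Bx; apply: nB; rewrite /B big_ord_recr; left.
  - apply: contrapT => n0; apply: nex; exists n => x Fx; apply: contrapT => nBx.
    by apply: n0; exists x.
  - have [[k _ Fk] _] := xD 0%N Logic.I; have [_ []] := xD k.+1 Logic.I.
    by rewrite /B big_ord_recr; right.
have TB n : T (B n) = \sum_(i < n) T (F i).
  elim: n => [|n ih]; first by rewrite /B !big_ord0.
  rewrite big_ord_recr -ih /= -T_U //; first by rewrite /B big_ord_recr.
  rewrite -subset0 => x [Bx Fx]; move: Bx; rewrite /B -bigcup_mkord => -[k /= kn Fk].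
  have : k = n by apply: (tF _ _ Logic.I Logic.I); exists x.
  by move=> kn'; rewrite kn' ltnn in kn.
have BE n : (N <= n)%N -> B n = \bigcup_n F n.
  move=> Nn; apply/seteqP; split=> [x|x /BN].
    by rewrite /B -bigcup_mkord => -[k _ Fk]; exists k.
  by rewrite /B -!bigcup_mkord => -[k /= kN Fk]; exists k => //=; exact: leq_trans Nn.
apply: (@cvg_near_cst _ _ _ _ _ _) => //.
near=> n; apply/eqP.
rewrite big_mkord (eq_bigr (fun i : 'I_n => (T (F i))%:E)) => [|i _]; last exact: cTE.
rewrite sumEFin -TB BE ?cTE //; near: n; exact: nbhs_infty_ge.
Unshelve. all: by end_near. Qed.

HB.instance Definition _ := isMeasure.Build _ _ _ cT cT0 cT_ge0 cT_sigma.

(** Caratheodory's extension; the values are finite because the whole cube is clopen. *)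
Lemma content_extension : exists m, fmeas m /\ forall A, clop setT A -> m A = T A.
Proof.
pose mu : {measure set _ -> \bar R} := measure_extension cT.
have muE A : clop setT A -> mu A = (T A)%:E.
  by move=> cA; rewrite -cTE //; exact: measurable_mu_extE.
have mfin A : msr A -> mu A \is a fin_num.
  move=> mA; rewrite ge0_fin_numE // (@le_lt_trans _ _ (mu setT)) //.
    by apply: le_measure; rewrite ?inE //; exact: msrT.
  by rewrite muE ?ltry //; exact: clopT.
exists (fun A => fine (mu A)); split; last by move=> A cA; rewrite muE.
split=> [A mA|A B mA mB AB|A mA Adec A0 e e0].
- exact: fine_ge0.
- by rewrite measureU // fineD ?mfin.
- have Adec' : nonincreasing_seq A.
    apply/nonincreasing_seqP => n; rewrite subsetEset; exact: Adec.
  have h : mu \o A @ \oo --> mu (\bigcap_n A n).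
    apply: nonincreasing_cvg_mu => //; last exact: msr_bigcap.
    by rewrite -ge0_fin_numE // mfin.
  rewrite A0 measure0 in h.
  move/fine_cvgP : h => [_ /cvgrPdist_lt/(_ e e0)[n _ /(_ n)]] /= h.
  by exists n; move: (h (leqnn n)); rewrite sub0r normrN ger0_norm // fine_ge0.
Qed.
End content_extension.

(** * Normalised linear combinations and their ultralimits *)

Lemma exists_kernel_row (F : fieldType) (n p : nat) (A : 'M[F]_(n, p)) :
  (p < n)%N -> exists2 v : 'rV_n, v != 0 & v *m A = 0.
Proof.
move=> pn; exists (nz_row (kermx A)); last by apply/sub_kermxP; exact: nz_row_sub.
rewrite nz_row_eq0 -mxrank_eq0 mxrank_ker subn_eq0 -ltnNge.
exact: leq_ltn_trans (rank_leq_col A) pn.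
Qed.

Section normalized_combinations.
Context (R : realType) (c : nat -> nat -> R) (b : nat -> nat).
Hypothesis c_supp : forall n k, (b n <= k)%N -> c n k = 0.
Hypothesis c_free : forall p (t : 'I_p -> R),
  (forall k, \sum_(n < p) t n * c n k = 0) -> forall n, t n = 0.

Lemma exists_normalized_comb p (phi : 'I_p -> nat -> R) : exists q (s : 'I_q -> R) (lam : nat -> R) N,
  [/\ forall k, lam k = \sum_(n < q) s n * c n k,
      forall k, (N <= k)%N -> lam k = 0,
      \sum_(k < N) `|lam k| = 1
    & forall i, \sum_(k < N) lam k * phi i k = 0].
Proof.
pose N := (\max_(n < p.+1) b n)%N.
have [v v0 vA] := exists_kernel_row (\matrix_(n < p.+1, i < p) \sum_(k < N) c n k * phi i k) (ltnSn p).
pose l0 k := \sum_(n < p.+1) v 0 n * c n k.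
have l0N k : (N <= k)%N -> l0 k = 0.
  move=> Nk; rewrite /l0 big1 // => n _; rewrite c_supp ?mulr0 //.
  by apply: leq_trans Nk; exact: (leq_bigmax (F := fun n : 'I_p.+1 => b n)).
pose nu : R := \sum_(k < N) `|l0 k|.
have nu0 : nu != 0.
  apply: contra_neq v0 => nu0; apply/rowP => n; rewrite mxE.
  apply: (c_free (t := fun n => v 0 n)) => k; have [Nk|kN] := leqP N k; first exact: l0N.
  move/eqP: nu0; rewrite /nu psumr_eq0 // => /allP/(_ (Ordinal kN) (mem_index_enum _)) /=.
  by rewrite normr_eq0 => /eqP.
have nu_gt0 : 0 < nu by rewrite lt_neqAle eq_sym nu0 sumr_ge0.
exists p.+1, (fun n => nu^-1 * v 0 n), (fun k => nu^-1 * l0 k), N; split.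
- by move=> k; rewrite mulr_sumr; apply: eq_bigr => n _; rewrite mulrA.
- by move=> k /l0N ->; rewrite mulr0.
- under eq_bigr => k _ do rewrite normrM gtr0_norm ?invr_gt0 //.
  by rewrite -mulr_sumr mulVf.
- move=> i; under eq_bigr => k _ do rewrite -mulrA.
  rewrite -mulr_sumr; apply/eqP; rewrite mulf_eq0 invr_eq0 (negPf nu0) /=; apply/eqP.
  have := congr1 (fun M : 'rV_p => M 0 i) vA; rewrite !mxE => vAi; rewrite -[RHS]vAi {vAi vA}.
  under [RHS]eq_bigr => n _ do rewrite mxE mulr_sumr.
  rewrite exchange_big /=; apply: eq_bigr => k _; rewrite /l0 mulr_suml.
  by apply: eq_bigr => n _; rewrite mulrA.
Qed.

(** The n-th combination meets [n + n] conditions: it is killed by the first [n] functionals and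
    vanishes at the first [n] indices. The latter pushes the supports to infinity, where the fibres
    over the atoms have small mass. *)
Lemma exists_normalized_seq (phi : nat -> nat -> R) :
  exists (lam : nat -> nat -> R) (N : nat -> nat), forall n,
  [/\ exists q (s : 'I_q -> R), forall k, lam n k = \sum_(i < q) s i * c i k,
      forall k, (k < n)%N || (N n <= k)%N -> lam n k = 0,
      \sum_(k < N n) `|lam n k| = 1
    & forall i, (i < n)%N -> \sum_(k < N n) lam n k * phi i k = 0].
Proof.
have h n : exists lN : (nat -> R) * nat,
  [/\ exists q (s : 'I_q -> R), forall k, lN.1 k = \sum_(i < q) s i * c i k,
      forall k, (k < n)%N || (lN.2 <= k)%N -> lN.1 k = 0,
      \sum_(k < lN.2) `|lN.1 k| = 1
    & forall i, (i < n)%N -> \sum_(k < lN.2) lN.1 k * phi i k = 0].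
  pose psi (i : 'I_(n + n)) (k : nat) : R := match fintype.split i with
    | inl j => phi j k | inr j => (k == j)%:R end.
  have [q [s [lam [N [lamE lamN lam1 lam0]]]]] := exists_normalized_comb psi.
  exists (lam, N); split=> //=.
  - by exists q, s.
  - move=> k; have [Nk _|kN /= kn] := leqP N k; first exact: lamN.
    rewrite orbF in kn.
    have := lam0 (unsplit (inr (Ordinal kn))).
    have psiE j : psi (unsplit (inr (Ordinal kn))) j = (j == k)%:R by rewrite /psi unsplitK.
    under eq_bigr => j _ do rewrite psiE.
    rewrite (bigD1 (Ordinal kN)) //= eqxx mulr1 big1 ?addr0 // => j jk.
    by rewrite (_ : (j == k :> nat) = false) ?mulr0 //; apply/negbTE.
  - move=> i ni; rewrite -[RHS](lam0 (unsplit (inl (Ordinal ni)))).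
    have psiE j : psi (unsplit (inl (Ordinal ni))) j = phi i j by rewrite /psi unsplitK.
    by apply: eq_bigr => j _; rewrite psiE.
have [f fP] := choice h.
by exists (fun n => (f n).1), (fun n => (f n).2).
Qed.

End normalized_combinations.

Section ultralimits.
Context (R : realType) (F : set_system nat) (UF : UltraFilter F).

Lemma real_ulim (u : nat -> R) (M : R) : (forall n, `|u n| <= M) ->
  exists l : R, forall e : R, 0 < e -> F [set n | `|u n - l| < e].
Proof.
move=> uM.
have [|l [_ lP]] := @segment_compact R (- M) M (u @ F) _.
  by apply: (@filterS _ F _ setT) filterT => n _ /=; rewrite in_itv /= -ler_norml.
exists l => e e0; have [//|nF] := in_ultra_setVsetC [set n | `|u n - l| < e] UF.
have [||x [/= [n nn <-] un]] := lP (u @` (~` [set n | `|u n - l| < e])) (ball l e) _ _.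
- by apply: (@filterS _ F _ _ _ _ nF) => n h; exists n.
- exact: nbhsx_ballx.
- by exfalso; apply: nn; rewrite /= distrC.
Qed.

(** Along an ultrafilter the limit exists on all sets at once, and additivity passes to it. On
    clopen sets additivity is enough for an extension to a measure. *)
Lemma ulim_measure (I : choiceType) (lam : nat -> nat -> R) (N : nat -> nat) (a : nat -> I -> bool) :
  (forall n, \sum_(k < N n) `|lam n k| = 1) ->
  exists m, fmeas m /\ forall A, clop setT A -> forall e : R, 0 < e ->
    F [set n | `|\sum_(k < N n) `|lam n k| * \1_A (a k) - m A| < e].
Proof.
move=> lam1.
pose u (A : set (I -> bool)) n : R := \sum_(k < N n) `|lam n k| * \1_A (a k).
have u0 A n : 0 <= u A n.
  by apply: sumr_ge0 => k _; rewrite mulr_ge0 // indicE ler0n.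
have uM A n : `|u A n| <= 1.
  rewrite ger0_norm // -(lam1 n); apply: ler_sum => k _.
  by rewrite -[leRHS]mulr1 ler_wpM2l // indicE lern1 leq_b1.
have [T TP] := choice (fun A => real_ulim (uM A)).
have Fex (P : set nat) : F P -> exists n, P n by move=> FP; exact: (@filter_ex _ F).
have [||m [fm mE]] := @content_extension R I T.
- move=> A _; rewrite leNgt; apply/negP => TA.
  have [n] := Fex _ (TP A (- T A) ltac:(by rewrite oppr_gt0)).
  by rewrite /= ltr_norml => /andP[_]; rewrite ltrBlDr addNr ltNge u0.
- move=> A B _ _ AB; apply/eqP; rewrite -subr_eq0 -normr_le0; apply/ler_addgt0Pr => e e0.
  have e3 : 0 < e / 3 by rewrite divr_gt0.
  have [n [hU [hA hB]]] := Fex _ (filterI (TP (A `|` B) _ e3) (filterI (TP A _ e3) (TP B _ e3))).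
  have uU : u (A `|` B) n = u A n + u B n.
    rewrite /u -big_split /=; apply: eq_bigr => k _; rewrite -mulrDr; congr (_ * _).
    rewrite !indicE !in_setU -natrD; congr (_%:R).
    case: (boolP (a k \in A)) => //; case: (boolP (a k \in B)) => // /set_mem aB /set_mem aA.
    by have : (A `&` B) (a k) by []; rewrite AB.
  rewrite /= in hU hA hB; move: hU; rewrite uU.
  move: hA hB; rewrite !ltr_norml => /andP[h1 h2] /andP[h3 h4] /andP[h5 h6].
  by rewrite add0r ler_norml; apply/andP; split; lra.
by exists m; split=> // A cA e e0; rewrite mE //; exact: TP.
Qed.

End ultralimits.

(** * The forcing step *)

Section forcing.
Context (R : realType) (I : choiceType) (S : set I).
Local Notation X := (I -> bool).
Variable theta : nat -> set X -> R.
Hypothesis fm_theta : forall i, fmeas (theta i).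

(* Approximations of the disjoint open sets U and V that a stage adds.  A
   condition promises that at most [cd] will be added to the union [cu `|` cv],
   as measured by each of the first [cm] measures. *)
Record cond := Cond { cu : set X ; cv : set X ; cd : R ; cm : nat }.

Definition cond_ok p := [/\ clop S (cu p), clop S (cv p), cu p `&` cv p = set0 & 0 < cd p].

Definition Theta n (A : set X) : R := \sum_(i < n) theta i A.

(** The last clause is a budget: the mass that [q] adds and the allowance [cd q] together do not
    exceed [cd p]. Hence the costs along a chain sum up to at most the initial allowance. *)
Definition cond_le p q := [/\ cu p `<=` cu q, cv p `<=` cv q, (cm p <= cm q)%N &
  Theta (cm p) ((cu q `|` cv q) `\` (cu p `|` cv p)) <= cd p - cd q].

Lemma fm_Theta n : fmeas (Theta n).
Proof.
elim: n => [|n ih]; rewrite /Theta.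
  by under eq_fun do rewrite big_ord0; exact: fm_zero.
by under eq_fun do rewrite big_ord_recr /=; exact: fm_add.
Qed.

Lemma theta_le_Theta i n A : msr A -> (i < n)%N -> theta i A <= Theta n A.
Proof.
move=> mA lt_in; rewrite /Theta (bigD1 (Ordinal lt_in)) //= lerDl sumr_ge0 // => j _.
exact: (fm_ge0 (fm_theta j)).
Qed.

Lemma Theta_le n n' A : msr A -> (n <= n')%N -> Theta n A <= Theta n' A.
Proof.
move=> mA nn'; rewrite /Theta -!(big_mkord xpredT (fun i => theta i A)).
rewrite (big_cat_nat _ nn') //= lerDl; apply: sumr_ge0 => i _.
exact: (fm_ge0 (fm_theta i)).
Qed.

Lemma cond_le_refl p : cond_le p p.
Proof. by split=> //; rewrite subrr setDv (fm0 (fm_Theta _)). Qed.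

Lemma cond_le_trans p q r : cond_ok p -> cond_ok q -> cond_ok r ->
  cond_le p q -> cond_le q r -> cond_le p r.
Proof.
move=> [cup cvp _ _] [cuq cvq _ _] [cur cvr _ _] [upq vpq mpq hpq] [uqr vqr mqr hqr].
split; [exact: subset_trans uqr|exact: subset_trans vqr|exact: leq_trans mqr|].
have mp : msr (cu p `|` cv p) by apply: (@msr_clop _ S); exact: clopU.
have mq : msr (cu q `|` cv q) by apply: (@msr_clop _ S); exact: clopU.
have mr : msr (cu r `|` cv r) by apply: (@msr_clop _ S); exact: clopU.
pose A := (cu q `|` cv q) `\` (cu p `|` cv p).
pose B := (cu r `|` cv r) `\` (cu q `|` cv q).
apply: le_trans (_ : Theta (cm p) (A `|` B) <= _).
  apply: (fm_le (fm_Theta _)); [exact: msrD|apply: msrU; exact: msrD|].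
  move=> x [xr xp]; have [xq|xq] := pselect ((cu q `|` cv q) x); first by left.
  by right.
apply: le_trans (fm_leU (fm_Theta _) _ _) _; [exact: msrD|exact: msrD|].
have : Theta (cm p) B <= Theta (cm q) B by apply: Theta_le => //; exact: msrD.
rewrite /A /B in hpq hqr *; lra.
Qed.

(** A Rasiowa-Sikorski argument with one requirement met at each step. Requirements need not survive
    extension; each is recovered for the unions from the fact that these exceed [p] by at most
    [cd p] in the first [cm p] measures. *)
Lemma generic (T : countType) (D : T -> cond -> Prop) p0 : cond_ok p0 ->
  (forall t p, cond_ok p -> exists q, [/\ cond_ok q, cond_le p q & D t q]) ->
  exists (u v : nat -> set X),
    [/\ forall k, clop S (u k) /\ clop S (v k),
        forall k, u k `<=` u k.+1 /\ v k `<=` v k.+1,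
        (\bigcup_k u k) `&` (\bigcup_k v k) = set0,
        (forall i, (i < cm p0)%N ->
           theta i ((\bigcup_k u k `|` \bigcup_k v k) `\` (cu p0 `|` cv p0)) <= cd p0)
      & forall t, exists p, [/\ D t p, cond_ok p,
          cu p `<=` \bigcup_k u k, cv p `<=` \bigcup_k v k &
          forall i, (i < cm p)%N ->
            theta i ((\bigcup_k u k `|` \bigcup_k v k) `\` (cu p `|` cv p)) <= cd p]].
Proof.
move=> ok0 dense.
have h (tp : nat * cond) : exists q, cond_ok tp.2 -> [/\ cond_ok q, cond_le tp.2 q &
    forall t : T, unpickle tp.1 = Some t -> D t q].
  have [ok|nok] := pselect (cond_ok tp.2); last by exists tp.2.
  case E : (unpickle tp.1) => [t|]; last by exists tp.2 => _; split=> //; exact: cond_le_refl.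
  by have [q [oq pq Dq]] := dense t _ ok; exists q => _; split=> // t' [<-].
have [f fP] := choice h.
pose p := fix p n := if n is n'.+1 then f (n', p n') else p0.
have okp n : cond_ok (p n).
  by elim: n => //= n ih; have [] := fP (n, p n) ih.
have lep n : cond_le (p n) (p n.+1) by have [] := fP (n, p n) (okp n).
have Dp n t : unpickle n = Some t -> D t (p n.+1).
  by have [_ _] := fP (n, p n) (okp n); apply.
have lepk n k : cond_le (p n) (p (n + k)%N).
  elim: k => [|k ih]; first by rewrite addn0; exact: cond_le_refl.
  rewrite addnS; exact: cond_le_trans (lep _).
have up n k : cu (p n) `<=` cu (p (n + k)%N) by have [] := lepk n k.
have vp n k : cv (p n) `<=` cv (p (n + k)%N) by have [] := lepk n k.
have mu n : msr (cu (p n)) by have [h1 _ _ _] := okp n; exact: msr_clop h1.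
have mv n : msr (cv (p n)) by have [_ h1 _ _] := okp n; exact: msr_clop h1.
have bound n i : (i < cm (p n))%N -> theta i
    ((\bigcup_k cu (p k) `|` \bigcup_k cv (p k)) `\` (cu (p n) `|` cv (p n))) <= cd (p n).
  move=> ilt.
  have -> : \bigcup_k cu (p k) `|` \bigcup_k cv (p k) =
      \bigcup_k (cu (p (n + k)%N) `|` cv (p (n + k)%N)).
    apply/seteqP; split=> x.
      move=> [] [k _ xk]; exists k => //; rewrite addnC; [left|right].
        exact: up xk.
      exact: vp xk.
    by move=> [k _ []] xk; [left|right]; exists (n + k)%N.
  apply: (fm_bigcup_le (fm_theta i)) => [||k|k].
  - exact: msrU.
  - by move=> k; exact: msrU.
  - rewrite addnS; have [u_ v_ _ _] := lep (n + k)%N.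
    by move=> x [/u_|/v_]; [left|right].
  - have [_ _ _ h1] := lepk n k; have [_ _ _ d0] := okp (n + k)%N.
    apply: le_trans (theta_le_Theta _ ilt) _; first by apply: msrD; exact: msrU.
    by apply: le_trans h1 _; rewrite gerBl ltW.
exists (fun n => cu (p n)), (fun n => cv (p n)); split.
- by move=> k; have [] := okp k.
- by move=> k; have [] := lep k.
- apply/seteqP; split=> // x [[k _ xk] [l _ xl]].
  have [_ _ <- _] := okp (k + l)%N; split; first exact: up xk.
  by rewrite addnC; exact: vp xl.
- exact: (bound 0%N).
- move=> t; exists (p (pickle t).+1); split=> //.
  + by apply: Dp; rewrite pickleK.
  + by move=> x xp; exists (pickle t).+1.
  + by move=> x xp; exists (pickle t).+1.
  + exact: bound.
Qed.

End forcing.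

(** * Small neighbourhoods of fibres and small cylinders *)

Section small_sets.
Context (R : realType) (I : choiceType).
Local Notation X := (I -> bool).

(** The fibres over the points [a k] are disjoint Baire sets, so those with [n1 <= k] have small
    total mass. Finitely many of them are the decreasing intersection of clopen neighbourhoods, one
    of which is still small. The bound [n1] depends neither on [M] nor on the coordinates [J0] that
    are to be included. *)
Lemma fiber_small (S : set I) (a : nat -> X) (theta : set X -> R) :
  countable S -> S !=set0 -> (forall k l, agree S (a k) (a l) -> k = l) -> fmeas theta ->
  forall eta : R, 0 < eta -> exists n1, forall n M (J0 : seq I), (n1 <= n)%N -> [set` J0] `<=` S ->
    exists J : seq I, [/\ [set` J0] `<=` [set` J], [set` J] `<=` S &
      theta [set x | exists k, (n <= k < M)%N /\ agree [set` J] (a k) x] < eta].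
Proof.
move=> cS S0 ainj fm eta eta0.
have [e eS] := countable_enum S0 cS.
pose cyl (J0 : seq I) k l := [set x | agree [set` J0 ++ [seq e i | i <- iota 0 l]] (a k) x].
pose fib k := [set x | agree S (a k) x].
have fibE k : fib k = \bigcap_l (cyl [::] k l).
  apply/seteqP; split=> x.
    move=> xS l _ i /= /mapP[j _ ->]; apply: xS; rewrite -eS; by exists j.
  move=> h i; rewrite -eS => -[j _ <-]; apply: (h j.+1 Logic.I).
  by rewrite /= -/(iota 0 j.+1) -map_cons; apply: map_f; rewrite (mem_iota 0 j.+1) /= add0n.
have mcyl J0 k l : msr (cyl J0 k l).
  by apply: (@msr_clop _ setT); apply: clop_agrees.
have mfib k : msr (fib k) by rewrite fibE; apply: msr_bigcap.
pose B n := \bigcup_k fib (n + k)%N.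
have mB n : msr (B n) by apply: msr_bigcup.
have [|n1 Bn1] := fm_tail fm mfib _ eta0.
  by move=> k l x xk xl; apply: ainj; apply: agree_trans xk _; exact: agree_sym.
exists n1 => n M J0 n1n J0S.
pose G l := [set x | exists k, (n <= k < M)%N /\ cyl J0 k l x].
have cG l : msr (G l).
  have -> : G l = [set x | exists2 k, k \in iota n (M - n) & cyl J0 k l x].
    apply/seteqP; split=> x [k].
      by move=> [knM xk]; exists k => //; rewrite mem_iota; lia.
    by move=> ks xk; exists k; split=> //; move: ks; rewrite mem_iota; lia.
  by apply: (@msr_clop _ setT); apply: clop_bigcup => k; exact: clop_agrees.
have Gdec l : G l.+1 `<=` G l.
  move=> x [k [knM xk]]; exists k; split=> // i iJ; apply: xk; move: iJ.
  rewrite /= !mem_cat => /orP[->//|/mapP[j jl ->]]; apply/orP; right.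
  by apply: (map_f e (s := iota 0 l.+1)); move: jl; rewrite !mem_iota; lia.
have capG : \bigcap_l G l `<=` B n1.
  move=> x xG; apply: contrapT => nB.
  have bad k : (n <= k)%N -> exists i, a k (e i) <> x (e i).
    move=> nk; apply: contrapT => ne; apply: nB; exists (k - n1)%N => //.
    rewrite subnKC; last exact: leq_trans nk.
    move=> j; rewrite -eS => -[i _ <-]; apply: contrapT => ax; apply: ne; by exists i.
  have bad' k : exists i, (n <= k)%N -> a k (e i) <> x (e i).
    have [nk|kn] := leqP n k; first by have [i ai] := bad k nk; exists i.
    by exists 0%N.
  have [f fP] := choice bad'.
  have [k [/andP[nk kM] xk]] := xG (\max_(k < M) (f k)).+1 Logic.I.
  apply: (fP k nk); apply: xk => /=; rewrite mem_cat; apply/orP; right.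
  apply: (map_f e (s := iota 0 (\max_(k < M) f k).+1)); rewrite mem_iota add0n ltnS leq0n /=.
  exact: (leq_bigmax (F := fun k : 'I_M => f k) (Ordinal kM)).
have eta1 : 0 < eta - theta (B n1) by rewrite subr_gt0.
have [l Gl] := fm_cvgE fm cG Gdec erefl eta1.
exists (J0 ++ [seq e i | i <- iota 0 l]); split.
- by move=> i /= iJ; rewrite mem_cat iJ.
- move=> i /=; rewrite mem_cat => /orP[/J0S //|/mapP[j _ ->]].
  by rewrite -eS; exists j.
- apply: lt_le_trans Gl _.
  have : theta (\bigcap_l G l) <= theta (B n1).
    by apply: (fm_le fm) => //; exact: msr_bigcap.
  lra.
Qed.

Lemma separating_seq (S : set I) (a : nat -> X) M :
  (forall k l, agree S (a k) (a l) -> k = l) -> exists J : seq I, [set` J] `<=` S /\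
    forall k l, (k < M)%N -> (l < M)%N -> agree [set` J] (a k) (a l) -> k = l.
Proof.
move=> ainj.
have [[i0 Si0]|I0] := pselect (exists i, S i); last first.
  exists [::]; split=> // k l _ _ _; apply: ainj => i Si; by case: I0; exists i.
have h (kl : nat * nat) : exists i, kl.1 <> kl.2 -> S i /\ a kl.1 i <> a kl.2 i.
  have [E|ne] := pselect (kl.1 = kl.2); first by exists i0.
  apply: contrapT => nex; apply: ne; apply: ainj => i Si; apply: contrapT => ai.
  by apply: nex; exists i.
have [f fP] := choice h.
exists [seq f kl | kl <- [seq kl <- [seq (k, l) | k <- iota 0 M, l <- iota 0 M] | kl.1 != kl.2]].
split.
  move=> i /= /mapP[kl]; rewrite mem_filter => /andP[/eqP ne _] ->.
  by have [] := fP kl ne.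
move=> k l kM lM kl; apply: contrapT => ne.
have [_ /=] := fP (k, l) ne; apply; apply: kl => /=.
apply: map_f; rewrite mem_filter /=; apply/andP; split; first exact/eqP.
by apply/allpairsP; exists (k, l); rewrite !mem_iota /= !add0n.
Qed.

Section cylinders.
Variable iot : nat -> I.

(** Basic clopen sets of the Cantor set given by the coordinates in the range of [iot]. *)
Definition cyl (d : nat -> bool) (l : nat) := [set x : X | forall i, (i < l)%N -> x (iot i) = d i].

Lemma clop_cyl (S : set I) d l : range iot `<=` S -> clop S (cyl d l).
Proof.
move=> iS; exists [seq iot i | i <- iota 0 l].
  by move=> i /= /mapP[j _ ->]; apply: iS; exists j.
move=> x y xy xd i il; rewrite -xd // -xy //=; apply: map_f; by rewrite mem_iota.
Qed.

(** A cylinder contains infinitely many disjoint ones, so two of them have small mass. *)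
Lemma small_cyl (theta : set X -> R) d l (eta : R) : fmeas theta -> 0 < eta ->
  exists d1 l1 d2 l2, [/\ cyl d1 l1 `<=` cyl d l, cyl d2 l2 `<=` cyl d l,
    cyl d1 l1 `&` cyl d2 l2 = set0, theta (cyl d1 l1) < eta & theta (cyl d2 l2) < eta].
Proof.
move=> fm eta0.
(* Continue [d] by [k] zeros and a one; different [k] give disjoint cylinders. *)
pose dk k i := if (i < l)%N then d i else i == (l + k)%N.
pose E k := cyl (dk k) (l + k).+1.
have mE k : msr (E k) by apply: (@msr_clop _ setT); exact: clop_cyl.
have El k : E k `<=` cyl d l.
  by move=> x xE i il; rewrite xE ?/dk ?il //; lia.
have Edisj j k x : E j x -> E k x -> j = k.
  suff lt j' k' : (j' < k')%N -> E j' x -> E k' x -> False.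
    by case: (ltngtP j k) => // h xj xk; exfalso; [exact: lt h xj xk|exact: lt h xk xj].
  move=> jk xj xk; have := xk (l + j')%N; rewrite xj // /dk.
  rewrite [(_ < l)%N]ltnNge leq_addr /= eqxx => /(_ ltac:(lia)) /esym/eqP; lia.
pose B n := \bigcup_k E (n + k)%N.
have mB n : msr (B n) by apply: msr_bigcup.
have [n Bn] := fm_tail fm mE Edisj eta0.
exists (dk n), (l + n).+1, (dk n.+1), (l + n.+1).+1; split; [exact: El|exact: El| | |].
- by apply/seteqP; split=> // x [x1 x2]; have := Edisj _ _ _ x1 x2; lia.
- apply: le_lt_trans Bn; apply: (fm_le fm); [exact: (mE n)|exact: mB|].
  by move=> x xE; exists 0%N => //; rewrite addn0.
- apply: le_lt_trans Bn; apply: (fm_le fm); [exact: (mE n.+1)|exact: mB|].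
  by move=> x xE; exists 1%N => //; rewrite addn1.
Qed.

End cylinders.
End small_sets.

(** * Promises and what a stage must do to keep them *)

Section promises.
Context (R : realType) (I : choiceType).
Local Notation X := (I -> bool).

Definition wsum (lam : nat -> R) (N : nat) (xi : nat -> X) (A : set X) : R :=
  \sum_(k < N) lam k * \1_A (xi k).

(* What is guaranteed to survive from a stage at which the diamond sequence
   guessed points [pa k] (known on the coordinates [pS] only) and combinations
   [plam n] of their Dirac measures, with weights on [n, pN n).  The index [r]
   codes a clopen set O, and [pk r c] is the part on O of the limit of the
   measures |plam n|, pushed forward by setting the new coordinate to [c].  By
   [promise1], [plam n] approaches [pT r] on lifts of the guessed points, and by
   [promise2] the measures [pk r c] concentrate near the point [pz c]. *)
Record promise := Promise {
  pS : set I ;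
  pa : nat -> X ;
  plam : nat -> nat -> R ;
  pN : nat -> nat ;
  pz : bool -> X ;
  pk : nat -> bool -> set X -> R }.

(** One half is the share of the mass of [plam n] carried by the atoms of positive weight. *)
Definition pT pi r A : R := (pk pi r true A - pk pi r false A) / 2.

Definition lifts (K : set X) pi (xi : nat -> X) := forall k, K (xi k) /\ agree (pS pi) (pa pi k) (xi k).

Definition promise_ok pi :=
  [/\ pS pi !=set0, forall k l, agree (pS pi) (pa pi k) (pa pi l) -> k = l,
      forall n k, (k < n)%N -> plam pi n k = 0 & forall r b, fmeas (pk pi r b)].

Definition promise1 (S : set I) (K : set X) pi :=
  forall r (Cs : seq (set X)) (e : R) n0, (forall C, C \in Cs -> clop S C) -> 0 < e ->
  exists2 n, (n0 <= n)%N & forall xi, lifts K pi xi -> forall C, C \in Cs ->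
    `|wsum (plam pi n) (pN pi n) xi C - pT pi r C| < e.

Definition promise2 (S : set I) pi :=
  forall C1 C0 (e : R), clop S C1 -> clop S C0 -> C1 (pz pi true) -> C0 (pz pi false) -> 0 < e ->
  exists r, pk pi r true (~` C1) + pk pi r false (~` C0) < e * pk pi r true setT.

(** At the next stage a clopen set is given by a section over [U] and a section off [U], so values
    on [C] and on the traces of [C] on [U] determine everything. The atoms must lie in [U] or [V],
    as otherwise the new coordinate would depend on the lift. *)
Definition keeps1 (S : set I) (K U V : set X) pi :=
  forall r (Cs : seq (set X)) (e : R) n0, (forall C, C \in Cs -> clop S C) -> 0 < e ->
  exists2 n, (n0 <= n)%N & forall xi, lifts K pi xi ->
    (forall k, (k < pN pi n)%N -> plam pi n k != 0 -> U (xi k) \/ V (xi k)) /\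
    forall C, C \in Cs -> `|wsum (plam pi n) (pN pi n) xi C - pT pi r C| < e /\
      `|wsum (plam pi n) (pN pi n) xi (C `&` U) - pT pi r (C `&` U)| < e.

(** A point [pz c] outside [U] continues with value 0, so the measures concentrating there must give
    little mass to [U], where the value is 1. A point in [U] has a clopen neighbourhood inside [U]
    and needs no such bound. *)
Definition keeps2 (S : set I) (U : set X) pi :=
  forall C1 C0 (e : R), clop S C1 -> clop S C0 -> C1 (pz pi true) -> C0 (pz pi false) -> 0 < e ->
  exists r, [/\ pk pi r true (~` C1) + pk pi r false (~` C0) < e * pk pi r true setT,
    ~ U (pz pi true) -> pk pi r true U < e * pk pi r true setT &
    ~ U (pz pi false) -> pk pi r false U < e * pk pi r true setT].

Definition sopen (S : set I) (U : set X) :=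
  exists2 u : nat -> set X, forall k, clop S (u k) & U = \bigcup_k u k.

Lemma eq_wsum (lam : nat -> R) N (xi xi' : nat -> X) A B :
  (forall k, (k < N)%N -> lam k != 0 -> A (xi k) <-> B (xi' k)) ->
  wsum lam N xi A = wsum lam N xi' B.
Proof.
move=> AB; apply: eq_bigr => k _; have [->|lk] := eqVneq (lam k) 0; first by rewrite !mul0r.
by have h := AB k (ltn_ord k) lk; rewrite !indicE; congr (_ * _%:R); congr nat_of_bool; exact/asbool_equiv_eq.
Qed.

Lemma keeps_all (S : set I) (K : set X) pi : promise1 S K pi -> keeps1 S K setT set0 pi.
Proof.
move=> h r Cs e n0 cCs e0; have [n n0n hn] := h r Cs e n0 cCs e0.
exists n => // xi lxi; split=> [k _ _|C Cin]; first by left.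
by rewrite setIT; split; exact: hn.
Qed.

Lemma keeps2_all (S : set I) pi : promise2 S pi -> keeps2 S setT pi.
Proof.
move=> h C1 C0 e c1 c0 z1 z0 e0; have [r ho] := h C1 C0 e c1 c0 z1 z0 e0.
by exists r; split=> // n; exfalso; exact: n.
Qed.

End promises.

Lemma mem_iotaB n N k : (k \in iota n (N - n)) = (n <= k < N)%N.
Proof. by rewrite mem_iota; lia. Qed.

(** The positive part of [l] is half the sum of [l] and its absolute value. The booleans tell
    whether an atom lies in the test set, in O, in the old [u] and in the old [v]. *)
Lemma mulr_pos_part (R : realFieldType) (l : R) (c o u v : bool) : l != 0 -> ~~ (u && v) ->
  l * (c && (u || (0 < l) && o && ~~ v))%:R =
  l * (c && u)%:R + (l * (c && o && ~~ u && ~~ v)%:R + `|l| * (c && o && ~~ u && ~~ v)%:R) / 2.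
Proof.
move=> l0 uv.
case: (ltgtP l 0) l0 => // l0 _; [rewrite (ltr0_norm l0)|rewrite (gtr0_norm l0)];
  by move: uv; case: c; case: o; case: u; case: v => //= _; rewrite ?mulr0 ?mulr1; lra.
Qed.

(** * One stage: dense requirements and a generic pair *)

Section step.
Context (R : realType) (I : choiceType) (S : set I) (cS : countable S).
Local Notation X := (I -> bool).
Variables (iot : nat -> I) (iotS : range iot `<=` S).
Variables (K : set X).
Hypothesis K_irr : forall A, clop S A -> A `&` K !=set0 ->
  exists d l, K `&` cyl iot d l `<=` A.
Hypothesis K_closed : forall x, ~ K x -> exists C, [/\ clop S C, C x & C `&` K = set0].
Variables (pi : nat -> promise R I) (act : nat -> Prop).
Hypothesis pi_ok : forall n, act n -> promise_ok (pi n).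
Hypothesis pi_S : forall n, act n -> pS (pi n) `<=` S.
Hypothesis pi_1 : forall n, act n -> promise1 S K (pi n).
Hypothesis pi_2 : forall n, act n -> promise2 S (pi n).
Variables (b : nat -> X) (lam : nat -> nat -> R) (N : nat -> nat) (tau : set X -> R).
Hypothesis b_K : forall k, K (b k).
Hypothesis b_inj : forall k l, agree S (b k) (b l) -> k = l.
Hypothesis lam0 : forall n k, (k < n)%N -> lam n k = 0.
Hypothesis fm_tau : fmeas tau.
Hypothesis tau1 : tau setT = 1.
Hypothesis lam_tau : forall (Cs : seq (set X)) (e : R) n0, (forall C, C \in Cs -> clop S C) -> 0 < e ->
  exists2 n, (n0 <= n)%N & forall C, C \in Cs -> `|wsum (lam n) (N n) b C| < e /\
    `|wsum (fun k => `|lam n k|) (N n) b C - tau C| < e.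

(** All measures that the forcing has to control, in one sequence: [tau] at index 0, then the
    measures of the active promises. *)
Let theta (i : nat) : set X -> R :=
  if i is i'.+1 then
    if (unpickle i' : option (nat * nat * bool)) is Some (n, r, c) then
      if `[< act n >] then pk (pi n) r c else fun=> 0
    else fun=> 0
  else tau.

Let fm_theta i : fmeas (theta i).
Proof.
case: i => //= i; case: unpickle => [[[n r] c]|]; last exact: fm_zero.
by case: asboolP => [/pi_ok[]//|_]; exact: fm_zero.
Qed.

Let idx n r c := (pickle ((n, r, c) : nat * nat * bool)).+1.

Let thetaE n r c : act n -> theta (idx n r c) = pk (pi n) r c.
Proof. by move=> an; rewrite /theta /idx pickleK asboolT. Qed.

Local Notation cond := (@cond R I).
Local Notation ok := (@cond_ok R I S).
Local Notation le := (@cond_le R I theta).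

(** An instance of [keeps1] with [cu q] for [U]. The allowance [cd q], binding for both measures
    with index [r], bounds the error made in passing from [cu q] to [U]. *)
Let kept1 n r (Cs : seq (set X)) (e : R) n0 (q : cond) :=
  [/\ cd q <= e, forall c, (idx n r c < cm q)%N &
  exists2 n', (n0 <= n')%N & forall xi, lifts K (pi n) xi ->
    (forall k, (k < pN (pi n) n')%N -> plam (pi n) n' k != 0 -> cu q (xi k) \/ cv q (xi k)) /\
    forall C, C \in Cs -> `|wsum (plam (pi n) n') (pN (pi n) n') xi C - pT (pi n) r C| < e /\
      `|wsum (plam (pi n) n') (pN (pi n) n') xi (C `&` cu q) - pT (pi n) r (C `&` cu q)| < e].

Let dense1 n r (Cs : seq (set X)) (e : R) n0 p : act n -> (forall C, C \in Cs -> clop S C) -> 0 < e -> ok p ->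
  exists q, [/\ ok q, le p q & kept1 n r Cs e n0 q].
Proof.
move=> an cCs e0 [cup cvp uvp d0].
(* A neighbourhood of the fibres over the support of [plam n'] goes into [v];
   it is small as soon as [n'] is large. *)
have [S0 ainj plam0 _] := pi_ok an.
have d2 : 0 < cd p / 2 by rewrite divr_gt0.
have cSn : countable (pS (pi n)) by exact: sub_countable (subset_card_le (pi_S an)) cS.
have [n1 hn1] := fiber_small cSn S0 ainj (fm_Theta fm_theta (cm p)) d2.
(* Only [v] will grow, so the estimates on the traces of [cu q = cu p] are instances of the old
   promise. *)
have [|n' n'1 hn'] := pi_1 an r (Cs := Cs ++ [seq C `&` cu p | C <- Cs]) (maxn n0 n1) _ e0.
  by move=> C; rewrite mem_cat => /orP[/cCs //|/mapP[C' C'in ->]]; apply: clopI => //; exact: cCs.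
move: n'1; rewrite geq_max => /andP[n0n' n1n'].
have [|J [_ JS hJ]] := hn1 n' (pN (pi n) n') [::] n1n' _; first by [].
set H := [set x | _] in hJ.
have cH : clop S H.
  have -> : H = [set x | exists2 k, k \in iota n' (pN (pi n) n' - n') & agree [set` J] (pa (pi n) k) x].
    apply/seteqP; split=> x [k].
      by move=> [knM xk]; exists k => //; rewrite mem_iotaB.
    by move=> ks xk; exists k; split=> //; move: ks; rewrite mem_iotaB.
  by apply: clop_bigcup => k; apply: clop_agrees; exact: subset_trans JS (pi_S an).
pose m := maxn (cm p) (maxn (idx n r true) (idx n r false)).+1.
pose q := @Cond R I (cu p) (cv p `|` (H `\` cu p)) (Num.min (cd p / 2) e) m.
have oq : ok q.
  split=> //=; [|by apply/seteqP; split=> // x [xu [xv|[_ /(_ xu)]]] //; rewrite -uvp|].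
    by apply: clopU => //; exact: clopD.
  by rewrite lt_min d2.
have mH : msr H by exact: msr_clop cH.
exists q; split=> //.
  split=> //=; first exact: leq_maxl.
  apply: le_trans (_ : Theta theta (cm p) H <= _); last first.
    have : Num.min (cd p / 2) e <= cd p / 2 by rewrite ge_min lexx.
    lra.
  apply: (fm_le (fm_Theta fm_theta _)) => //.
    apply: (@msr_clop _ S); apply: clopD; last exact: clopU.
    by apply: clopU => //; apply: clopU => //; exact: clopD.
  by move=> x [[xu|[xv|[]//]] nuv]; exfalso; apply: nuv; [left|right].
split=> /=; [by rewrite ge_min lexx orbT|by rewrite /m; case; lia|].
exists n' => // xi lxi; split=> [k kN lk|C Cin]; last first.
  split; apply: hn' => //; rewrite mem_cat ?Cin //.
  by apply/orP; right; apply: map_f.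
have [xu|nxu] := pselect (cu p (xi k)); [by left|right; right; split=> //].
exists k; rewrite kN andbT; split; last by apply: agree_sub JS _; have [_] := lxi k.
by rewrite leqNgt; apply: contra lk => kn'; rewrite plam0.
Qed.

Let kept2 n C1 C0 (e : R) (q : cond) := exists r,
  [/\ pk (pi n) r true (~` C1) + pk (pi n) r false (~` C0) < e * pk (pi n) r true setT,
   ~ cu q (pz (pi n) true) -> pk (pi n) r true (cu q) < e * pk (pi n) r true setT,
   ~ cu q (pz (pi n) false) -> pk (pi n) r false (cu q) < e * pk (pi n) r true setT,
   cd q <= e * pk (pi n) r true setT & forall c, (idx n r c < cm q)%N].

(** For a point outside [cu p] the set [cu p] is removed from its neighbourhood; then [promise2]
    bounds the mass of [cu p] as well. The condition changes only in its allowance and in the number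
    of measures. *)
Let dense2 n C1 C0 (e : R) p : act n -> clop S C1 -> clop S C0 -> C1 (pz (pi n) true) ->
  C0 (pz (pi n) false) -> 0 < e -> ok p ->
  exists q, [/\ ok q, le p q & kept2 n C1 C0 e q].
Proof.
move=> an c1 c0 z1 z0 e0 [cup cvp uvp d0].
have [_ _ _ fk] := pi_ok an.
pose B c C := if `[< cu p (pz (pi n) c) >] then C else C `\` cu p.
have cB c C : clop S C -> clop S (B c C).
  by move=> cC; rewrite /B; case: asboolP => // _; exact: clopD.
have BC c C : B c C `<=` C by rewrite /B; case: asboolP => _ // x [].
have zB c C : C (pz (pi n) c) -> B c C (pz (pi n) c).
  by rewrite /B; case: asboolP => // nu Cz; split.
have [r ho] := pi_2 an (cB true _ c1) (cB false _ c0) (zB true _ z1) (zB false _ z0) e0.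
have mC C : clop S C -> msr C by exact: msr_clop.
have ge0 c C : clop S C -> 0 <= pk (pi n) r c C by move=> cC; apply: (fm_ge0 (fk r c)); exact: mC.
have lek c A C : clop S A -> clop S C -> A `<=` C -> pk (pi n) r c A <= pk (pi n) r c C.
  by move=> cA cC; apply: (fm_le (fk r c)); exact: mC.
have cBC c C : clop S C -> clop S (~` B c C) by move=> cC; exact/clopC/cB.
have g1 := ge0 true _ (cBC true _ c1); have g0 := ge0 false _ (cBC false _ c0).
have pos : 0 < e * pk (pi n) r true setT.
  by apply: le_lt_trans ho; exact: addr_ge0.
pose m := maxn (cm p) (maxn (idx n r true) (idx n r false)).+1.
pose dd := Num.min (cd p) (e * pk (pi n) r true setT).
exists (@Cond R I (cu p) (cv p) dd m); split.
- by split=> //=; rewrite lt_min d0.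
- split=> //=; first exact: leq_maxl.
  by rewrite setDv (fm0 (fm_Theta fm_theta _)) subr_ge0 ge_min lexx.
exists r; split=> /=.
- apply: le_lt_trans ho; apply: lerD; apply: lek; rewrite ?clopC //; try exact: cBC.
  + exact: clopC.
  + by move=> x nC; apply: contra_not nC; exact: BC.
  + exact: clopC.
  + by move=> x nC; apply: contra_not nC; exact: BC.
- move=> nu; apply: le_lt_trans ho; rewrite -[leLHS]addr0; apply: lerD => //.
  by apply: lek => //; [exact: cBC|move=> x xu; rewrite /B asboolF // => -[]].
- move=> nu; apply: le_lt_trans ho; rewrite -[leLHS]add0r; apply: lerD => //.
  by apply: lek => //; [exact: cBC|move=> x xu; rewrite /B asboolF // => -[]].
- by rewrite ge_min lexx orbT.
- by rewrite /m; case; lia.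
Qed.

Let kept3 A (q : cond) := A `&` K `<=` cu q `|` cv q \/
  (exists d l, K `&` cyl iot d l `<=` A `&` cu q) /\ (exists d l, K `&` cyl iot d l `<=` A `&` cv q).

(** Where [A] meets K outside [cu p] and [cv p], irreducibility yields a cylinder, and two small
    disjoint subcylinders of it go to [u] and [v]. *)
Let dense3 A p : clop S A -> ok p -> exists q, [/\ ok q, le p q & kept3 A q].
Proof.
move=> cA okp; have [cup cvp uvp d0] := okp.
have [AK|nAK] := pselect (A `&` K `<=` cu p `|` cv p).
  by exists p; split=> //; [exact: (cond_le_refl fm_theta)|left].
have [||d [l dl]] := K_irr (A := A `\` (cu p `|` cv p)).
- by apply: clopD => //; exact: clopU.
- apply: contrapT => n0; apply: nAK => x [Ax Kx]; apply: contrapT => nuv.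
  by apply: n0; exists x.
have d4 : 0 < cd p / 4 by rewrite divr_gt0.
have [d1 [l1 [d2 [l2 [s1 s2 dis h1 h2]]]]] :=
  small_cyl iot d l (fm_Theta fm_theta (cm p)) d4.
set H1 := cyl iot d1 l1 in s1 dis h1; set H2 := cyl iot d2 l2 in s2 dis h2.
have c1 : clop S H1 by exact: clop_cyl.
have c2 : clop S H2 by exact: clop_cyl.
have m1 : msr H1 by exact: msr_clop c1.
have m2 : msr H2 by exact: msr_clop c2.
(* The cylinders avoid [cu p] and [cv p] on K only, hence the differences. Each costs less than a
   quarter of the allowance, which is halved. *)
pose q := @Cond R I (cu p `|` (H1 `\` cv p)) (cv p `|` (H2 `\` cu p)) (cd p / 2) (cm p).
have cuq : clop S (cu q) by apply: clopU => //; exact: clopD.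
have cvq : clop S (cv q) by apply: clopU => //; exact: clopD.
exists q; split.
- split=> //=; last by rewrite divr_gt0.
  apply/seteqP; split=> // x [[xu|[x1 nv]] [xv|[x2 nu]]] //.
  + by rewrite -uvp.
  + by rewrite -dis.
- split=> //=; try by move=> x; left.
  apply: le_trans (_ : Theta theta (cm p) (H1 `|` H2) <= _).
    apply: (fm_le (fm_Theta fm_theta _)); [|exact: msrU|].
      apply: (@msr_clop _ S); apply: clopD; last exact: clopU.
      exact: clopU.
    by move=> x [[[xu|[x1 _]]|[xv|[x2 _]]] nuv]; [exfalso; apply: nuv; left|left|exfalso; apply: nuv; right|right].
  apply: le_trans (fm_leU (fm_Theta fm_theta _) m1 m2) _.
  lra.
- right; split; [exists d1, l1|exists d2, l2] => x [Kx xc].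
    have [|Ax nuv] := dl x; first by split=> //; exact: s1.
    by split=> //; right; split=> // xv; apply: nuv; right.
  have [|Ax nuv] := dl x; first by split=> //; exact: s2.
  by split=> //; right; split=> // xu; apply: nuv; left.
Qed.

Let kept4 O (Cs : seq (set X)) (e : R) n0 (q : cond) := [/\ cd q <= e, (0 < cm q)%N & exists2 n, (n0 <= n)%N &
  (forall k, (k < N n)%N -> lam n k != 0 -> cu q (b k) \/ cv q (b k)) /\
  forall C, C \in Cs -> `|wsum (lam n) (N n) b C| < e /\
    `|wsum (lam n) (N n) b (C `&` cu q) - tau ((C `&` O) `\` (cu q `|` cv q)) / 2| < e].

Let dense4 O (Cs : seq (set X)) (e : R) n0 p : clop S O -> (forall C, C \in Cs -> clop S C) -> 0 < e -> ok p ->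
  exists q, [/\ ok q, le p q & kept4 O Cs e n0 q].
Proof.
move=> cO cCs e0 [cup cvp uvp d0].
pose eta := Num.min (cd p / 2) (e / 4).
have eta0 : 0 < eta by rewrite lt_min !divr_gt0.
have eta1 : eta <= cd p / 2 by rewrite ge_min lexx.
have eta2 : eta <= e / 4 by rewrite ge_min lexx orbT.
have SS0 : S !=set0 by exists (iot 0%N); apply: iotS; exists 0%N.
(* At least 1, so that [tau], the measure with index 0, is controlled. *)
pose m := maxn (cm p) 1.
have [n1 hn1] := fiber_small cS SS0 b_inj (fm_Theta fm_theta m) eta0.
pose W C := (C `&` O) `\` (cu p `|` cv p).
have cW C : clop S C -> clop S (W C).
  by move=> cC; apply: clopD; [exact: clopI|exact: clopU].
have e4 : 0 < e / 4 by rewrite divr_gt0.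
(* The same [n] must serve the sets [C], their traces on [cu p] and their undecided parts [W C] over
   [O]. *)
have [|n n01 hn] := lam_tau (Cs := Cs ++ [seq C `&` cu p | C <- Cs] ++ [seq W C | C <- Cs]) (maxn n0 n1) _ e4.
  move=> C; rewrite !mem_cat => /orP[/cCs //|/orP[] /mapP[C' C'in ->]].
    by apply: clopI => //; exact: cCs.
  by apply: cW; exact: cCs.
move: n01; rewrite geq_max => /andP[n0n n1n].
(* Separating the atoms makes [Hp] contain those of positive weight and no others. *)
have [J0 [J0S J0sep]] := separating_seq (N n) b_inj.
have [J [J0J JS hJ]] := hn1 n (N n) J0 n1n J0S.
set H := [set x | _] in hJ.
pose Hc (P : pred nat) := [set x | exists2 k, k \in [seq k <- iota n (N n - n) | P k] & agree [set` J] (b k) x].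
have cHc P : clop S (Hc P).
  by apply: clop_bigcup => k; exact: clop_agrees.
have HE : H = Hc xpredT.
  apply/seteqP; split=> x [k].
    by move=> [knM xk]; exists k => //; rewrite mem_filter /= mem_iotaB.
  by move=> ks xk; exists k; split=> //; move: ks; rewrite mem_filter /= mem_iotaB.
have cH : clop S H by rewrite HE.
pose Hp := Hc (fun k => 0 < lam n k).
have cHp : clop S Hp by exact: cHc.
have HpH : Hp `<=` H.
  by rewrite HE => x [k]; rewrite mem_filter => /andP[_ kn] xk; exists k => //; rewrite filter_predT.
(* In O only the atoms of positive weight go into [u]: since the combination is
   nearly balanced, these carry half of the mass of |lam n| on O. *)
pose u' := cu p `|` ((Hp `&` O) `\` cv p).
pose v' := cv p `|` (H `\` u').
have cu' : clop S u' by apply: clopU => //; apply: clopD => //; exact: clopI.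
have cv' : clop S v' by apply: clopU => //; exact: clopD.
have new : (u' `|` v') `\` (cu p `|` cv p) `<=` H.
  move=> x [[[xu|[[xH _] _]]|[xv|[xH _]]] nuv] //; first by exfalso; apply: nuv; left.
    exact: HpH.
  by exfalso; apply: nuv; right.
have mnew : msr ((u' `|` v') `\` (cu p `|` cv p)).
  by apply: (@msr_clop _ S); apply: clopD; exact: clopU.
have mH : msr H by exact: msr_clop cH.
exists (@Cond R I u' v' eta m); split.
- split=> //=; apply/seteqP; split=> // x [[xu|[[xp xO] nv]] [xv|[xH nu']]] //.
  + by rewrite -uvp.
  + by apply: nu'; left.
  + by apply: nu'; right.
- split=> //=; [by left|by left|exact: leq_maxl|].
  apply: le_trans (_ : eta <= _); last by lra.
  apply: le_trans (ltW hJ); apply: le_trans (Theta_le fm_theta mnew (leq_maxl _ 1%N)) _.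
  exact: (fm_le (fm_Theta fm_theta _)).
have supp k : (k < N n)%N -> lam n k != 0 -> k \in iota n (N n - n).
  move=> kN lk; rewrite mem_iotaB kN andbT.
  by rewrite leqNgt; apply: contra lk => kn; rewrite lam0.
have inH k : (k < N n)%N -> lam n k != 0 -> H (b k).
  by move=> kN lk; rewrite HE; exists k; rewrite ?filter_predT ?supp.
have inHp k : (k < N n)%N -> lam n k != 0 -> Hp (b k) <-> 0 < lam n k.
  move=> kN lk; split=> [[l]|l0].
    rewrite mem_filter mem_iotaB => /and3P[l0 _ lN] kl.
    suff -> : k = l by [].
    by apply: J0sep => //; apply: agree_sub J0J _; exact: agree_sym.
  by exists k; rewrite ?mem_filter ?l0 ?supp.
split=> //=; [by lra|by rewrite leq_max orbT|exists n => //; split].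
  move=> k kN lk; have := inH k kN lk => Hk.
  by have [|] := pselect (u' (b k)); [left|right; right; split].
move=> C Cin.
have [hC _] := hn C ltac:(by rewrite !mem_cat Cin).
have [hCu _] := hn (C `&` cu p) ltac:(by rewrite !mem_cat (map_f (fun C => C `&` cu p) Cin) orbT).
have [hW htW] := hn (W C) ltac:(by rewrite !mem_cat (map_f W Cin) !orbT).
split; first by apply: lt_trans hC _; lra.
have -> : wsum (lam n) (N n) b (C `&` u') = wsum (lam n) (N n) b (C `&` cu p) +
    (wsum (lam n) (N n) b (W C) + wsum (fun k => `|lam n k|) (N n) b (W C)) / 2.
  rewrite /wsum -big_split /= mulr_suml -big_split /=; apply: eq_bigr => k _.
  have [lk|lk] := eqVneq (lam n k) 0; first by rewrite lk normr0 !mul0r addr0 mul0r addr0.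
  have hp := inHp k (ltn_ord k) lk.
  have iW : b k \in W C = (b k \in C) && (b k \in O) && (b k \notin cu p) && (b k \notin cv p).
    by rewrite /W in_setD in_setI in_setU negb_or !andbA.
  have iu : b k \in C `&` u' = (b k \in C) && ((b k \in cu p) ||
      ((0 < lam n k) && (b k \in O) && (b k \notin cv p))).
    rewrite in_setI /u' in_setU in_setD in_setI; congr (_ && (_ || _ && _ && _)).
    by apply/idP/idP => [/set_mem/hp|/hp/mem_set].
  have uv : ~~ ((b k \in cu p) && (b k \in cv p)).
    by apply/negP => /andP[/set_mem x1 /set_mem x2]; have : (cu p `&` cv p) (b k) by []; rewrite uvp.
  rewrite !indicE iW iu in_setI.
  exact: mulr_pos_part.
have mW : msr (W C) by apply: (@msr_clop _ S); apply: cW; exact: cCs.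
have mW' : msr ((C `&` O) `\` (u' `|` v')).
  apply: (@msr_clop _ S); apply: clopD; last exact: clopU.
  by apply: clopI => //; exact: cCs.
have tau_le : tau ((C `&` O) `\` (u' `|` v')) <= tau (W C).
  by apply: (fm_le fm_tau) => // x [xC nuv]; split=> // -[xu|xv]; apply: nuv; [left; left|right; left].
have tau_H : tau H <= eta.
  apply: le_trans (ltW hJ); apply: (theta_le_Theta fm_theta (i := 0%N)) => //.
  by rewrite leq_max orbT.
have tau_ge : tau (W C) <= tau ((C `&` O) `\` (u' `|` v')) + tau H.
  apply: le_trans (fm_leU fm_tau mW' mH); apply: (fm_le fm_tau) => //; first exact: msrU.
  move=> x [xC nuv]; have [xuv|xuv] := pselect ((u' `|` v') x); last by left.
  by right; apply: new.
move: hCu hW htW; rewrite !ltr_norml => /andP[? ?] /andP[? ?] /andP[? ?].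
by apply/andP; split; lra.
Qed.

(** Value 1 at the new coordinate is possible exactly off [V]. Wherever it is possible in [A], it
    must be forced over a whole cylinder, or irreducibility would fail at the next stage. Exchanging
    [U] and [V] treats value 0. *)
Definition keeps_irr (U V : set X) := forall A, clop S A -> (A `&` K) `\` V !=set0 ->
  exists d l, K `&` cyl iot d l `<=` A `&` U.

(** Countably many requirements suffice, because [clop S] is countable and the errors may be taken
    of the form [1 / (k + 1)]. Each estimate is met for a condition with error below [e / 2], and
    the remaining allowance covers the passage to the union. *)
Lemma step_exists : exists U V,
  [/\ sopen S U, sopen S V, U `&` V = set0,
      forall n, act n -> keeps1 S K U V (pi n) /\ keeps2 S U (pi n) &
      keeps_irr U V /\ keeps_irr V U] /\
  (forall O (Cs : seq (set X)) (e : R) n0, clop S O -> (forall C, C \in Cs -> clop S C) -> 0 < e ->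
    exists2 n, (n0 <= n)%N &
      (forall k, (k < N n)%N -> lam n k != 0 -> U (b k) \/ V (b k)) /\
      forall C, C \in Cs -> `|wsum (lam n) (N n) b C| < e /\
        `|wsum (lam n) (N n) b (C `&` U) - tau ((C `&` O) `\` (U `|` V)) / 2| < e) /\
  exists y, [/\ K y, ~ (U `|` V) y & forall C, clop S C -> C y -> 0 < tau (C `\` (U `|` V))].
Proof.
have [ec ecS] := countable_enum (ex_intro _ _ (clopT S)) (countable_clop cS).
have ecP i : clop S (ec i) by have : range ec (ec i) by [exists i]; rewrite ecS.
have ecC C : clop S C -> exists i, ec i = C.
  move=> cC; have : range ec C by rewrite ecS.
  by move=> [i _ <-]; exists i.
have ecs (Cs : seq (set X)) : (forall C, C \in Cs -> clop S C) -> exists is_, map ec is_ = Cs.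
  elim: Cs => [_|C Cs ih h]; first by exists [::].
  have [|is_ isE] := ih; first by move=> C' C'in; apply: h; rewrite inE C'in orbT.
  have [|i iE] := ecC C; first by apply: h; rewrite inE eqxx.
  by exists (i :: is_); rewrite /= iE isE.
have eclop is_ C : C \in map ec is_ -> clop S C by move=> /mapP[i _ ->].
pose ee (k : nat) : R := k.+1%:R^-1.
have ee0 k : 0 < ee k by rewrite invr_gt0.
have eeP (e : R) : 0 < e -> exists k, ee k < e.
  move=> e0; have [k _ h] := near_infty_natSinv_lt (PosNum e0).
  by exists k; apply: h => /=.
pose T : countType := ((nat * nat * seq nat * nat * nat) + (nat * nat * nat * nat) + nat +
  (nat * seq nat * nat * nat))%type.
pose D (t : T) (q : cond) : Prop := match t with
  | inl (inl (inl (n, r, Cs, k, n0))) => act n -> kept1 n r (map ec Cs) (ee k) n0 q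
  | inl (inl (inr (n, i1, i0, k))) => act n -> ec i1 (pz (pi n) true) -> ec i0 (pz (pi n) false) ->
      kept2 n (ec i1) (ec i0) (ee k) q
  | inl (inr i) => kept3 (ec i) q
  | inr (i, Cs, k, n0) => kept4 (ec i) (map ec Cs) (ee k) n0 q
  end.
(* An allowance of one half against [tau], which has mass 1, leaves positive mass outside the final
   [U] and [V]. *)
pose p0 := @Cond R I set0 set0 2^-1 1.
have okp0 : ok p0 by split; rewrite /= ?setI0 ?invr_gt0 //; exact: clop0.
have dense t p : ok p -> exists q, [/\ ok q, le p q & D t q].
  move=> okp; have triv : exists q, [/\ ok q, le p q & q = p].
    by exists p; split=> //; exact: (cond_le_refl fm_theta).
  case: t => [[[[[[[n r] Cs] k] n0]|[[[n i1] i0] k]]|i]|[[[i Cs] k] n0]] /=.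
  - have [an|nan] := pselect (act n); last by have [q [h1 h2 _]] := triv; exists q.
    by have [q [h1 h2 h3]] := dense1 r n0 an (@eclop Cs) (ee0 k) okp; exists q.
  - have [[an z1 z0]|nn] := pselect [/\ act n, ec i1 (pz (pi n) true) & ec i0 (pz (pi n) false)].
      by have [q [h1 h2 h3]] := dense2 an (ecP i1) (ecP i0) z1 z0 (ee0 k) okp; exists q.
    have [q [h1 h2 _]] := triv; exists q; split=> // an z1 z0.
    by exfalso; apply: nn.
  - exact: dense3.
  - exact: (dense4 n0 (ecP i) (@eclop Cs) (ee0 k) okp).
have [u [v [cuv incuv uv0 bound0 gen]]] := generic fm_theta okp0 dense.
set U := \bigcup_k u k in uv0 bound0 gen; set V := \bigcup_k v k in uv0 bound0 gen.
have oU : sopen S U by exists u => // k; have [] := cuv k.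
have oV : sopen S V by exists v => // k; have [] := cuv k.
have mU : msr U by apply: msr_bigcup => k; have [h _] := cuv k; exact: msr_clop h.
have mV : msr V by apply: msr_bigcup => k; have [_ h] := cuv k; exact: msr_clop h.
have UV := msrU mU mV.
have uvU x : U x -> V x -> False by move=> h1 h2; have : (U `&` V) x by []; rewrite uv0.
have mok (p : cond) : ok p -> msr (cu p) /\ msr (cv p).
  by move=> [h1 h2 _ _]; split; [exact: msr_clop h1|exact: msr_clop h2].
have sub1 (p : cond) : cv p `<=` V -> U `\` cu p `<=` (U `|` V) `\` (cu p `|` cv p).
  by move=> vp x [Ux nu]; split; [left|move=> [//|/vp]; exact: uvU].
have irr U' V' : sopen S U' ->
    (forall i, (ec i `&` K `<=` U' `|` V') \/ exists d l, K `&` cyl iot d l `<=` ec i `&` U') ->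
    keeps_irr U' V'.
  move=> [u' cu' UE] h A cA [x [[Ax Kx] nV]].
  have [Ux|nU] := pselect (U' x).
    move: (Ux); rewrite UE => -[k _ uk].
    have [|d [l dl]] := K_irr (clopI cA (cu' k)); first by exists x; split=> //; split.
    by exists d, l => z /dl[Az uz]; split=> //; exists k.
  have [i iE] := ecC A cA; have [sub|[d [l dl]]] := h i; last by exists d, l; rewrite -iE.
  by have [] : (U' `|` V') x by apply: sub; rewrite iE.
exists U, V; split; [split=> //|split].
- move=> n an; have [_ _ _ fk] := pi_ok an; split.
    move=> r Cs e n0 /ecs[is_ isE] e0; have e2 : 0 < e / 2 by rewrite divr_gt0.
    have [k ke] := eeP _ e2.
    have [p [/(_ an)[pe pidx [n' n0n hn]] okp pU pV pb]] := gen (inl (inl (inl (n, r, is_, k, n0)))).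
    have [mu mv] := mok p okp.
    exists n' => // xi lxi; have [hs hC] := hn xi lxi; split.
      by move=> j jN lj; have [/pU|/pV] := hs j jN lj; [left|right].
    move=> C; rewrite -isE => Cin; have [h1 h2] := hC C Cin; split; first by lra.
    have mC : msr C by apply: msr_clop (eclop _ _ Cin).
    (* All atoms already lie in [cu p] or in [cv p], hence outside the rest of [U], and the sum does
       not change. *)
    rewrite (eq_wsum (xi' := xi) (B := C `&` cu p)); last first.
      move=> j jN lj; split=> -[Cx]; last by move=> /pU.
      by move=> Ux; split=> //; have [//|/pV] := hs j jN lj => /uvU.
    have kap c : 0 <= pk (pi n) r c (C `&` U) - pk (pi n) r c (C `&` cu p) <= ee k.
      rewrite (fm_IC (fk r c) (msrI mC mU) (msrI mC mu)).
      have -> : (C `&` U) `&` (C `&` cu p) = C `&` cu p.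
        by apply/seteqP; split=> x /=; [move=> [_]|move=> [Cx ux]; split; split=> //; exact: pU].
      rewrite addrC addKr; apply/andP; split.
        by apply: (fm_ge0 (fk r c)); apply: msrD; exact: msrI.
      apply: le_trans pe; apply: le_trans (pb _ (pidx c)); rewrite thetaE //.
      apply: (fm_le (fk r c)); [by apply: msrD; exact: msrI|by apply: msrD => //; exact: msrU|].
      by move=> x [[Cx Ux] nC]; apply: (sub1 _ pV); split=> // ux; apply: nC.
    have /andP[k1 k2] := kap true; have /andP[k3 k4] := kap false.
    move: h2; rewrite /pT !ltr_norml => /andP[h3 h4].
    by apply/andP; split; lra.
  move=> C1 C0 e c1 c0 z1 z0 e0.
  have e2 : 0 < e / 2 by rewrite divr_gt0.
  have [k ke] := eeP _ e2.
  have [i1 E1] := ecC _ c1; have [i0 E0] := ecC _ c0.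
  rewrite -E1 in c1 z1 *; rewrite -E0 in c0 z0 *.
  have [p [/(_ an z1 z0)[r [h1 h2 h3 h4 h5]] okp pU pV pb]] := gen (inl (inl (inr (n, i1, i0, k)))).
  have [mu mv] := mok p okp.
  have c_ge0 : 0 <= pk (pi n) r true setT by apply: (fm_ge0 (fk r true)); exact: msrT.
  have kc : ee k * pk (pi n) r true setT <= e / 2 * pk (pi n) r true setT.
    by apply: ler_wpM2r => //; exact: ltW.
  have pos : 0 <= pk (pi n) r true (~` ec i1) + pk (pi n) r false (~` ec i0).
    apply: addr_ge0; first by apply: (fm_ge0 (fk r true)); apply: msrC; exact: msr_clop c1.
    by apply: (fm_ge0 (fk r false)); apply: msrC; exact: msr_clop c0.
  have kU c : ~ U (pz (pi n) c) -> (~ cu p (pz (pi n) c) ->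
      pk (pi n) r c (cu p) < ee k * pk (pi n) r true setT) ->
      pk (pi n) r c U < e * pk (pi n) r true setT.
    move=> nU h; have := h ltac:(by move/pU) => hc.
    have : pk (pi n) r c U <= pk (pi n) r c (cu p) + pk (pi n) r c (U `\` cu p).
      apply: le_trans (fm_leU (fk r c) mu (msrD mU mu)).
      apply: (fm_le (fk r c)) => //; first by apply: msrU => //; exact: msrD.
      by move=> x Ux; have [|] := pselect (cu p x); [left|right].
    have : pk (pi n) r c (U `\` cu p) <= cd p.
      apply: le_trans (pb _ (h5 c)); rewrite thetaE //.
      by apply: (fm_le (fk r c)); [exact: msrD|by apply: msrD => //; exact: msrU|exact: sub1].
    lra.
  exists r; split; [by lra|by move=> nU; exact: kU|by move=> nU; exact: kU].
- split.
    apply: irr => // i.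
    have [p [[sub|[[d [l dl]] _]] _ pU pV _]] := gen (inl (inr i)).
      by left=> x /sub[/pU|/pV]; [left|right].
    by right; exists d, l => x /dl[Ax /pU].
  apply: irr => // i; have [p [[sub|[_ [d [l dl]]]] _ pU pV _]] := gen (inl (inr i)).
    by left=> x /sub[/pU|/pV]; [right|left].
  by right; exists d, l => x /dl[Ax /pV].
- move=> O Cs e n0 cO /ecs[is_ isE] e0; have e2 : 0 < e / 2 by rewrite divr_gt0.
  have [k ke] := eeP _ e2; have [i iE] := ecC _ cO.
  have [p [[pe pidx [n n0n [hs hC]]] okp pU pV pb]] := gen (inr (i, is_, k, n0)).
  have [mu mv] := mok p okp.
  exists n => //; split; first by move=> j jN lj; have [/pU|/pV] := hs j jN lj; [left|right].
  move=> C; rewrite -isE => Cin; have [h1 h2] := hC C Cin; split; first by lra.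
  have mCO : msr (C `&` O) by apply: (@msr_clop _ S); apply: clopI => //; exact: eclop Cin.
  rewrite (eq_wsum (xi' := b) (B := C `&` cu p)); last first.
    move=> j jN lj; split=> -[Cx]; last by move=> /pU.
    by move=> Ux; split=> //; have [//|/pV] := hs j jN lj => /uvU.
  rewrite iE in h2.
  have t1 : tau ((C `&` O) `\` (U `|` V)) <= tau ((C `&` O) `\` (cu p `|` cv p)).
    apply: (fm_le fm_tau); [exact: msrD|by apply: msrD => //; exact: msrU|].
    by move=> x [xC nUV]; split=> // -[/pU|/pV] h; apply: nUV; [left|right].
  have t2 : tau ((C `&` O) `\` (cu p `|` cv p)) <= tau ((C `&` O) `\` (U `|` V)) + cd p.
    have mD : msr ((U `|` V) `\` (cu p `|` cv p)) by apply: msrD => //; exact: msrU.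
    have := pb 0%N pidx; rewrite /= => tb.
    apply: le_trans (_ : tau (((C `&` O) `\` (U `|` V)) `|` ((U `|` V) `\` (cu p `|` cv p))) <= _).
      apply: (fm_le fm_tau); [by apply: msrD => //; exact: msrU|by apply: msrU => //; exact: msrD|].
      by move=> x [xC nuv]; have [|] := pselect ((U `|` V) x); [right|left].
    apply: le_trans (fm_leU fm_tau (msrD mCO UV) mD) _; rewrite lerD2l; exact: tb.
  move: h2; rewrite !ltr_norml => /andP[h3 h4].
  by apply/andP; split; lra.
- pose G := ~` (U `|` V); have mG : msr G by exact: msrC.
  have G0 : 0 < tau G.
    have := bound0 0%N isT; rewrite /= setU0 setD0 => h.
    have := fm_IC fm_tau (@msrT I) UV; rewrite setTI setTD tau1 -/G; lra.
  (* [y] lies in the support of the restriction of [tau] to [G]. *)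
  pose F := filter_from [set C | clop S C /\ tau (G `\` C) = 0] id.
  have PF : ProperFilter F.
    apply: filter_from_proper => [|C [cC GC]]; last first.
      apply: contrapT => /set0P/negP/negPn/eqP C0.
      by move: G0; rewrite -GC C0 setD0 ltxx.
    apply: filter_from_filter; first by exists setT; split; [exact: clopT|rewrite setDT (fm0 fm_tau)].
    move=> C C' [cC GC] [cC' GC']; exists (C `&` C') => //; split; first exact: clopI.
    have mD A : clop S A -> msr (G `\` A) by move=> cA; apply: msrD => //; exact: msr_clop cA.
    apply/eqP; rewrite eq_le (fm_ge0 fm_tau) ?andbT; last by apply: mD; exact: clopI.
    by rewrite setDIr; apply: le_trans (fm_leU fm_tau (mD _ cC) (mD _ cC')) _; rewrite GC GC' addr0.
  have [H [UH FH]] := ultraFilterLemma PF; have [y yP] := cube_ulim id UH.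
  have key C : clop S C -> C y -> 0 < tau (C `\` (U `|` V)).
    move=> cC Cy; have mC : msr C by exact: msr_clop cC.
    rewrite lt_neqAle (fm_ge0 fm_tau) ?andbT; last exact: msrD.
    apply/eqP => tC; have HC : H (~` C).
      apply: FH; exists (~` C) => //; split; first exact: clopC.
      by rewrite setDE setCK setIC -setDE.
    have [J _ dC] := cC; have [z [zy nCz]] := @filter_ex _ H _ _ (filterI (yP J) HC).
    by apply: nCz; apply: dC Cy; exact: agree_sym.
  exists y; split=> //.
    apply: contrapT => nK; have [C [cC Cy CK]] := K_closed nK.
    have tC : 0 < tau C.
      have mC : msr C by exact: msr_clop cC.
      by apply: lt_le_trans (key C cC Cy) _; apply: (fm_le fm_tau) => //; exact: msrD.
    (* The atoms lie in K, so the sums over a set [C] disjoint from K are 0 and cannot approach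
       [tau C > 0]. *)
    have [|n _ hn] := lam_tau (Cs := [:: C]) 0%N _ tC; first by move=> C'; rewrite inE => /eqP ->.
    have [_] := hn C (mem_head _ _); rewrite /wsum big1 ?sub0r ?normrN ?gtr0_norm ?ltxx // => k _.
    rewrite indicE memNset ?mulr0 // => Cb.
    by have : (C `&` K) (b k) by []; rewrite CK.
  move=> UVy; suff [C [cC Cy CUV]] : exists C, [/\ clop S C, C y & C `<=` U `|` V].
    have := key C cC Cy; suff -> : C `\` (U `|` V) = set0 by rewrite (fm0 fm_tau) ltxx.
    by apply/seteqP; split=> // x [/CUV].
  case: UVy => -[k _ yk].
    by exists (u k); split=> //; [have [] := cuv k|move=> x xk; left; exists k].
  by exists (v k); split=> //; [have [] := cuv k|move=> x xk; right; exists k].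
Qed.

End step.

(** * The recursion along W *)

Section invariance.
Context (R : realType) (I : choiceType).
Local Notation X := (I -> bool).
Implicit Types (S : set I) (A : set X) (pi : promise R I).

Definition determ S A := forall x y, agree S x y -> A x -> A y.

Lemma determ_clop S A : clop S A -> determ S A.
Proof. by move=> cA x y; exact: clop_agree cA. Qed.

Lemma determI S A B : determ S A -> determ S B -> determ S (A `&` B).
Proof. by move=> iA iB x y xy [Ax Bx]; split; [exact: iA Ax|exact: iB Bx]. Qed.

Lemma determ_sopen S A : sopen S A -> determ S A.
Proof. by move=> [u cu ->] x y xy [k _ ux]; exists k => //; exact: clop_agree (cu k) xy ux. Qed.

Lemma msr_sopen S A : sopen S A -> msr A.
Proof. by move=> [u cu ->]; apply: msr_bigcup => k; exact: msr_clop (cu k). Qed.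

Lemma msr_preimage_in S A (f : X -> X) : clop S A -> (forall i, S i -> msr [set x | f x i]) ->
  msr (f @^-1` A).
Proof.
move=> cA mf; pose g x i := if `[< S i >] then f x i else false.
have -> : f @^-1` A = g @^-1` A.
  have fg x : agree S (f x) (g x) by move=> i Si; rewrite /g asboolT.
  by apply/seteqP; split=> x /=; apply: (clop_agree cA) => //; exact: agree_sym.
apply: msr_preimage (msr_clop cA) => i; rewrite /g.
case: asboolP => Si; first exact: mf.
by rewrite (_ : [set x | _] = set0) //; [exact: msr0|apply/seteqP; split=> x].
Qed.

(** Equality as far as the coordinates in [S] can tell. The points and measures of a promise are
    defined through all later stages, whereas the recursion at a stage may look only at earlier
    ones; this relation bridges the two. *)
Definition promise_sim S pi pi' :=
  [/\ pS pi = pS pi', pa pi = pa pi', plam pi = plam pi', pN pi = pN pi' &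
   (forall c, agree S (pz pi c) (pz pi' c)) /\
   forall o c A, determ S A -> pk pi o c A = pk pi' o c A].

Section transfer.
Variables (S : set I) (pi pi' : promise R I) (sim : promise_sim S pi pi').

Let pTE o A : determ S A -> pT pi o A = pT pi' o A.
Proof. by case: sim => _ _ _ _ [_ h] iA; rewrite /pT !h. Qed.

Let liftsE K xi : lifts K pi' xi -> lifts K pi xi.
Proof. by case: sim => h1 h2 _ _ _ h k; rewrite h1 h2; exact: h. Qed.

Let pzE c A : determ S A -> A (pz pi' c) -> A (pz pi c).
Proof. by case: sim => _ _ _ _ [h _] iA; apply: iA; exact: agree_sym. Qed.

Lemma promise1_sim K : promise1 S K pi -> promise1 S K pi'.
Proof.
case: (sim) => _ _ h3 h4 _ h o Cs e n0 cCs e0; have [n n0n hn] := h o Cs e n0 cCs e0.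
exists n => // xi /liftsE lxi C Cin; rewrite -h3 -h4 -pTE; first exact: hn.
exact: determ_clop (cCs _ Cin).
Qed.

Lemma promise2_sim : promise2 S pi -> promise2 S pi'.
Proof.
case: (sim) => _ _ _ _ [_ hk] h C1 C0 e c1 c0 z1 z0 e0.
have [||o' ho] := h C1 C0 e c1 c0 _ _ e0; [by apply: pzE z1; exact: determ_clop c1|by apply: pzE z0; exact: determ_clop c0|].
by exists o'; rewrite -!hk //; apply: determ_clop; exact: clopC.
Qed.

Lemma keeps1_sim K U V : determ S U -> keeps1 S K U V pi -> keeps1 S K U V pi'.
Proof.
case: (sim) => _ _ h3 h4 _ iU h o Cs e n0 cCs e0; have [n n0n hn] := h o Cs e n0 cCs e0.
exists n => // xi /liftsE lxi; have [k1 k2] := hn xi lxi.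
rewrite -h3 -h4; split=> // C Cin; have iC : determ S C by exact: determ_clop (cCs _ Cin).
by rewrite -!pTE //; [exact: k2|exact: determI].
Qed.

Lemma keeps2_sim U : determ S U -> keeps2 S U pi -> keeps2 S U pi'.
Proof.
case: (sim) => _ _ _ _ [hz hk] iU h C1 C0 e c1 c0 z1 z0 e0.
have [||o' [k1 k2 k3]] := h C1 C0 e c1 c0 _ _ e0; [by apply: pzE z1; exact: determ_clop c1|by apply: pzE z0; exact: determ_clop c0|].
have iT : determ S setT by [].
exists o'; rewrite -!hk //; try (by apply: determ_clop; exact: clopC).
by split=> // nU; [apply: k2|apply: k3]; apply: contra_not nU => /iU; apply.
Qed.

End transfer.
End invariance.

Section construction.
Context (R : realType) {d : Order.disp_t} (W : orderType d) (w1 : is_omega1 W).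
Local Notation I := (nat + W)%type.
Local Notation X := (I -> bool).
Local Notation iot := (@inl nat W).
Implicit Types (a b c : W) (x y : X).

Definition low b : set I := [set i | if i is inr c then (c < b)%O else true].
Definition lowe b : set I := [set i | if i is inr c then (c <= b)%O else true].

Lemma iot_low b : range iot `<=` low b. Proof. by move=> _ [n _ <-]. Qed.

Lemma low_lowe b : low b `<=` lowe b. Proof. by move=> [//|c] /= /ltW. Qed.

Lemma lowe_low b c : (b < c)%O -> lowe b `<=` low c.
Proof. by move=> bc [//|e] /= /le_lt_trans; apply. Qed.

Lemma low_low b c : (b <= c)%O -> low b `<=` low c.
Proof. by move=> bc [//|e] /= /lt_le_trans; apply. Qed.

Lemma countable_low b : countable (low b).
Proof.
rewrite (_ : low b = range iot `|` inr @` [set c | (c < b)%O]); last first.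
  apply/seteqP; split=> [[n|c]//= h|i [[n _ <-]//|[c cb <-]//]]; first by left; exists n.
  by right; exists c.
rewrite (_ : _ `|` _ = \bigcup_(i in [set: bool]) (if i then range iot else inr @` [set c | (c < b)%O])).
  apply: bigcup_countable => // -[] _.
    exact: card_le_trans (card_image_le _ _) (countableP _).
  exact: card_le_trans (card_image_le _ _) (countable_below w1 b).
apply/seteqP; split=> i; first by move=> [|] h; [exists true|exists false].
by move=> [[]] _ h; [left|right].
Qed.

Section extension.
Variable U : W -> set X.
Hypothesis iU : forall c, determ (low c) (U c).

(** Above [a] the value 1 is taken only where it is forced, so [y] is determined by [x] up to [a]
    and by the sets [U c]. *)
Definition is_ext a x y := agree (lowe a) x y /\ forall c, (a < c)%O -> y (inr c) = `[< U c y >].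

Lemma ext_exists a x : exists y, is_ext a x y.
Proof.
pose glue (f : W -> bool) : X := fun i => match i with inl n => x (inl n) | inr c => f c end.
have [|f fP] := @omega1_choice _ W w1 bool true (fun c f v =>
    v = if (c <= a)%O then x (inr c) else `[< U c (glue f) >]).
  move=> c h k hk v /= ->; case: ifP => // _; apply/asbool_equiv_eq.
  by split; apply: iU => -[//|e] /= ec; rewrite hk.
exists (glue f); split=> [[//|c] /= ca|c ac] /=.
  by rewrite (fP c _) ?ca //; eexists.
by rewrite (fP c _) ?leNgt ?ac //; eexists.
Qed.

Definition ext a x : X := projT1 (cid (ext_exists a x)).

Lemma extP a x : is_ext a x (ext a x).
Proof. exact: (projT2 (cid (ext_exists a x))). Qed.

(** By induction on the coordinate: for [c] above [a] the set in question is a countable union of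
    preimages of clopen sets that involve lower coordinates only. *)
Lemma ext_msr a i (f : X -> X) : (forall c, exists2 u : nat -> set X, forall k, clop (low c) (u k) & U c = \bigcup_k u k) ->
  (forall j, msr [set x | f x j]) -> msr [set x | ext a (f x) i].
Proof.
move=> oU mf.
have base j : lowe a j -> msr [set x | ext a (f x) j].
  move=> lj; rewrite (_ : [set x | _] = [set x | f x j]); first exact: mf.
  by apply/seteqP; split=> x /=; have [h _] := extP a (f x); rewrite h.
case: i => [n|c]; first exact: base.
elim/(omega1_ind w1): c => c ih.
have [ca|ac] := leP c a; first exact: base.
have [u cu UE] := oU c.
rewrite (_ : [set x | _] = \bigcup_k ((fun x => ext a (f x)) @^-1` (u k))).
  apply: msr_bigcup => k; apply: msr_preimage_in (cu k) _ => -[n|e] /= h; first exact: base.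
  exact: ih.
rewrite -preimage_bigcup -UE; apply/seteqP; split=> x /=; have [_ /(_ c ac) ->] := extP a (f x).
  by move/asboolP.
by move/asboolP.
Qed.

End extension.

Lemma is_ext_local U U' a b x y y' : (forall c, determ (low c) (U c)) ->
  (forall c, (c < b)%O -> U c = U' c) -> is_ext U a x y -> is_ext U' a x y' -> agree (low b) y y'.
Proof.
move=> iU UU' [xy yE] [xy' yE'].
have base i : lowe a i -> y i = y' i by move=> ai; rewrite -xy // -xy'.
case=> [n _|c]; first exact: base.
elim/(omega1_ind w1): c => c ih /= cb.
have [ca|ac] := leP c a; first exact: base.
rewrite yE // yE' //; apply/asbool_equiv_eq; rewrite -UU' //.
have yy' : agree (low c) y y'.
  by move=> [n _|e ec]; [exact: base|apply: ih => //; exact: lt_trans cb].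
by split; apply: iU => //; exact: agree_sym.
Qed.

End construction.

Section construction.
Context (R : realType) {d : Order.disp_t} (W : orderType d) (w1 : is_omega1 W).
Local Notation I := (nat + W)%type.
Local Notation X := (I -> bool).
Local Notation iot := (@inl nat W).
Implicit Types (a b c : W) (x y : X).

(** [sact] tells whether the stage makes a promise. The fields after it are the guessed points, the
    combinations with bounds on their supports, the limit of their absolute values, and a point in
    its support off [sU] and [sV]. *)
Record stage := Stage {
  sU : set X ; sV : set X ; sact : Prop ; sb : nat -> X ;
  slam : nat -> nat -> R ; sN : nat -> nat ; stau : set X -> R ; sy : X }.

Implicit Type D : W -> stage.

(* The set [sU (D c)] forces coordinate [c] to be 1, and [sV (D c)] forces it to
   be 0. *)
Definition Klt D b : set X := [set x | forall c, (c < b)%O ->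
  (sU (D c) x -> x (inr c)) /\ (sV (D c) x -> ~ x (inr c))].
Definition Kle D b : set X := [set x | forall c, (c <= b)%O ->
  (sU (D c) x -> x (inr c)) /\ (sV (D c) x -> ~ x (inr c))].

Definition valid b (s : stage) :=
  [/\ sopen (low b) (sU s), sopen (low b) (sV s), sU s `&` sV s = set0 &
    sact s -> [/\ forall k l, agree (low b) (sb s k) (sb s l) -> k = l,
      forall n k, (k < n)%N -> slam s n k = 0 & fmeas (stau s)]].

Definition clop_enum b : {e : nat -> set X | range e = [set A | clop (low b) A]} :=
  cid (countable_enum (ex_intro [set A | clop (low b) A] _ (clopT (low b)))
    (countable_clop (countable_low w1 b))).

Definition upd x a (v : bool) : X := fun i => if i == inr a then v else x i.

Section promises_of.
Variable D : W -> stage.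
Hypothesis vD : forall b, valid b (D b).

Lemma determ_sU c : determ (low c) (sU (D c)).
Proof. by have [h _ _ _] := vD c; exact: determ_sopen h. Qed.

Lemma determ_sV c : determ (low c) (sV (D c)).
Proof. by have [_ h _ _] := vD c; exact: determ_sopen h. Qed.

(* Set coordinate [a] to [v] and continue above [a] with the least values that
   the constraints allow. *)
Definition jump a (v : bool) x : X := ext w1 determ_sU a (upd x a v).

Definition sF a : set X := ~` (sU (D a) `|` sV (D a)).

(** On [sF a] both values of coordinate [a] are allowed. The measure moves the part of [stau] there,
    within the o-th clopen set, to points with value [v]. *)
Definition prom a : promise R I := Promise (low a) (sb (D a)) (slam (D a)) (sN (D a))
  (fun v => jump a v (sy (D a)))
  (fun o v A => stau (D a) ((sF a `&` projT1 (clop_enum a) o) `&` (jump a v) @^-1` A)).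

Lemma msr_jump a v i : msr [set x | jump a v x i].
Proof.
rewrite /jump; apply: (@ext_msr _ W w1 _ determ_sU a i (fun x => upd x a v)) => [c|j].
  by have [[u cu uE] _ _ _] := vD c; exists u.
rewrite /upd; case: eqVneq => _; last exact: msr_clop (clop_coord true (S := setT) Logic.I).
case: v; first by rewrite (_ : mkset _ = setT); [exact: msrT|apply/seteqP; split=> x].
by rewrite (_ : mkset _ = set0); [exact: msr0|apply/seteqP; split=> x].
Qed.

Lemma prom_ok a : sact (D a) -> promise_ok (prom a).
Proof.
have [hU hV _ h] := vD a; move=> /h[binj lam0 fm]; split=> //.
  by exists (inl 0%N).
move=> o v; apply: fm_restr => //; last exact: msr_jump.
apply: msrI; first by apply: msrC; apply: msrU; [exact: msr_sopen hU|exact: msr_sopen hV].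
apply: (@msr_clop _ (low a)); case: (clop_enum a) => e /= eE.
by have : range e (e o) by [exists o]; rewrite eE.
Qed.

Lemma jump_low a v x c : (a < c)%O -> jump a v x (inr c) = `[< sU (D c) (jump a v x) >].
Proof. by have [_] := extP w1 determ_sU a (upd x a v); apply. Qed.

Lemma jump_at a v x : jump a v x (inr a) = v.
Proof.
have [h _] := extP w1 determ_sU a (upd x a v).
by rewrite /jump -h /upd ?eqxx //= lexx.
Qed.

Lemma jump_agree a v x : agree (low a) x (jump a v x).
Proof.
have [h _] := extP w1 determ_sU a (upd x a v) => i ai.
rewrite /jump -h; last exact: low_lowe.
by rewrite /upd; case: eqP => // iE; move: ai; rewrite iE /= ltxx.
Qed.

Lemma jump_K a v x b : Klt D a x -> sF a x -> Klt D b (jump a v x).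
Proof.
move=> Kx Fx c _; have ja := @jump_agree a v x; have [ca|ac|->] := ltgtP c a.
- have jc : agree (low c) x (jump a v x) by apply: agree_sub ja; apply: low_low; exact: ltW.
  have [k1 k2] := Kx c ca; rewrite -ja //; split=> h; [apply: k1|apply: k2].
    exact: determ_sU (agree_sym jc) h.
  exact: determ_sV (agree_sym jc) h.
- rewrite jump_low //; split=> h; first exact/asboolP.
  move=> /asboolP h'; have [_ _ uv _] := vD c.
  by have : (sU (D c) `&` sV (D c)) (jump a v x) by []; rewrite uv.
- split=> h; exfalso; apply: Fx; [left; apply: determ_sU h|right; apply: determ_sV h]; exact: agree_sym.
Qed.

Lemma pk_eq a o v A B : (forall x, A (jump a v x) <-> B (jump a v x)) ->
  pk (prom a) o v A = pk (prom a) o v B.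
Proof. by move=> AB; rewrite /=; congr (stau _ (_ `&` _)); apply/seteqP; split=> x /AB. Qed.

Lemma pk_le a o v A B : sact (D a) -> msr A -> msr B ->
  (forall x, A (jump a v x) -> B (jump a v x)) -> pk (prom a) o v A <= pk (prom a) o v B.
Proof.
move=> /prom_ok[_ _ _ fm] mA mB AB; rewrite (@pk_eq a o v A (A `&` B)); last first.
  by move=> x; split=> [Ax|[]//]; split=> //; exact: AB.
by apply: (fm_le (fm o v)) => //; exact: msrI.
Qed.

End promises_of.

Definition stage0 : stage :=
  Stage set0 set0 False (fun _ => xpred0) (fun _ _ => 0) (fun=> 0%N) (fun=> 0) xpred0.

Lemma valid_stage0 c : valid c stage0.
Proof.
have s0 : @sopen I (low c) set0.
  by exists (fun=> set0) => [k|]; [exact: clop0|rewrite bigcup0].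
by split=> //=; rewrite setI0.
Qed.

(* The promises mention the validity of all stages, whereas the requirement on
   stage [b] may only depend on the stages below [b]. *)
Definition trunc b D c : stage := if (c < b)%O then D c else stage0.

Lemma valid_trunc b D : (forall c, (c < b)%O -> valid c (D c)) -> forall c, valid c (trunc b D c).
Proof.
by move=> vD c; rewrite /trunc; case: ifP => [/vD //|_]; exact: valid_stage0.
Qed.

Lemma promise_sim_local D D' (vD : forall b, valid b (D b)) (vD' : forall b, valid b (D' b)) a b :
  (a < b)%O -> (forall c, (c < b)%O -> D c = D' c) -> promise_sim (low b) (prom vD a) (prom vD' a).
Proof.
move=> ab DD'; have ja v x : agree (low b) (jump vD a v x) (jump vD' a v x).
  apply: (is_ext_local w1 (U := sU \o D) (U' := sU \o D') _ _
    (extP w1 (determ_sU vD) a (upd x a v)) (extP w1 (determ_sU vD') a (upd x a v))).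
    exact: determ_sU.
  by move=> c cb /=; rewrite DD'.
rewrite /prom -(DD' a ab); split=> //=; split=> [v|o v A iA]; first exact: ja.
rewrite /sF -(DD' a ab); congr (stau _ (_ `&` _)); apply/seteqP; split=> x /=; apply: iA => //.
exact: agree_sym.
Qed.

(** For a [K] that maps onto the Cantor set of the coordinates in [nat], this is irreducibility of
    the projection. *)
Definition irr (S : set I) (K : set X) := forall A, clop S A -> A `&` K !=set0 ->
  exists e l, K `&` cyl iot e l `<=` A.

Section stages.
Variables (gb : W -> nat -> X) (gc : W -> nat -> nat -> R).

Definition good_guess D b := [/\ forall k, Klt D b (gb b k),
  forall k l, agree (low b) (gb b k) (gb b l) -> k = l,
  forall n, exists N, forall k, (N <= k)%N -> gc b n k = 0 &
  forall p (t : 'I_p -> R), (forall k, \sum_(n < p) t n * gc b n k = 0) -> forall n, t n = 0].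

Definition stage_hyp D b := irr (low b) (Klt D b) /\
  exists vD : forall c, valid c (D c), forall a, (a < b)%O -> sact (D a) ->
    promise1 (low b) (Klt D b) (prom vD a) /\ promise2 (low b) (prom vD a).

Definition new_promise1 b (s : stage) := forall O (Cs : seq (set X)) (e : R) n0, clop (low b) O ->
  (forall C, C \in Cs -> clop (low b) C) -> 0 < e ->
  exists2 n, (n0 <= n)%N &
    (forall k, (k < sN s n)%N -> slam s n k != 0 -> sU s (sb s k) \/ sV s (sb s k)) /\
    forall C, C \in Cs -> `|wsum (slam s n) (sN s n) (sb s) C| < e /\
      `|wsum (slam s n) (sN s n) (sb s) (C `&` sU s) - stau s ((C `&` O) `\` (sU s `|` sV s)) / 2| < e.

Definition new_promise2 D b (s : stage) := [/\ Klt D b (sy s), ~ (sU s `|` sV s) (sy s) &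
  forall C, clop (low b) C -> C (sy s) -> 0 < stau s (C `\` (sU s `|` sV s))].

Definition spanned b (s : stage) := [/\ sact s, sb s = gb b,
  forall n, exists q (t : 'I_q -> R), forall k, slam s n k = \sum_(i < q) t i * gc b i k,
  forall n k, (sN s n <= k)%N -> slam s n k = 0 &
  forall n, \sum_(k < sN s n) `|slam s n k| = 1].

Definition stage_concl D b (s : stage) := [/\ forall vD : forall c, valid c (D c), forall a, (a < b)%O -> sact (D a) ->
    keeps1 (low b) (Klt D b) (sU s) (sV s) (prom vD a) /\ keeps2 (low b) (sU s) (prom vD a),
  keeps_irr (low b) iot (Klt D b) (sU s) (sV s) /\ keeps_irr (low b) iot (Klt D b) (sV s) (sU s),
  good_guess D b -> spanned b s & sact s -> new_promise1 b s /\ new_promise2 D b s].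

Lemma Klt_closed D b x : (forall c, valid c (D c)) -> ~ Klt D b x ->
  exists C, [/\ clop (low b) C, C x & C `&` Klt D b = set0].
Proof.
move=> vD nK.
have [c [cb bad]] : exists c, (c < b)%O /\ ~ ((sU (D c) x -> x (inr c)) /\ (sV (D c) x -> ~ x (inr c))).
  apply: contrapT => nex; apply: nK => c cb; apply: contrapT => bad; apply: nex; by exists c.
have [[u cu UE] [v cv VE] _ _] := vD c.
have lc : low c `<=` low b by apply: low_low; exact: ltW.
have cc t : clop (low b) [set z : X | z (inr c) = t] by exact: clop_coord.
have [Ux|nU] := pselect (sU (D c) x).
  case E : (x (inr c)).
    have Vx : sV (D c) x by apply: contrapT => nV; apply: bad; split.
    move: (Vx); rewrite VE => -[k _ vk].
    exists (v k `&` [set z | z (inr c) = true]); split=> //; first by apply: clopI => //; exact: clop_sub lc (cv k).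
    apply/seteqP; split=> // z [[vz zc] Kz]; have [_ h] := Kz c cb; apply: h => //.
    by rewrite VE; exists k.
  move: (Ux); rewrite UE => -[k _ uk].
  exists (u k `&` [set z | z (inr c) = false]); split=> //; first by apply: clopI => //; exact: clop_sub lc (cu k).
  apply/seteqP; split=> // z [[uz /= zc] Kz]; have [h _] := Kz c cb.
  have : z (inr c) by apply: h; rewrite UE; exists k.
  by rewrite zc.
have Vx : sV (D c) x by apply: contrapT => nV; apply: bad; split.
have E : x (inr c) by apply: contrapT => nx; apply: bad; split.
move: (Vx); rewrite VE => -[k _ vk].
exists (v k `&` [set z | z (inr c) = true]); split=> //; first by apply: clopI => //; exact: clop_sub lc (cv k).
apply/seteqP; split=> // z [[vz zc] Kz]; have [_ h] := Kz c cb; apply: h => //.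
by rewrite VE; exists k.
Qed.

Lemma stage_trivial D b : stage_hyp D b -> ~ good_guess D b -> exists s, valid b s /\ stage_concl D b s.
Proof.
move=> [hirr [vD hp]] ng.
exists (Stage setT set0 False (fun _ => xpred0) (fun _ _ => 0) (fun=> 0%N) (fun=> 0) xpred0).
split; first (split=> //=; [by exists (fun=> setT) => [k|]; [exact: clopT|rewrite bigcup_const //; exists 0%N]|
  by exists (fun=> set0) => [k|]; [exact: clop0|rewrite bigcup0]|by rewrite setI0]).
split=> //=.
  move=> vD' a ab act; rewrite (Prop_irrelevance vD' vD); have [h1 h2] := hp a ab act.
  by split; [exact: keeps_all|exact: keeps2_all].
split=> A cA [x [[Ax Kx] nx]]; last by exfalso; apply: nx.
by have [|e [l el]] := hirr A cA; [exists x|exists e, l => z /el].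
Qed.

Lemma stage_good D b : stage_hyp D b -> good_guess D b -> exists s, valid b s /\ stage_concl D b s.
Proof.
move=> [hirr [vD hp]] [gK ginj gsupp gfree].
have [N0 N0P] := choice gsupp.
have [ec ecE] := clop_enum b.
have ecC C : clop (low b) C -> exists i, ec i = C.
  by move=> cC; have : range ec C; [rewrite ecE|move=> [i _ <-]; exists i].
(* The functionals are the evaluations of the measures on the clopen sets, so each clopen set is
   null for all but finitely many of the combinations. *)
have [lam [N lamP]] := exists_normalized_seq N0P gfree (fun i k => \1_(ec i) (gb b k)).
have [F [UF Foo]] := ultraFilterLemma (@eventually_filter : ProperFilter \oo).
have lam1 n : \sum_(k < N n) `|lam n k| = 1 by have [] := lamP n.
have [tau [fm tauE]] := ulim_measure UF (gb b) lam1.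
have Fex (P : set nat) : F P -> exists n, P n by move=> FP; exact: (@filter_ex _ F).
have Fge n0 : F [set n | (n0 <= n)%N] by apply: Foo; exact: nbhs_infty_ge.
have clT A : clop (low b) A -> clop setT A by apply: clop_sub.
have lam_tau (Cs : seq (set X)) (e : R) n0 : (forall C, C \in Cs -> clop (low b) C) -> 0 < e ->
    exists2 n, (n0 <= n)%N & forall C, C \in Cs -> `|wsum (lam n) (N n) (gb b) C| < e /\
      `|wsum (fun k => `|lam n k|) (N n) (gb b) C - tau C| < e.
  move=> cCs e0.
  suff /Fex[n [n0n hn]] : F ([set n | (n0 <= n)%N] `&` [set n | forall C, C \in Cs ->
      `|wsum (lam n) (N n) (gb b) C| < e /\ `|wsum (fun k => `|lam n k|) (N n) (gb b) C - tau C| < e]).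
    by exists n.
  apply: filterI; first exact: Fge.
  elim: Cs cCs => [_|C Cs ih cCs]; first by apply: (@filterS _ F _ setT) filterT.
  have cC : clop (low b) C by apply: cCs; rewrite inE eqxx.
  have [i iE] := ecC C cC.
  apply: (@filterS _ F _ ([set n | (i.+1 <= n)%N] `&` ([set n | `|\sum_(k < N n) `|lam n k| * \1_C (gb b k) - tau C| < e] `&`
    [set n | forall C, C \in Cs -> `|wsum (lam n) (N n) (gb b) C| < e /\ `|wsum (fun k => `|lam n k|) (N n) (gb b) C - tau C| < e]))).
    move=> n [i_n [hn1 hn2]] C' /=; rewrite inE => /orP[/eqP ->|C'in]; last exact: hn2.
    split=> //; have [_ _ _ /(_ i i_n)] := lamP n.
    by rewrite iE /wsum => ->; rewrite normr0.
  apply: filterI; first exact: Fge.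
  apply: filterI; first by apply: tauE => //; exact: clT.
  by apply: ih => C' C'in; apply: cCs; rewrite inE C'in orbT.
have tau1 : tau setT = 1.
  apply/eqP; rewrite -subr_eq0 -normr_le0; apply/ler_addgt0Pr => e e0; rewrite add0r.
  have /Fex[n /= hn] := tauE setT (clopT _) e e0.
  rewrite distrC; apply: ltW; rewrite -(lam1 n); move: hn.
  by under eq_bigr => k _ do rewrite indicT mulr1.
have [eW eWP] : exists e : nat -> W, forall a, (a < b)%O -> exists n, e n = a.
  have [[a0 a0b]|na] := pselect (exists a, (a < b)%O).
    have [e eE] := countable_enum (ex_intro [set a | (a < b)%O] a0 a0b) (countable_below w1 b).
    exists e => a ab; have : range e a by rewrite eE.
    by move=> [n _ <-]; exists n.
  by exists (fun=> b) => a ab; exfalso; apply: na; exists a.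
pose act n := (eW n < b)%O /\ sact (D (eW n)).
have [|||||U [V [[oU oV UV hk [ir1 ir2]] [n1 [y [yK yF ytau]]]]]] := @step_exists R I (low b) (countable_low w1 b) iot (@iot_low _ W b)
  (Klt D b) hirr (fun x => @Klt_closed D b x vD) (fun n => prom vD (eW n)) act
  _ _ _ _ (gb b) lam N tau gK ginj _ fm tau1 lam_tau.
- by move=> n [_ an]; exact: prom_ok.
- by move=> n [nb _]; apply: low_low; exact: ltW.
- by move=> n [nb an]; have [] := hp _ nb an.
- by move=> n [nb an]; have [] := hp _ nb an.
- by move=> n k kn; have [_ h _ _] := lamP n; apply: h; rewrite kn.
exists (Stage U V True (gb b) lam N tau y); split.
  split=> //= _; split=> // n k kn; have [_ h _ _] := lamP n; apply: h; by rewrite kn.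
split=> //=.
- move=> vD' a ab sa; rewrite (Prop_irrelevance vD' vD); have [n nE] := eWP a ab.
  by rewrite -nE; apply: hk; rewrite /act nE.
- move=> _; split=> //= n; first by have [] := lamP n.
  by move=> k Nk; have [_ h _ _] := lamP n; apply: h; rewrite Nk orbT.
Qed.

End stages.
End construction.

(** [A1] and [A0] will be the sections of [C] at the new coordinate, which is 1 on [U] and 0 at the
    remaining atoms. *)
Lemma wsum_split (R : realType) (I : choiceType) (lam : nat -> R) N (xi : nat -> I -> bool) C A1 A0 U :
  (forall k, (k < N)%N -> lam k != 0 -> C (xi k) <-> (U (xi k) /\ A1 (xi k)) \/ (~ U (xi k) /\ A0 (xi k))) ->
  wsum lam N xi C = wsum lam N xi (A1 `&` U) + wsum lam N xi A0 - wsum lam N xi (A0 `&` U).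
Proof.
move=> h; rewrite /wsum -big_split -sumrB; apply: eq_bigr => k _ /=.
have [->|lk] := eqVneq (lam k) 0; first by rewrite !mul0r addr0 subr0.
rewrite -mulrDr -mulrBr; congr (_ * _); have {h} := h k (ltn_ord k) lk.
rewrite !indicE !in_setI.
have inE' (A : set (I -> bool)) : (xi k \in A) = `[< A (xi k) >].
  by apply/idP/asboolP; [exact: set_mem|exact: mem_set].
rewrite !inE'; case: (asboolP (C _)) => hC; case: (asboolP (U _)) => hU;
  case: (asboolP (A1 _)) => h1; case: (asboolP (A0 _)) => h0 /= [k1 k2];
  first [by exfalso; tauto | lra].
Qed.

(** * Invariants of the recursion *)

Section invariants.
Context (R : realType) {d : Order.disp_t} (W : orderType d) (w1 : is_omega1 W).
Local Notation I := (nat + W)%type.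
Local Notation X := (I -> bool).
Local Notation iot := (@inl nat W).
Implicit Types (a b c : W) (x y : X).
Variables (gb : W -> nat -> X) (gc : W -> nat -> nat -> R).

(** The requirement on a stage is conditional on the invariants below it, so the recursion can be
    run before the invariants are proved. *)
Lemma exists_stages : exists D : W -> stage R W, forall b,
  valid b (D b) /\ (stage_hyp w1 (trunc b D) b -> stage_concl w1 gb gc (trunc b D) b (D b)).
Proof.
have [|D DP] := @omega1_choice _ W w1 _ (@stage0 R d W) (fun b f s =>
   valid b s /\ (stage_hyp w1 (trunc b f) b -> stage_concl w1 gb gc (trunc b f) b s)).
  move=> a h k hk s; suff -> : trunc a h = trunc a k by [].
  by apply/funext => c; rewrite /trunc; case: ifP => // /hk ->.
exists D => b; apply: DP.
have [h|nh] := pselect (stage_hyp w1 (trunc b D) b).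
  have [g|ng] := pselect (good_guess gb gc (trunc b D) b).
    by have [s [vs cs]] := stage_good h g; exists s.
  by have [s [vs cs]] := stage_trivial h ng; exists s.
by exists (@stage0 R d W); split=> //; exact: valid_stage0.
Qed.

Lemma seq_bounded (J : seq I) a b : (a < b)%O -> [set` J] `<=` low b ->
  exists c, [/\ (a <= c)%O, (c < b)%O & [set` J] `<=` lowe c].
Proof.
move=> ab; elim: J => [_|i J ih iJ]; first by exists a.
have [|c [ac cb Jc]] := ih; first by move=> j /= jJ; apply: iJ; rewrite /= inE jJ orbT.
have /iJ ib : [set` i :: J] i by rewrite /= inE eqxx.
case: i ib {iJ} => [n _|e /= eb].
  by exists c; split=> // j /=; rewrite inE => /orP[/eqP -> //|/Jc].
exists (Order.max c e); split; [by rewrite le_max ac|by rewrite gt_max cb|].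
move=> j /=; rewrite inE => /orP[/eqP ->|/Jc]; first by rewrite /= le_max lexx orbT.
by case: j => [//|j] /= jc; rewrite le_max jc.
Qed.

Lemma clops_bounded (Cs : seq (set X)) (T : set I) (P : W -> Prop) c0 : P c0 ->
  (forall J : seq I, [set` J] `<=` T -> forall a, P a -> exists c, [/\ (a <= c)%O, P c & [set` J] `<=` lowe c]) ->
  (forall C, C \in Cs -> clop T C) ->
  exists c, [/\ (c0 <= c)%O, P c & forall C, C \in Cs -> clop (lowe c) C].
Proof.
move=> Pc0 h; elim: Cs => [_|C Cs ih cCs]; first by exists c0.
have [|c [c0c Pc hc]] := ih; first by move=> C' C'in; apply: cCs; rewrite inE C'in orbT.
have [|J JT dC] := cCs C; first by rewrite inE eqxx.
have [e [ce Pe Je]] := h J JT c Pc.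
exists e; split=> //; first exact: le_trans ce.
move=> C'; rewrite inE => /orP[/eqP ->|/hc]; first by exists J.
by apply: clop_sub => -[//|i] /= /le_trans; apply.
Qed.

Lemma clop_upd b v A : clop (lowe b) A -> clop (low b) [set z | A (upd z b v)].
Proof.
move=> [J Jb dA]; exists [seq i <- J | i != inr b].
  move=> i /=; rewrite mem_filter => /andP[ib /Jb]; case: i ib => [//|c] /= cb.
  by rewrite le_eqVlt => /orP[/eqP E|//]; rewrite E eqxx in cb.
move=> x y xy /=; apply: dA => i /= iJ; rewrite /upd; case: eqVneq => // ib.
by apply: xy; rewrite /= mem_filter ib.
Qed.

Lemma upd_id b x : upd x b (x (inr b)) = x.
Proof. by apply/funext => i; rewrite /upd; case: eqVneq => [->|]. Qed.

Variable D : W -> stage R W.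
Hypothesis DP : forall b, valid b (D b) /\ (stage_hyp w1 (trunc b D) b -> stage_concl w1 gb gc (trunc b D) b (D b)).

Lemma vD b : valid b (D b). Proof. by case: (DP b). Qed.

Definition inv_le b := irr (lowe b) (Kle D b) /\
  forall a, (a <= b)%O -> sact (D a) ->
    promise1 (lowe b) (Kle D b) (prom w1 vD a) /\ promise2 (lowe b) (prom w1 vD a).

Definition inv_lt b := irr (low b) (Klt D b) /\
  forall a, (a < b)%O -> sact (D a) ->
    promise1 (low b) (Klt D b) (prom w1 vD a) /\ promise2 (low b) (prom w1 vD a).

Lemma Klt_Kle b c : (c < b)%O -> Klt D b `<=` Kle D c.
Proof. by move=> cb x Kx e ec; apply: Kx; exact: le_lt_trans cb. Qed.

Lemma irr_lt b : (forall c, (c < b)%O -> inv_le c) -> irr (low b) (Klt D b).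
Proof.
move=> ih A [J Jb dA] [x [Ax Kx]].
have [[c cb]|nb] := pselect (exists c, (c < b)%O).
  have [e [_ eb Je]] := seq_bounded cb Jb.
  have [||u [l ul]] := (ih e eb).1 A; [by exists J|by exists x; split=> //; exact: Klt_Kle Kx|].
  by exists u, l => z [Kz zc]; apply: ul; split=> //; exact: Klt_Kle Kz.
(* Here [b] is the least element of W, so [A] is given by finitely many coordinates in [nat]. *)
have [l hl] : exists l, forall n, inl n \in J -> (n < l)%N.
  elim: J {dA Jb} => [|[n|c] J [l hl]]; first by exists 0%N.
    exists (maxn l n.+1) => m; rewrite inE => /orP[/eqP[->]|/hl ml]; rewrite leq_max ?ltnSn ?orbT //.
    by rewrite ml.
  by exists l => m; rewrite inE => /orP[/eqP|/hl].
exists (x \o inl), l => z [Kz zc]; apply: dA Ax => -[n|c] /= iJ.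
  by rewrite zc //; exact: hl.
by exfalso; apply: nb; exists c; exact: (Jb _ iJ).
Qed.

(** An instance of a promise involves finitely many clopen sets, hence finitely many coordinates,
    and is already an instance at an earlier stage. *)
Lemma promises_lt b : (forall c, (c < b)%O -> inv_le c) -> forall a, (a < b)%O -> sact (D a) ->
    promise1 (low b) (Klt D b) (prom w1 vD a) /\ promise2 (low b) (prom w1 vD a).
Proof.
move=> ih a ab sa.
have bd (J : seq I) : [set` J] `<=` low b -> forall a, (a < b)%O -> exists c,
    [/\ (a <= c)%O, (c < b)%O & [set` J] `<=` lowe c] by move=> Jb e eb; exact: seq_bounded.
split.
  move=> o Cs e n0 cCs e0.
  have [c [ac cb hc]] := clops_bounded ab bd cCs.
  have [n n0n hn] := ((ih c cb).2 a ac sa).1 o Cs e n0 hc e0.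
  exists n => // xi lxi; apply: hn => k; have [Kx ax] := lxi k.
  by split=> //; exact: Klt_Kle Kx.
move=> C1 C0 e c1 c0 z1 z0 e0.
have [|c [ac cb hc]] := clops_bounded (Cs := [:: C1; C0]) ab bd.
  by move=> C; rewrite !inE => /orP[/eqP ->|/eqP ->].
by apply: ((ih c cb).2 a ac sa).2 => //; apply: hc; rewrite !inE eqxx ?orbT.
Qed.

Lemma promises_all : (forall c, inv_le c) -> forall a, sact (D a) ->
    promise1 setT (fun x => forall b, Kle D b x) (prom w1 vD a) /\ promise2 setT (prom w1 vD a).
Proof.
move=> ih a sa.
have bd (J : seq I) : [set` J] `<=` setT -> forall a, True -> exists c,
    [/\ (a <= c)%O, True & [set` J] `<=` lowe c].
  move=> _ e _; elim: J => [|i J [c [ec _ Jc]]]; first by exists e.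
  case: i => [n|f]; first by exists c; split=> // j /=; rewrite inE => /orP[/eqP ->|/Jc].
  exists (Order.max c f); split=> //; first by rewrite le_max ec.
  move=> j /=; rewrite inE => /orP[/eqP ->|/Jc]; first by rewrite /= le_max lexx orbT.
  by case: j => [//|j] /= jc; rewrite le_max jc.
split.
  move=> o Cs e n0 cCs e0.
  have [c [ac cb hc]] := clops_bounded (c0 := a) Logic.I bd cCs.
  have [n n0n hn] := ((ih c).2 a ac sa).1 o Cs e n0 hc e0.
  exists n => // xi lxi; apply: hn => k; have [Kx ax] := lxi k.
  by split=> //; exact: Kx.
move=> C1 C0 e c1 c0 z1 z0 e0.
have [|c [ac cb hc]] := clops_bounded (c0 := a) (Cs := [:: C1; C0]) Logic.I bd.
  by move=> C; rewrite !inE => /orP[/eqP ->|/eqP ->].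
by apply: ((ih c).2 a ac sa).2 => //; apply: hc; rewrite !inE eqxx ?orbT.
Qed.

Lemma Klt_trunc b : Klt (trunc b D) b = Klt D b.
Proof. by apply/seteqP; split=> x Kx c cb; have := Kx c cb; rewrite /trunc cb. Qed.

Lemma good_trunc b : good_guess gb gc D b -> good_guess gb gc (trunc b D) b.
Proof. by case=> h1 h2 h3 h4; split=> //; rewrite Klt_trunc. Qed.

Lemma concl_lt b : inv_lt b ->
  [/\ forall a, (a < b)%O -> sact (D a) ->
    keeps1 (low b) (Klt D b) (sU (D b)) (sV (D b)) (prom w1 vD a) /\ keeps2 (low b) (sU (D b)) (prom w1 vD a),
  keeps_irr (low b) iot (Klt D b) (sU (D b)) (sV (D b)) /\ keeps_irr (low b) iot (Klt D b) (sV (D b)) (sU (D b)),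
  good_guess gb gc D b -> spanned gb gc b (D b) & sact (D b) -> new_promise1 b (D b) /\ new_promise2 D b (D b)].
Proof.
move=> [hirr hpr].
have vT := valid_trunc (b := b) (D := D) (fun c _ => vD c).
have tE c : (c < b)%O -> D c = trunc b D c by move=> cb; rewrite /trunc cb.
have sim a : (a < b)%O -> promise_sim (low b) (prom w1 vD a) (prom w1 vT a).
  by move=> ab; exact: promise_sim_local.
have sim' a : (a < b)%O -> promise_sim (low b) (prom w1 vT a) (prom w1 vD a).
  by move=> ab; apply: promise_sim_local => // c cb; rewrite tE.
have [vb cb] := DP b.
have hb : stage_hyp w1 (trunc b D) b.
  split; rewrite Klt_trunc //; exists vT => a ab; rewrite -tE // => sa.
  have [h1 h2] := hpr a ab sa.
  by split; [exact: promise1_sim (sim a ab) _ h1|exact: promise2_sim (sim a ab) h2].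
have [k1 k2 k3 k4] := cb hb.
have dU : determ (low b) (sU (D b)) by exact: determ_sU vD b.
split.
- move=> a ab sa; have := k1 vT a ab; rewrite -tE // => /(_ sa)[h1 h2]; rewrite Klt_trunc in h1.
  by split; [exact: keeps1_sim (sim' a ab) _ _ _ dU h1|exact: keeps2_sim (sim' a ab) _ dU h2].
- by move: k2; rewrite Klt_trunc.
- by move=> /good_trunc.
- by move=> /k4[h1 [h2 h3 h4]]; split=> //; split=> //; rewrite -Klt_trunc.
Qed.

Section successor.
Variable b : W.
Hypothesis Ib : inv_lt b.
Let U := sU (D b).
Let V := sV (D b).

Let mU : msr U. Proof. by have [h _ _ _] := vD b; exact: msr_sopen h. Qed.
Let mV : msr V. Proof. by have [_ h _ _] := vD b; exact: msr_sopen h. Qed.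

Let Kle_lt x : Kle D b x -> Klt D b x.
Proof. by move=> Kx c /ltW; exact: Kx. Qed.

Let Kle_at x : Kle D b x -> (U x -> x (inr b)) /\ (V x -> ~ x (inr b)).
Proof. by apply. Qed.

(** A point with new coordinate 1 lies off [V], so the section of [A] at 1 contains a cylinder on
    which [U] forces the value 1; likewise for 0. *)
Lemma irr_le : irr (lowe b) (Kle D b).
Proof.
move=> A cA [x [Ax Kx]]; have [_ [ir1 ir2] _ _] := concl_lt Ib.
have [k1 k2] := Kle_at Kx; have cA' v := clop_upd v cA.
have xA : A (upd x b (x (inr b))) by rewrite upd_id.
case E : (x (inr b)).
  have [|e [l el]] := ir1 _ (cA' true).
    by exists x; split; [split; [rewrite -E|exact: Kle_lt]|move=> /k2; rewrite E].
  exists e, l => z [Kz zc]; have [|Az Uz] := el z; first by split=> //; exact: Kle_lt.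
  by move: Az; rewrite /= -[true](_ : z (inr b) = _) ?upd_id //; apply: (Kle_at Kz).1.
have [|e [l el]] := ir2 _ (cA' false).
  by exists x; split; [split; [rewrite -E|exact: Kle_lt]|move=> /k1; rewrite E].
exists e, l => z [Kz zc]; have [|Az Vz] := el z; first by split=> //; exact: Kle_lt.
by move: Az; rewrite /= -[false](_ : z (inr b) = _) ?upd_id //; apply/negbTE/negP; apply: (Kle_at Kz).2.
Qed.

Let split_mem (C : set X) x (t : bool) : (t = `[< U x >]) -> x (inr b) = t ->
  C x <-> (U x /\ C (upd x b true)) \/ (~ U x /\ C (upd x b false)).
Proof.
move=> tU xt; rewrite -{1}(upd_id b x) xt tU; case: asboolP => Ux; split.
- by left.
- by move=> [[]|[]].
- by right.
- by move=> [[]|[]].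
Qed.

(** The atoms lie in [U] or [V], so their new coordinate is known and the sum splits along [U]. The
    measures live on points that follow [U] above [a], so they split in the same way. *)
Lemma promise1_old a : (a < b)%O -> sact (D a) -> promise1 (lowe b) (Kle D b) (prom w1 vD a).
Proof.
move=> ab sa o Cs e n0 cCs e0; have [/(_ a ab sa)[k1 _] _ _ _] := concl_lt Ib.
have e3 : 0 < e / 3 by rewrite divr_gt0.
pose A v (C : set X) : set X := [set z | C (upd z b v)].
have cA v C : C \in Cs -> clop (low b) (A v C) by move=> /cCs; exact: clop_upd.
have [|n n0n hn] := k1 o ([seq A true C | C <- Cs] ++ [seq A false C | C <- Cs]) _ n0 _ e3.
  by move=> C; rewrite mem_cat => /orP[] /mapP[C' C'in ->]; exact: cA.
exists n => // xi lxi C Cin.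
have [|hs hC] := hn xi; first by move=> k; have [Kx ax] := lxi k; split=> //; exact: Kle_lt.
have [_ h1] := hC (A true C) ltac:(by rewrite mem_cat map_f).
have [h2 h3] := hC (A false C) ltac:(by rewrite mem_cat [X in _ || X]map_f ?orbT).
rewrite (@wsum_split _ _ _ _ _ C (A true C) (A false C) U); last first.
  move=> k kN lk; have [Kx _] := lxi k; have [kU kV] := Kle_at Kx.
  apply: split_mem erefl _; have [Ux|/kV nx] := hs k kN lk.
    by rewrite asboolT // kU.
  by rewrite asboolF; [exact/negbTE/negP|move=> /kU].
have [_ _ _ fk] := prom_ok w1 vD sa.
have mA v : msr (A v C) by apply: msr_clop (cA v C Cin).
have pkE v : pk (prom w1 vD a) o v C = pk (prom w1 vD a) o v (A true C `&` U) +
    pk (prom w1 vD a) o v (A false C) - pk (prom w1 vD a) o v (A false C `&` U).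
  rewrite (@pk_eq _ _ _ w1 D vD a o v C ((A true C `&` U) `|` (A false C `\` U))); last first.
    move=> x; rewrite (split_mem C erefl (jump_low w1 vD v x ab)).
    by split=> -[] []; [left|right|left|right].
  rewrite (fm_U (fk o v)); [|exact: msrI|exact: msrD|]; last first.
    by apply/seteqP; split=> // x [[_ ?] []].
  rewrite [X in _ = _ + X - _](fm_IC (fk o v) (mA false) mU); lra.
rewrite /pT !pkE; move: h1 h2 h3; rewrite /pT !ltr_norml => /andP[? ?] /andP[? ?] /andP[? ?].
by apply/andP; split; lra.
Qed.

(** A neighbourhood of the new stage is replaced by one of the old stage: inside a clopen part of
    [U] if the point is in [U], where the coordinate is 1, and otherwise up to an error in [U]. The
    old neighbourhoods and the two errors each take a third of [e]. *)
Lemma promise2_old a : (a < b)%O -> sact (D a) -> promise2 (lowe b) (prom w1 vD a).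
Proof.
move=> ab sa C1 C0 e c1 c0 z1 z0 e0; have [/(_ a ab sa)[_ k2] _ _ _] := concl_lt Ib.
have e3 : 0 < e / 3 by rewrite divr_gt0.
have [[u cu UE] _ _ _] := vD b.
have [_ _ _ fk] := prom_ok w1 vD sa.
set z := pz (prom w1 vD a) in z1 z0 *.
have zb v : z v (inr b) = `[< U (z v) >] by exact: jump_low.
have ex v C : clop (lowe b) C -> C (z v) -> exists C', [/\ clop (low b) C', C' (z v) &
    forall o, pk (prom w1 vD a) o v (~` C) <= pk (prom w1 vD a) o v (~` C') +
      (if `[< U (z v) >] then 0 else pk (prom w1 vD a) o v U)].
  move=> cC Cz; pose A := [set x | C (upd x b (z v (inr b)))].
  have cA : clop (low b) A by exact: clop_upd.
  have Az : A (z v) by rewrite /A /= upd_id.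
  have mC : msr C by exact: msr_clop cC.
  have jb x : jump w1 vD a v x (inr b) = `[< U (jump w1 vD a v x) >] by exact: jump_low.
  case: asboolP => Uz.
    move: (Uz); rewrite /U UE => -[k _ uk].
    have cAu : clop (low b) (A `&` u k) by exact: clopI.
    exists (A `&` u k); split=> // o; rewrite addr0; apply: pk_le => //.
    - exact: msrC.
    - by apply: msrC; exact: msr_clop cAu.
    - move=> x nC [Ax ux]; apply: nC; move: Ax; rewrite /A /= zb asboolT //.
      have -> : true = jump w1 vD a v x (inr b) by rewrite jb asboolT // /U UE; exists k.
      by rewrite upd_id.
  exists A; split=> // o.
  apply: le_trans (fm_leU (fk o v) (msrC (msr_clop cA)) mU); apply: pk_le => //.
  - exact: msrC.
  - by apply: msrU => //; apply: msrC; exact: msr_clop cA.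
  - move=> x nC; have [Ux|nU] := pselect (U (jump w1 vD a v x)); [by right|left => Ax; apply: nC].
    move: Ax; rewrite /A /= zb asboolF //.
    have -> : false = jump w1 vD a v x (inr b) by rewrite jb asboolF.
    by rewrite upd_id.
have [C1' [c1' z1' h1]] := ex true C1 c1 z1.
have [C0' [c0' z0' h0]] := ex false C0 c0 z0.
have [r [k3 k4 k5]] := k2 _ _ _ c1' c0' z1' z0' e3.
exists r.
have C_ge0 v C : clop (low b) C -> 0 <= pk (prom w1 vD a) r v (~` C).
  by move=> cC; apply: (fm_ge0 (fk r v)); apply: msrC; exact: msr_clop cC.
have g1 := C_ge0 true _ c1'; have g0 := C_ge0 false _ c0'.
have pos : 0 < e / 3 * pk (prom w1 vD a) r true setT by apply: le_lt_trans k3; exact: addr_ge0.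
have := h1 r; have := h0 r.
have t1 : (if `[< U (z true) >] then 0 else pk (prom w1 vD a) r true U) < e / 3 * pk (prom w1 vD a) r true setT.
  by case: asboolP => // nU; exact: k4.
have t0 : (if `[< U (z false) >] then 0 else pk (prom w1 vD a) r false U) < e / 3 * pk (prom w1 vD a) r true setT.
  by case: asboolP => // nU; exact: k5.
lra.
Qed.

Hypothesis sb_act : sact (D b).

(** By the splitting along [U], the section at 1 contributes its trace on [U], with limit half of
    [stau] on its undecided part in O. The section at 0 is nearly null as a whole and loses its
    trace on [U], which gives the opposite sign. *)
Lemma promise1_new : promise1 (lowe b) (Kle D b) (prom w1 vD b).
Proof.
move=> o Cs e n0 cCs e0; have [_ _ _ /(_ sb_act)[n1 _]] := concl_lt Ib.
have e3 : 0 < e / 3 by rewrite divr_gt0.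
pose A v (C : set X) : set X := [set z | C (upd z b v)].
have cA v C : C \in Cs -> clop (low b) (A v C) by move=> /cCs; exact: clop_upd.
case EO : (clop_enum w1 b) => [ec ecE].
have cO : clop (low b) (ec o) by have : range ec (ec o) by [exists o]; rewrite ecE.
have [|n n0n [hs hC]] := n1 (ec o) ([seq A true C | C <- Cs] ++ [seq A false C | C <- Cs]) _ n0 cO _ e3.
  by move=> C; rewrite mem_cat => /orP[] /mapP[C' C'in ->]; exact: cA.
exists n => // xi lxi C Cin.
have [_ h1] := hC (A true C) ltac:(by rewrite mem_cat map_f).
have [h2 h3] := hC (A false C) ltac:(by rewrite mem_cat [X in _ || X]map_f ?orbT).
have dU : determ (low b) U by exact: determ_sU vD b.
have ag k : agree (low b) (sb (D b) k) (xi k) by have [_] := lxi k.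
have tr B : determ (low b) B -> wsum (slam (D b) n) (sN (D b) n) xi B = wsum (slam (D b) n) (sN (D b) n) (sb (D b)) B.
  move=> dB; apply: eq_wsum => k _ _; split; apply: dB; [exact: agree_sym|exact: ag].
have dA v : determ (low b) (A v C) by exact: determ_clop (cA v C Cin).
rewrite (@wsum_split _ _ _ _ _ C (A true C) (A false C) U); last first.
  move=> k kN lk; have [Kx _] := lxi k; have [kU kV] := Kle_at Kx.
  apply: split_mem erefl _; have [Ux|Vx] := hs k kN lk.
    by have Ux' := dU _ _ (ag k) Ux; rewrite asboolT // kU.
  have /kV nx := determ_sV vD (ag k) Vx.
  by rewrite asboolF; [exact/negbTE/negP|move=> /kU].
rewrite !tr //; [|exact: determI|exact: determI].
have pkE v : pk (prom w1 vD b) o v C = stau (D b) ((A v C `&` ec o) `\` (U `|` V)).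
  rewrite /= EO /=; congr (stau _ _); apply/seteqP; split=> x /=.
    move=> [[Fx Ox] Cx]; split=> //; split=> //.
    apply: (dA v _ _ (agree_sym (@jump_agree _ _ _ w1 D vD b v x))).
    by rewrite /A /= -[X in upd _ b X](jump_at w1 vD b v x) upd_id.
  move=> [[Ax Ox] Fx]; split=> //.
  have := dA v _ _ (@jump_agree _ _ _ w1 D vD b v x) Ax.
  by rewrite /A /= -[X in upd _ b X](jump_at w1 vD b v x) upd_id.
rewrite /pT !pkE; move: h1 h2 h3; rewrite -/U -/V !ltr_norml => /andP[? ?] /andP[? ?] /andP[? ?].
by apply/andP; split; lra.
Qed.

(** For O take the intersection of the sections of [C1] at 1 and of [C0] at 0. Then no mass lies
    outside the neighbourhoods, and the total mass is positive because [sy] is in the support. *)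
Lemma promise2_new : promise2 (lowe b) (prom w1 vD b).
Proof.
move=> C1 C0 e c1 c0 z1 z0 e0; have [_ _ _ /(_ sb_act)[_ [_ _ ypos]]] := concl_lt Ib.
pose A v (C : set X) : set X := [set z | C (upd z b v)].
have cA v C : clop (lowe b) C -> clop (low b) (A v C) by exact: clop_upd.
have jA v C x : clop (lowe b) C -> C (jump w1 vD b v x) <-> A v C x.
  move=> cC; rewrite (_ : C (jump w1 vD b v x) = A v C (jump w1 vD b v x)); last first.
    by rewrite /A /= -[X in upd _ b X](jump_at w1 vD b v x) upd_id.
  by apply: clop_agreeE (cA v C cC) _; apply: agree_sym; exact: jump_agree.
case EO : (clop_enum w1 b) => [ec ecE].
have cAA : clop (low b) (A true C1 `&` A false C0) by apply: clopI; exact: cA.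
have [r oE] : exists r, ec r = A true C1 `&` A false C0.
  by have : range ec (A true C1 `&` A false C0); [rewrite ecE|move=> [r _ <-]; exists r].
have [_ _ _ fk] := prom_ok w1 vD sb_act.
have fm : fmeas (stau (D b)) by have [_ _ _ /(_ sb_act)[]] := vD b.
exists r; rewrite /= EO /= oE.
rewrite (_ : _ `&` jump w1 vD b true @^-1` (~` C1) = set0); last first.
  by apply/seteqP; split=> // x [[_ [A1 _]]] /=; apply; apply/jA.
rewrite (_ : _ `&` jump w1 vD b false @^-1` (~` C0) = set0); last first.
  by apply/seteqP; split=> // x [[_ [_ A0]]] /=; apply; apply/jA.
rewrite (fm0 fm) addr0 mulr_gt0 // preimage_setT setIT setIC -setDE; apply: ypos => //.
by split; apply/jA.
Qed.

End successor.

Lemma inv_le_all b : inv_le b.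
Proof.
elim/(omega1_ind w1): b => b ih.
have Ib : inv_lt b by split; [exact: irr_lt|exact: promises_lt].
split; first exact: irr_le.
move=> a; rewrite le_eqVlt => /orP[/eqP -> sa|ab sa].
  by split; [exact: promise1_new|exact: promise2_new].
by split; [exact: promise1_old|exact: promise2_old].
Qed.

Lemma inv_lt_all b : inv_lt b.
Proof. by split; [apply: irr_lt|apply: promises_lt] => c _; exact: inv_le_all. Qed.

End invariants.

(** * Twins *)

Lemma sum_widen (R : realType) (h : nat -> R) N M : (N <= M)%N -> (forall k, (N <= k)%N -> h k = 0) ->
  \sum_(k < M) h k = \sum_(k < N) h k.
Proof.
move=> NM h0; rewrite (big_ord_widen _ h NM) [LHS](bigID (fun k : 'I_M => (k < N)%N)) /=.
by rewrite [X in _ + X]big1 ?addr0 // => k; rewrite -leqNgt => /h0.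
Qed.

Section twins.
Context (R : realType) (I : choiceType).
Local Notation X := (I -> bool).

Definition ucont (K : set X) (f : X -> R) := forall e : R, 0 < e ->
  exists J : seq I, forall x y, K x -> K y -> agree [set` J] x y -> `|f x - f y| < e.

Lemma fm_partition (m : set X -> R) (T : finType) (P : X -> T) (Q : pred T) : fmeas m ->
  (forall t, msr [set x | P x = t]) ->
  msr [set x | Q (P x)] /\ \sum_(t | Q t) m [set x | P x = t] = m [set x | Q (P x)].
Proof.
move=> fm mP.
have h (s : seq T) : uniq s -> msr [set x | P x \in s /\ Q (P x)] /\
    \sum_(t <- s | Q t) m [set x | P x = t] = m [set x | P x \in s /\ Q (P x)].
  elim: s => [_|t s ih /= /andP[ts us]].
    rewrite (_ : [set x | _] = set0); last by apply/seteqP; split=> x // [].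
    by rewrite big_nil (fm0 fm); split=> //; exact: msr0.
  have [h1 h2] := ih us; rewrite big_cons.
  case: ifP => Qt.
    rewrite (_ : [set x | P x \in t :: s /\ _] = [set x | P x = t] `|` [set x | P x \in s /\ Q (P x)]).
      split; first exact: msrU.
      rewrite (fm_U fm) // ?h2 //; apply/seteqP; split=> // x /= [Px [Pxs _]].
      by rewrite -Px Pxs in ts.
    apply/seteqP; split=> x /=; rewrite inE.
      by move=> [/orP[/eqP|] ? ?]; [left|right].
    by move=> [->|[-> ->]]; rewrite ?eqxx ?Qt ?orbT.
  rewrite (_ : [set x | P x \in t :: s /\ _] = [set x | P x \in s /\ Q (P x)]) //.
  apply/seteqP; split=> x /=; rewrite inE; last by move=> [-> ->]; rewrite orbT.
  by move=> [/orP[/eqP ->|->]]; rewrite ?Qt.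
have [h1 h2] := h _ (index_enum_uniq T).
rewrite h2; rewrite (_ : [set x | Q (P x)] = [set x | P x \in index_enum T /\ Q (P x)]) //.
by apply/seteqP; split=> x /=; [move=> Qx; rewrite mem_index_enum|move=> []].
Qed.

Lemma twin_eq (K : set X) (pi : promise R I) (f : X -> R) (M : R) (xi : nat -> X) i0 :
  promise_ok pi -> promise1 setT K pi -> promise2 setT pi ->
  (forall o, pk pi o false setT = pk pi o true setT) ->
  K (pz pi true) -> K (pz pi false) -> pz pi true i0 <> pz pi false i0 ->
  (forall x, K x -> `|f x| <= M) -> ucont K f ->
  (forall n, \sum_(k < pN pi n) `|plam pi n k| = 1) ->
  lifts K pi xi -> (forall n, \sum_(k < pN pi n) plam pi n k * f (xi k) = 0) ->
  f (pz pi true) = f (pz pi false).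
Proof.
(* On a fine partition into cells, f is nearly constant.  The combinations kill f,
   hence so does the limit (pk r true - pk r false) / 2; as these two measures have
   equal mass and concentrate near the two points, f takes nearly equal values
   there. *)
move=> [_ _ _ fk] P1 P2 pkT K1 K0 zi0 fM uf lam1 lxi kill.
set z1 := pz pi true in K1 zi0 *; set z0 := pz pi false in K0 zi0 *.
have M0 : 0 <= M by apply: le_trans (fM _ K1).
apply/eqP; rewrite -subr_eq0 -normr_le0; apply/ler_addgt0Pr => e' e'0; rewrite add0r.
(* In units of [e * c] the errors are 4 from [cl1] and [cl2], doubled because the limit is half a
   difference, 2 from the two averages, and [2 * M] from the mass outside the neighbourhoods. *)
pose e := e' / (6 + 2 * M); have e0 : 0 < e by rewrite divr_gt0 //; lra.
have [J1 hJ1] := uf e e0.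
(* Including [i0] makes the two neighbourhoods disjoint. *)
pose C (v : bool) := [set x | agree [set` i0 :: J1] (pz pi v) x].
have cC v : clop setT (C v) by exact: clop_agrees.
have mC v : msr (C v) by exact: msr_clop (cC v).
have [||r hr] := P2 (C true) (C false) e (cC _) (cC _) _ _ e0; [by []|by []|].
set c := pk pi r true setT in hr.
have pk_ge0 v A : msr A -> 0 <= pk pi r v A by exact: (fm_ge0 (fk r v)).
have c0 : 0 < c.
  rewrite -(pmulr_rgt0 _ e0); apply: le_lt_trans hr.
  by apply: addr_ge0; apply: pk_ge0; exact: msrC.
pose eta : R := e * c; have eta0 : 0 < eta by exact: mulr_gt0.
have [J2 hJ2] := uf eta eta0.
pose J := (i0 :: J1) ++ J2.
pose P (x : X) := map_tuple x (in_tuple J).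
have PE x y : P x = P y <-> agree [set` J] x y.
  split=> [/(congr1 val) E i /= iJ|h]; first by have /eq_in_map : map x J = map y J by []; apply.
  have E : map x J = map y J by apply/eq_in_map => i; exact: h.
  by apply: val_inj; exact: E.
have sub1 x y : P x = P y -> agree [set` i0 :: J1] x y.
  by move=> /PE/agree_cat[].
have sub2 x y : P x = P y -> agree [set` J2] x y.
  by move=> /PE/agree_cat[].
pose cell t := [set x | P x = t].
have ccell t : clop setT (cell t).
  by exists J => // x y xy; rewrite /cell /= => <-; apply/PE; exact: agree_sym.
have mcell t : msr (cell t) by exact: msr_clop (ccell t).
(* A cell need not meet K. It then gets the value of [f] at the one of the two points that it is
   near to, which keeps [gC] true for all points of the cube. *)
pose g t : R := if pselect (exists x, K x /\ P x = t) is left h then f (projT1 (cid h))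
  else if pselect (exists x, C true x /\ P x = t) then f z1 else f z0.
have g1 x : K x -> `|g (P x) - f x| <= eta.
  move=> Kx; rewrite /g; case: pselect => [h|[]]; last by exists x.
  by have [Ky /sub2 Pyx] := projT2 (cid h); apply/ltW/hJ2.
have gC v x : C v x -> `|g (P x) - f (pz pi v)| <= e.
  move=> Cx; have Kv : K (pz pi v) by case: v {Cx}.
  rewrite /g; case: pselect => [h|nh].
    have [Ky /sub1 Pyx] := projT2 (cid h); apply/ltW/hJ1 => //.
    by have /agree_cons[_] := agree_trans Pyx (agree_sym Cx).
  case: pselect => [[y [C1y Pyx']]|n1] /=; [have Pyx := sub1 _ _ Pyx'|]; case: v Cx {Kv} => Cx.
  - by rewrite subrr normr0 ltW.
  - exfalso; apply: zi0; have i0J : [set` i0 :: J1] i0 by rewrite /= inE eqxx.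
    by rewrite /z1 /z0 (C1y i0 i0J) (Pyx i0 i0J) -(Cx i0 i0J).
  - by exfalso; apply: n1; exists x.
  - by rewrite subrr normr0 ltW.
have gM t : `|g t| <= M.
  rewrite /g; case: pselect => [h|_]; first by have [Ky _] := projT2 (cid h); exact: fM.
  by case: pselect => h /=; exact: fM.
pose T : finType := (size J).-tuple bool.
have average v : `|\sum_(t : T) g t * pk pi r v (cell t) - f (pz pi v) * pk pi r v setT| <=
    e * pk pi r v setT + 2 * M * pk pi r v (~` C v).
  pose s (t : T) := `[< exists x, C v x /\ P x = t >].
  have [_ sumT] := fm_partition xpredT (fk r v) mcell.
  rewrite (_ : [set x | xpredT (P x)] = setT) in sumT; last by apply/seteqP; split.
  have [ms sums] := fm_partition (fun t => ~~ s t) (fk r v) mcell.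
  rewrite -sumT mulr_sumr -sumrB.
  apply: le_trans (ler_norm_sum _ _ _) _.
  apply: le_trans (_ : \sum_(t : T) (e * pk pi r v (cell t) +
      2 * M * (if ~~ s t then pk pi r v (cell t) else 0)) <= _).
    apply: ler_sum => t _; rewrite -mulrBl normrM (ger0_norm (pk_ge0 v _ (mcell t))).
    case: ifPn => [st|].
      rewrite -mulrDl; apply: ler_wpM2r; first exact: pk_ge0.
      apply: le_trans (ler_normB _ _) _.
      have Kv : K (pz pi v) by case: v {s sumT ms sums st}.
      have := gM t; have := fM _ Kv; lra.
    rewrite negbK mulr0 addr0 => /asboolP[x [Cx <-]].
    by apply: ler_wpM2r; [exact: pk_ge0|exact: gC].
  rewrite big_split /= -!mulr_sumr -big_mkcond /= sums sumT lerD2l.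
  apply: ler_wpM2l; first by rewrite mulr_ge0.
  apply: (fm_le (fk r v)) => //; first exact: msrC.
  by move=> x /= /asboolP sx Cx; apply: sx; exists x.
(* The errors on the cells are weighted by values of size at most [M] and add up over [#|T|] cells
   to at most [eta]. *)
pose e2 := eta / (#|T|%:R * M + 1).
have d0 : 0 < #|T|%:R * M + 1 :> R by apply: ltr_wpDl => //; rewrite mulr_ge0.
have e20 : 0 < e2 by exact: divr_gt0.
have [|n _ /(_ xi lxi) hn] := P1 r [seq cell t | t <- enum T] e2 0%N _ e20.
  by move=> _ /mapP[t _ ->].
have cl1 : `|\sum_(t : T) g t * wsum (plam pi n) (pN pi n) xi (cell t)
    - \sum_(t : T) g t * pT pi r (cell t)| <= eta.
  rewrite -sumrB; apply: le_trans (ler_norm_sum _ _ _) _.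
  apply: le_trans (_ : \sum_(t : T) M * e2 <= _).
    apply: ler_sum => t _; rewrite -mulrBr normrM; apply: ler_pM => //.
    by apply/ltW/hn; apply: map_f; rewrite mem_enum.
  rewrite sumr_const -mulr_natl mulrA /e2 mulrCA ler_piMr //; first exact: ltW.
  by rewrite ler_pdivrMr // mul1r lerDl.
have cl2 : `|\sum_(t : T) g t * wsum (plam pi n) (pN pi n) xi (cell t)| <= eta.
  have -> : \sum_(t : T) g t * wsum (plam pi n) (pN pi n) xi (cell t) =
      \sum_(k < pN pi n) plam pi n k * (g (P (xi k)) - f (xi k)).
    under [RHS]eq_bigr => k _ do rewrite mulrBr.
    rewrite sumrB kill subr0; under eq_bigr => t _ do rewrite mulr_sumr.
    rewrite exchange_big /=; apply: eq_bigr => k _.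
    rewrite (bigD1 (P (xi k))) //= big1 ?addr0 => [|t tP]; rewrite indicE.
      by rewrite mem_set // mulr1 mulrC.
    by rewrite memNset ?mulr0 // => /= E; rewrite E eqxx in tP.
  apply: le_trans (ler_norm_sum _ _ _) _.
  rewrite -[leRHS]mul1r -(lam1 n) mulr_suml; apply: ler_sum => k _.
  by rewrite normrM; apply: ler_wpM2l => //; apply: g1; have [] := lxi k.
have SE : \sum_(t : T) g t * pT pi r (cell t) = (\sum_(t : T) g t * pk pi r true (cell t) -
    \sum_(t : T) g t * pk pi r false (cell t)) / 2.
  by rewrite -sumrB mulr_suml; apply: eq_bigr => t _; rewrite /pT; lra.
have := average true; have := average false; rewrite pkT -/c -/z1 -/z0.
move: cl1 cl2; rewrite SE {SE}.
set s1 := \sum_(t : T) _ * pk pi r true _; set s0 := \sum_(t : T) _ * pk pi r false _.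
set w := \sum_(t : T) _; move=> cl1 cl2 av0 av1.
have Mhr : 2 * M * pk pi r true (~` C true) + 2 * M * pk pi r false (~` C false) <= 2 * M * (e * c).
  by rewrite -mulrDr; apply: ler_wpM2l (ltW hr); rewrite mulr_ge0.
have key : `|f z1 - f z0| * c <= e' * c.
  have -> : e' * c = (6 + 2 * M) * (e * c).
    by rewrite /e mulrA; congr (_ * c); rewrite mulrC divfK //; apply: lt0r_neq0; lra.
  rewrite -[c in leLHS](gtr0_norm c0) -normrM mulrBl.
  move: cl1 cl2 av0 av1; rewrite -/eta !ler_norml => /andP[? ?] /andP[? ?] /andP[? ?] /andP[? ?].
  rewrite -/eta in Mhr *.
  by apply/andP; split; lra.
by rewrite -(ler_pM2r c0).
Qed.

End twins.

Section twins_in_K.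
Context (R : realType) {d : Order.disp_t} (W : orderType d) (w1 : is_omega1 W).
Local Notation I := (nat + W)%type.
Local Notation X := (I -> bool).
Implicit Types (a b c : W) (x y : X).
Variables (gb : W -> nat -> X) (gc : W -> nat -> nat -> R).
Variable D : W -> stage R W.
Hypothesis DP : forall b, valid b (D b) /\ (stage_hyp w1 (trunc b D) b -> stage_concl w1 gb gc (trunc b D) b (D b)).

Definition Kall : set X := [set x | forall b, Kle D b x].

Lemma twins b : good_guess gb gc D b -> exists p q, [/\ Kall p, Kall q, agree (low b) p q, p (inr b) <> q (inr b) &
  forall (f : X -> R) (M : R) xi, (forall x, Kall x -> `|f x| <= M) -> ucont Kall f ->
   (forall k, Kall (xi k) /\ agree (low b) (gb b k) (xi k)) ->
   (forall n N, (forall k, (N <= k)%N -> gc b n k = 0) -> \sum_(k < N) gc b n k * f (xi k) = 0) ->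
   f p = f q].
Proof.
move=> gd.
have [_ _ /(_ gd)[sa sbE lamE lamN lam1] /(_ sa)[_ [yK yF _]]] := concl_lt (inv_lt_all DP b).
have [P1 P2] := promises_all (inv_le_all DP) sa.
pose vD := vD DP.
have Kz v : Kall (jump w1 vD b v (sy (D b))).
  move=> c e ec; have [e' ce'] := omega1_unbounded w1 e.
  exact: (jump_K w1 vD v (b := e') yK yF).
exists (pz (prom w1 vD b) true), (pz (prom w1 vD b) false); split.
- exact: Kz.
- exact: Kz.
- by apply: agree_trans (agree_sym (@jump_agree _ _ _ w1 D vD b true _)) (@jump_agree _ _ _ w1 D vD b false _).
- by rewrite /= !jump_at.
move=> f M xi fM uf lxi kill.
apply: (twin_eq (xi := xi) (M := M) (i0 := inr b) (prom_ok w1 vD sa) P1 P2) => //.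
- exact: Kz.
- exact: Kz.
- by rewrite /= !jump_at.
- by move=> k; have [h1 h2] := lxi k; split; [exact: h1|rewrite /= sbE; exact: h2].
- move=> n /=; have [q [t tE]] := lamE n.
  have [_ _ gsupp _] := gd; have [N0 N0P] := choice gsupp.
  pose N := maxn (sN (D b) n) (\max_(i < q) N0 i).
  rewrite -(@sum_widen _ (fun k => slam (D b) n k * f (xi k)) _ N (leq_maxl _ _)); last first.
    by move=> k nk; rewrite lamN ?mul0r.
  under eq_bigr => k _ do rewrite tE mulr_suml.
  rewrite exchange_big /= big1 // => i _.
  under eq_bigr => k _ do rewrite -mulrA.
  rewrite -mulr_sumr kill ?mulr0 // => k Nk; apply: N0P; apply: leq_trans Nk.
  by rewrite leq_max; apply/orP; right; exact: (leq_bigmax (F := fun i : 'I_q => N0 i)).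
Qed.

End twins_in_K.

Lemma omega1_least {d : Order.disp_t} (W : orderType d) : is_omega1 W ->
  exists m : W, forall b, (m <= b)%O.
Proof.
move=> w1; have [|m _ mmin] := @omega1_min _ W w1 setT; last by exists m => b; exact: mmin.
by apply/set0P/eqP => W0; have [_ []] := w1; rewrite W0; exact: countable0.
Qed.

Section nonempty.
Context (R : realType) {d : Order.disp_t} (W : orderType d) (w1 : is_omega1 W).
Local Notation I := (nat + W)%type.
Local Notation X := (I -> bool).
Variables (gb : W -> nat -> X) (gc : W -> nat -> nat -> R).
Variable D : W -> stage R W.
Hypothesis DP : forall b, valid b (D b) /\ (stage_hyp w1 (trunc b D) b -> stage_concl w1 gb gc (trunc b D) b (D b)).

(** At the least element of W take the value that the stage forces there, then continue
    minimally. *)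
Lemma Kall_inl (t : nat -> bool) : exists2 x, Kall D x & forall n, x (inl n) = t n.
Proof.
have [m mmin] := omega1_least w1.
pose x0 : X := fun i => if i is inl n then t n else false.
pose v := `[< sU (D m) x0 >].
have vD := vD DP.
have ja := @jump_agree _ _ _ w1 D vD m v x0.
exists (jump w1 vD m v x0) => [b c _|n]; last by rewrite -ja.
have := mmin c.
have uv e x : sU (D e) x -> sV (D e) x -> False.
  by have [_ _ h _] := vD e => Ux Vx; have : (sU (D e) `&` sV (D e)) x by []; rewrite h.
rewrite le_eqVlt => /orP[/eqP <-|mc].
  rewrite jump_at /v; split=> h; first by apply/asboolP; apply: determ_sU h => //; exact: agree_sym.
  move=> /asboolP Ux; apply: (uv m x0) => //.
  by apply: determ_sV h => //; exact: agree_sym.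
rewrite jump_low //; split=> h; first exact/asboolP.
by move=> /asboolP /uv; apply.
Qed.

Lemma lowe_seq (J : seq I) : exists c, [set` J] `<=` lowe c.
Proof.
elim: J => [|i J [c Jc]].
  by have [w _] := omega1_least w1; exists w.
case: i => [n|f]; first by exists c => j /=; rewrite inE => /orP[/eqP ->|/Jc].
exists (Order.max c f) => j /=; rewrite inE => /orP[/eqP ->|/Jc]; first by rewrite /= le_max lexx orbT.
by case: j => [//|j] /= jc; rewrite le_max jc.
Qed.

Lemma Kall_cyl A : clop setT A -> A `&` Kall D !=set0 ->
  exists e l, Kall D `&` cyl inl e l `<=` A.
Proof.
move=> [J _ dA] [x [Ax Kx]]; have [c Jc] := lowe_seq J.
have [h _] := inv_le_all DP c.
have [||e [l el]] := h A; first by exists J.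
  by exists x; split=> //; exact: Kx.
by exists e, l => z [Kz zc]; apply: el; split=> //; exact: Kz.
Qed.

Lemma Kall_closed x : ~ Kall D x -> exists C, [/\ clop setT C, C x & C `&` Kall D = set0].
Proof.
move=> nK; have [b nKb] : exists b, ~ Kle D b x.
  by apply: contrapT => nex; apply: nK => b; apply: contrapT => nKb; apply: nex; exists b.
have [b' bb'] := omega1_unbounded w1 b.
have [|C [cC Cx CK]] := Klt_closed (vD DP) (b := b') (x := x).
  by move=> Kx; apply: nKb => c cb; apply: Kx; exact: le_lt_trans bb'.
exists C; split=> //; first exact: clop_sub cC.
apply/seteqP; split=> // z [Cz Kz]; rewrite -CK; split=> // c _; exact: (Kz c).
Qed.

Lemma Klt_agree b x y : agree (low b) x y -> Klt D b x -> Klt D b y.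
Proof.
move=> xy Kx c cb; have [h1 h2] := Kx c cb; rewrite -xy //.
have yx : agree (low c) y x by apply: agree_sub (agree_sym xy); apply: low_low; exact: ltW.
have dU : determ (low c) (sU (D c)) by exact: (@determ_sU _ _ _ D (vD DP)).
have dV : determ (low c) (sV (D c)) by exact: (@determ_sV _ _ _ D (vD DP)).
by split=> h; [apply: h1; exact: dU yx h|apply: h2; exact: dV yx h].
Qed.

End nonempty.

Section coding.
Context (R : realType).

(* One coordinate of all guessed points, and again at each coordinate the data
   that do not depend on it: the coordinates in [nat] and the coefficients. *)
Definition guess := ((nat -> bool) * ((nat -> nat -> bool) * (nat -> nat -> R)))%type.

(** A real coefficient is coded by the rationals below it. *)
Lemma guess_card : ([set: guess] #<= [set: set nat])%card.
Proof.
pose code (s : guess) (z : nat + (nat * nat + nat * nat * rat)) :=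
  match z with
  | inl k => s.1 k
  | inr (inl (k, n)) => s.2.1 k n
  | inr (inr (n, k, q)) => ratr q < s.2.2 n k
  end.
apply: (@card_le_fun _ _ _ _ (fun s => [set choice.pickle z | z in [set z | code s z]])) => // s s' _ _ E.
have {}E z : code s z = code s' z.
  have imp u v : [set choice.pickle z | z in [set z | code u z]] = [set choice.pickle z | z in [set z | code v z]] ->
      code u z -> code v z.
    move=> uv cu; have : [set choice.pickle z | z in [set z | code u z]] (choice.pickle z) by exists z.
    by rewrite uv => -[z' cz' /(pcan_inj choice.pickleK) <-].
  by apply/idP/idP; exact: imp.
case: s s' E => s1 [s2 s3] [t1 [t2 t3]] E; congr (_, (_, _)).
- by apply/funext => k; exact: (E (inl k)).
- by apply/funext => k; apply/funext => n; exact: (E (inr (inl (k, n)))).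
- apply/funext => n; apply/funext => k.
  have Eq q : (ratr q < s3 n k) = (ratr q < t3 n k) by exact: (E (inr (inr (n, k, q)))).
  by case: (ltgtP (s3 n k) (t3 n k)) => // /rat_in_itvoo[q]; rewrite in_itv /= => /andP[];
    [move=> /ltW; rewrite leNgt Eq => /negbTE ->|move=> /ltW; rewrite leNgt -Eq => /negbTE ->].
Qed.

End coding.

Section space.
Context (R : realType) {d : Order.disp_t} (W : orderType d).
Local Notation I := (nat + W)%type.
Local Notation X := (I -> bool).

(** The facts about the constructed set from which all topological properties are derived. *)
Record rich (K : set X) : Prop := Rich {
  rich_closed : forall x, ~ K x -> exists C, [/\ clop setT C, C x & C `&` K = set0];
  rich_cyl : forall A, clop setT A -> A `&` K !=set0 -> exists e l, K `&` cyl inl e l `<=` A;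
  rich_inl : forall t : nat -> bool, exists2 x, K x & forall n, x (inl n) = t n;
  rich_twins : forall (xi : nat -> X) (c : nat -> nat -> R) a0,
    (forall k, K (xi k)) -> injective xi ->
    (forall n, exists N, forall k, (N <= k)%N -> c n k = 0) ->
    (forall p (t : 'I_p -> R), (forall k, \sum_(n < p) t n * c n k = 0) -> forall n, t n = 0) ->
    exists p q, [/\ K p, K q, agree (low a0) p q, p <> q &
      forall (f : X -> R) (M : R), (forall x, K x -> `|f x| <= M) -> ucont K f ->
      (forall n N, (forall k, (N <= k)%N -> c n k = 0) -> \sum_(k < N) c n k * f (xi k) = 0) ->
      f p = f q] }.

Theorem exists_rich : is_omega1 W -> diamond W -> exists K : set X, rich K.
Proof.
move=> w1 dW.
have [m mmin] := omega1_least w1.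
have [G GP] := diamond_fun w1 ((fun=> true, (fun _ _ => true, fun _ _ => 0)) : guess R) dW (@guess_card R).
pose gb a k : X := fun i => match i with inl n => (G a m).2.1 k n | inr b => (G a b).1 k end.
pose gc a := (G a m).2.2.
have [D DP] := exists_stages w1 gb gc.
exists (Kall D); split; [exact: Kall_closed DP|exact: Kall_cyl DP|exact: Kall_inl DP|].
move=> xi c a0 Kxi xinj csupp cfree.
pose Xc b : guess R := (fun k => xi k (inr b), (fun k n => xi k (inl n), c)).
(* One separating coordinate for each pair of points; these are countably many, so they are
   bounded. *)
have [a1 a1P] : exists a, forall k l, agree (low a) (xi k) (xi l) -> k = l.
  have /choice[i iP] : forall kl : nat * nat, exists i, kl.1 <> kl.2 -> xi kl.1 i <> xi kl.2 i.
    move=> [k l] /=; have [->|kl] := pselect (k = l); first by exists (inl 0%N).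
    have [i ni] : exists i, xi k i <> xi l i.
      apply: contrapT => nex; apply: kl; apply: xinj; apply/funext => i.
      by apply: contrapT => ni; apply: nex; exists i.
    by exists i.
  have [|a aP] := @countable_ub _ _ w1 ((fun kl => if i kl is inr b then b else m) @` [set: nat * nat]).
    by apply: card_le_trans (card_image_le _ _) _; exact: countableP.
  exists a => k l kl; apply: contrapT => nkl; apply: (iP (k, l) nkl); apply: kl.
  have : ((if i (k, l) is inr b then b else m) < a)%O by apply: aP; exists (k, l).
  by case: (i (k, l)).
(* Beyond [m], where the common data are read; beyond [a0], up to which the twins must agree; beyond
   [a1], below which the points are distinct. *)
have [b /= bE] := stationary_gt w1 (Order.max m (Order.max a0 a1)) (GP Xc).
rewrite !gt_max => /and3P[mb a0b a1b].
have ag k : agree (low b) (gb b k) (xi k).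
  by move=> [n _|e eb]; rewrite /gb /= bE.
have gcE : gc b = c by rewrite /gc bE.
have gd : good_guess gb gc D b.
  split=> [k|k l kl||]; rewrite ?gcE //.
    by apply: (Klt_agree DP) (agree_sym (ag k)) _ => e eb; exact: (Kxi k e).
  apply: a1P; apply: agree_sub (low_low (ltW a1b)) _.
  exact: agree_trans (agree_sym (ag k)) (agree_trans kl (ag l)).
have [p [q [Kp Kq pq npq tw]]] := twins DP gd.
exists p, q; split=> //.
- by apply: agree_sub pq; apply: low_low; exact: ltW.
- by move=> E; rewrite E in npq.
- by move=> f M fM uf kill; apply: (tw f M xi) => // n N; rewrite gcE; exact: kill.
Qed.

End space.

(** * The space *)

Section subcube.
Context (I : choiceType) (K : set (I -> bool)).

Record subcube := Subcube { kval : I -> bool ; kvalP : K kval }.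

Lemma kval_inj : injective kval.
Proof. by move=> [x Kx] [y Ky] /= xy; move: Kx Ky; rewrite xy => Kx Ky; congr Subcube; exact: Prop_irrelevance. Qed.

Lemma kval_neq x y : x <> y -> exists i, kval x i <> kval y i.
Proof.
move=> xy; apply: contrapT => nex; apply: xy; apply: kval_inj; apply/funext => i.
by apply: contrapT => ni; apply: nex; exists i.
Qed.

HB.instance Definition _ := gen_eqMixin subcube.
HB.instance Definition _ := gen_choiceMixin subcube.

Definition cell (J : seq I) (x : subcube) : set subcube := [set y | agree [set` J] (kval x) (kval y)].

Let sopenT (A : set subcube) := forall x, A x -> exists J, cell J x `<=` A.

Let sopenTT : sopenT setT. Proof. by move=> x _; exists [::]. Qed.

Let cell_cat J J' x : cell (J ++ J') x `<=` cell J x `&` cell J' x.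
Proof. by move=> y /agree_cat. Qed.

Let sopenTI : setI_closed sopenT.
Proof.
move=> A B oA oB x [/oA[J JA] /oB[J' JB]]; exists (J ++ J') => y /cell_cat[Jy J'y].
by split; [exact: JA|exact: JB].
Qed.

Let sopenTU (T : Type) (f : T -> set subcube) : (forall t, sopenT (f t)) -> sopenT (\bigcup_t f t).
Proof. by move=> of_ x [t _ /of_[J Jf]]; exists J => y /Jf; exists t. Qed.

HB.instance Definition _ := isOpenTopological.Build subcube sopenTT sopenTI sopenTU.

Lemma cell_id J x : cell J x x. Proof. by []. Qed.

Lemma open_cellP (A : set subcube) : open A <-> forall x, A x -> exists J, cell J x `<=` A.
Proof. by []. Qed.

Lemma open_clop C : clop setT C -> open [set x : subcube | C (kval x)].
Proof. by move=> [J _ dC]; apply/open_cellP => x Cx; exists J => y xy; exact: dC Cx. Qed.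

Lemma clopen_clop C : clop setT C -> clopen [set x : subcube | C (kval x)].
Proof.
move=> cC; split; first exact: open_clop.
by rewrite -openC; exact: (open_clop (clopC cC)).
Qed.

Lemma clop_cell (J : seq I) (x : subcube) : clop setT [set y | agree [set` J] (kval x) y].
Proof. exact: clop_agrees. Qed.

Lemma nbhs_cellP (x : subcube) (A : set subcube) : nbhs x A <-> exists J, cell J x `<=` A.
Proof.
rewrite nbhsE; split=> [[B [/open_cellP oB Bx] BA]|[J JA]].
  by have [J JB] := oB x Bx; exists J; exact: subset_trans BA.
by exists (cell J x) => //; split; [exact: open_clop (clop_cell J x)|exact: cell_id].
Qed.

Lemma subcube_hausdorff : hausdorff_space subcube.
Proof.
move=> x y xy; apply: kval_inj; apply/funext => i.
have [||z [xz yz]] := xy (cell [:: i] x) (cell [:: i] y); [by apply/nbhs_cellP; exists [:: i]..|].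
by rewrite (xz i) ?(yz i) //= inE.
Qed.

Lemma subcube_clopen_basis : has_clopen_basis subcube.
Proof.
exists clopen => //; split=> [A []//|x A /nbhs_cellP[J JA]].
by exists (cell J x) => //; split; [exact: clopen_clop (clop_cell J x)|exact: cell_id].
Qed.

Lemma continuous_indic (R : realType) C : clop setT C -> continuous (fun x : subcube => \1_C (kval x) : R).
Proof.
move=> [J _ dC] x A Ax; apply/nbhs_cellP; exists J => y xy /=.
have -> : \1_C (kval y) = \1_C (kval x) :> R.
  rewrite !indicE; congr (_ %:R); congr nat_of_bool; apply/asbool_equiv_eq.
  by split; apply: dC => //; exact: agree_sym.
exact: nbhs_singleton Ax.
Qed.

Hypothesis closedK : forall x, ~ K x -> exists C, [/\ clop setT C, C x & C `&` K = set0].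

Lemma subcube_ulim (T : Type) (F : set_system T) (u : T -> subcube) : UltraFilter F ->
  exists y, forall J, F [set t | cell J y (u t)].
Proof.
move=> UF; have [y yP] := cube_ulim (kval \o u) UF.
suff Ky : K y.
  by exists (Subcube Ky) => J; apply: filterS (yP J) => t; exact: agree_sym.
apply: contrapT => /closedK[C [[J _ dC] Cy CK]].
have [t ty] : exists t, agree [set` J] (kval (u t)) y by exact: (@filter_ex _ F _ _ (yP J)).
have : (C `&` K) (kval (u t)) by split; [exact: dC (agree_sym ty) Cy|exact: kvalP].
by rewrite CK.
Qed.

Lemma subcube_compact : compact [set: subcube].
Proof.
rewrite compact_ultra => F UF _; have [y yP] := subcube_ulim id UF.
by exists y; split=> // A /= /nbhs_cellP[J JA]; apply: filterS JA (yP J).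
Qed.

(** The sets of indices at which the pair agrees on [J] generate a proper filter; along an
    ultrafilter above it both families have the same limit. *)
Lemma subcube_twin_ulim (T : Type) (u v : T -> subcube) :
  (forall J, exists t, cell J (u t) (v t)) ->
  exists F : set_system T, UltraFilter F /\
    exists y, forall J, F [set t | cell J y (u t) /\ cell J y (v t)].
Proof.
move=> uv; pose G := filter_from [set: seq I] (fun J => [set t | cell J (u t) (v t)]).
have PG : ProperFilter G.
  apply: filter_from_proper => [|J _]; last by have [t] := uv J; exists t.
  apply: filter_from_filter; first by exists [::].
  move=> J J' _ _; by exists (J ++ J') => // t /agree_cat.
have [F [UF GF]] := ultraFilterLemma PG.
exists F; split=> //; have [y yP] := subcube_ulim u UF; exists y => J.
apply: (@filterS2 _ F _ _ _ _ _ (yP J)) (GF _ (ex_intro2 _ _ J Logic.I (fun t h => h))) => t yu uv'.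
by split=> //; exact: agree_trans uv'.
Qed.

Lemma continuous_uniform (R : realType) (f : subcube -> R) (e : R) : continuous f -> 0 < e ->
  exists J, forall x y, cell J x y -> `|f x - f y| < e.
Proof.
move=> cf e0; apply: contrapT => nJ.
pose T := {xy : subcube * subcube | e <= `|f xy.1 - f xy.2|}.
have [J|F [UF [y yP]]] := @subcube_twin_ulim T (fun t => (projT1 t).1) (fun t => (projT1 t).2).
  apply: contrapT => nt; apply: nJ; exists J => x z xz; rewrite ltNge; apply/negP => h.
  by apply: nt; exists (exist _ (x, z) h).
have [J hJ] : exists J, forall z, cell J y z -> `|f y - f z| < e / 2.
  have : nbhs y [set z | `|f y - f z| < e / 2].
    by have /cvgrPdist_lt := cf y; apply; rewrite divr_gt0.
  by move=> /nbhs_cellP[J JA]; exists J.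
have [[[x z] /= h] /= [/hJ h1 /hJ h2]] := @filter_ex _ F _ _ (yP J).
have : `|f x - f z| < e.
  rewrite (splitr e) -[f x](subrK (f y)) -addrA; apply: le_lt_trans (ler_normD _ _) _.
  by apply: ltrD => //; rewrite distrC.
by rewrite ltNge h.
Qed.

Lemma continuous_bounded (R : realType) (f : subcube -> R) : continuous f ->
  exists M : R, forall x, `|f x| <= M.
Proof.
move=> cf; have : compact (f @` setT).
  by apply: continuous_compact subcube_compact; exact: continuous_subspaceT.
move=> /compact_bounded[M [_ /(_ (M + 1))]] h; exists (M + 1) => x; apply: h; last by exists x.
by rewrite ltrDl.
Qed.

End subcube.

Lemma card_le_inj S T (A : set T) : ([set: S] #<= A)%card ->
  exists2 xi : S -> T, injective xi & forall k, A (xi k).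
Proof.
move=> /card_leP[f].
exists (fun n => val (f (SigSub (in_setT n)))) => [k l /val_inj E|k]; last exact: set_valP.
have := @inj _ _ _ f (SigSub (in_setT k)) (SigSub (in_setT l)).
by rewrite !inE => /(_ Logic.I Logic.I E) /(congr1 val).
Qed.

Section rich_space.
Context (R : realType) {d : Order.disp_t} (W : orderType d) (w1 : is_omega1 W).
Local Notation I := (nat + W)%type.
Local Notation X := (I -> bool).
Variables (K : set X) (rK : rich R K).
Local Notation T := (subcube K).

Let closedK := rich_closed rK.

Lemma rich_open (O : set T) : open O -> O !=set0 ->
  exists e l, forall x : T, cyl inl e l (kval x) -> O x.
Proof.
move=> /open_cellP oO [x /oO[J JO]].
have [|e [l el]] := rich_cyl rK (clop_cell J x); first by exists (kval x); split=> //; exact: kvalP.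
by exists e, l => y ey; apply: JO; apply: el; split=> //; exact: kvalP.
Qed.

Lemma rich_point (t : nat -> bool) : exists x : T, forall n, kval x (inl n) = t n.
Proof. by have [x Kx xt] := rich_inl rK t; exists (Subcube Kx). Qed.

(** A nonempty open set contains all points over some cylinder, so one point over each finitely
    supported 0-1 sequence suffices. *)
Lemma rich_separable : separable_space T.
Proof.
have [y yP] := choice (fun s : seq bool => rich_point (nth false s)).
exists (range y); first by apply: card_le_trans (card_image_le _ _) _; exact: countableP.
move=> O O0 oO; have [e [l el]] := rich_open oO O0.
exists (y (mkseq e l)); split; last by exists (mkseq e l).
by apply: el => i il; rewrite yP nth_mkseq.
Qed.

(** Over any cylinder there are two points, distinguished by the next coordinate in [nat]. *)
Lemma rich_crowded : crowded T.
Proof.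
apply/seteqP; split=> // x [_ [V /nbhs_cellP[J JV] Vx]].
have [|e [l el]] := rich_open (open_clop (clop_cell J x)); first by exists x.
have [y yP] := rich_point (fun n => if (n < l)%N then e n else true).
have [z zP] := rich_point (fun n => if (n < l)%N then e n else false).
have Vx' u : V u -> u = x by move=> Vu; have : (V `&` setT) u by []; rewrite Vx.
have : y = z.
  rewrite (Vx' y) 1?(Vx' z) //; apply: JV; apply: el => i il; rewrite ?yP ?zP il //.
by move=> /(congr1 (fun u => kval u (inl l))); rewrite yP zP ltnn.
Qed.

Lemma rich_infinite : infinite_set [set: T].
Proof.
apply/infiniteP; have [y yP] := choice (fun n => rich_point (fun m => m == n)).
apply: (card_le_fun (f := y)) => // m n _ _ /(congr1 (fun u => kval u (inl m))).
by rewrite !yP eqxx => /esym/eqP.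
Qed.

Lemma low_separates (S : set T) : countable S ->
  exists a, forall x y, S x -> S y -> agree (low a) (kval x) (kval y) -> x = y.
Proof.
move=> cS; have [w _] := omega1_least w1; have [S0|nS] := pselect (S !=set0); last first.
  by exists w => x y Sx; exfalso; apply: nS; exists x.
have [e eE] := countable_enum S0 cS.
have /choice[i iP] : forall kl : nat * nat, exists i, e kl.1 <> e kl.2 -> kval (e kl.1) i <> kval (e kl.2) i.
  move=> [k l] /=; have [->|/kval_neq[i ni]] := pselect (e k = e l); first by exists (inl 0%N).
  by exists i.
have [|a aP] := @countable_ub _ _ w1 ((fun kl => if i kl is inr b then b else w) @` [set: nat * nat]).
  by apply: card_le_trans (card_image_le _ _) _; exact: countableP.
exists a => x y; rewrite -eE => -[k _ <-] [l _ <-] kl; apply: contrapT => nkl.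
apply: (iP (k, l) nkl); apply: kl.
have : ((if i (k, l) is inr b then b else w) < a)%O by apply: aP; exists (k, l).
by case: (i (k, l)).
Qed.

Lemma twins_continuous (xi : nat -> T) (c : nat -> nat -> R) a0 : injective xi ->
    (forall n, exists N, forall k, (N <= k)%N -> c n k = 0) ->
    (forall p (t : 'I_p -> R), (forall k, \sum_(n < p) t n * c n k = 0) -> forall n, t n = 0) ->
    exists p q : T, [/\ agree (low a0) (kval p) (kval q), p <> q &
      forall f : T -> R, continuous f ->
      (forall n N, (forall k, (N <= k)%N -> c n k = 0) -> \sum_(k < N) c n k * f (xi k) = 0) ->
      f p = f q].
Proof.
move=> xinj csupp cfree.
have [|k l /kval_inj/xinj //|p [q [Kp Kq pq npq tw]]] :=
    rich_twins rK (xi := fun k => kval (xi k)) a0 _ _ csupp cfree.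
  by move=> k; exact: kvalP.
exists (Subcube Kp), (Subcube Kq); split=> //; first by move=> [/npq].
move=> f cf kill.
pose g (x : X) : R := if pselect (K x) is left h then f (Subcube h) else 0.
have gE (x : T) : g (kval x) = f x.
  by rewrite /g; case: pselect => [h|[]]; [congr f; apply: kval_inj|exact: kvalP].
have [M fM] := continuous_bounded closedK cf.
rewrite -(gE (Subcube Kp)) -(gE (Subcube Kq)) /=; apply: (tw g M).
- by move=> x Kx; rewrite (gE (Subcube Kx)).
- move=> e e0; have [J JP] := continuous_uniform closedK cf e0.
  by exists J => x y Kx Ky xy; rewrite (gE (Subcube Kx)) (gE (Subcube Ky)); exact: JP.
- by move=> n N cN; under eq_bigr => k _ do rewrite gE; exact: kill.
Qed.

Lemma closed_separate (S : set T) x y : closed S -> ~ S x -> x <> y ->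
  exists2 C, clop setT C & [/\ C (kval x), ~ C (kval y) & forall z, S z -> ~ C (kval z)].
Proof.
rewrite -openC => /open_cellP oS /oS[J JS] xy.
have [i xyi] := kval_neq xy.
exists [set z | agree [set` i :: J] (kval x) z]; first exact: clop_agrees.
by split=> // [/agree_cons[]|z Sz /agree_cons[_ /JS]].
Qed.

(** Dirac measures at infinitely many points of [S] give twins that agree on coordinates separating
    the points of [S], so one twin lies outside [S]. A clopen set containing it but neither the
    other twin nor a point of [S] has an indicator that all these measures kill. *)
Lemma closed_countable_finite (S : set T) : closed S -> countable S -> finite_set S.
Proof.
move=> clS cS; apply: contrapT => /infiniteP/card_le_inj[xi xinj xiS].
have [a aP] := low_separates cS.
have [||p [q [pq npq tw]]] := twins_continuous (c := fun n k => (k == n)%:R) a xinj.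
- by move=> n; exists n.+1 => k nk; rewrite gtn_eqF.
- move=> p t tk n; have := tk n; rewrite (bigD1 n) //= eqxx mulr1 big1 ?addr0 // => m mn.
  by rewrite (_ : _ == _ = false) ?mulr0 //; apply/negbTE; rewrite eq_sym; apply: contra mn => /eqP mn; apply/eqP/val_inj.
have kill C : clop setT C -> (forall z, S z -> ~ C (kval z)) -> (\1_C (kval p) : R) = \1_C (kval q).
  move=> cC SC; apply: (tw (fun x => \1_C (kval x))); first exact: continuous_indic.
  move=> n N _; rewrite big1 // => k _; rewrite indicE memNset ?mulr0 //.
  by apply: SC; exact: xiS.
have noS x y : p = x /\ q = y \/ p = y /\ q = x -> ~ S x -> x <> y -> False.
  move=> pqxy nSx xy; have [C cC [Cx nCy SC]] := closed_separate clS nSx xy.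
  have := kill C cC SC; case: pqxy => -[-> ->]; rewrite !indicE.
    by rewrite mem_set // memNset // => /eqP; rewrite oner_eq0.
  by rewrite memNset // mem_set // => /esym/eqP; rewrite oner_eq0.
have [Sp|nSp] := pselect (S p); last by apply: (noS p q) => //; left.
have [Sq|nSq] := pselect (S q); last by apply: (noS q p) => //; [right|exact: nesym].
exact: npq (aP p q Sp Sq pq).
Qed.

(** With its limit the sequence forms a countable closed set, hence a finite one. The terms other
    than the limit then stay outside some neighbourhood of it. *)
Lemma rich_no_cvg_seq : ~ has_nontrivial_cvg_seq T.
Proof.
move=> [u [x [ux nux]]].
have fcl (F : set T) : finite_set F -> closed F.
  by move: F; apply/accessible_finite_set_closed/hausdorff_accessible; exact: subcube_hausdorff.
have fin : finite_set (x |` range u).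
  apply: closed_countable_finite; last first.
    rewrite (_ : x |` range u = range (fun n => if n is n'.+1 then u n' else x)).
      by apply: card_le_trans (card_image_le _ _) _; exact: countableP.
    apply/seteqP; split=> y; first by move=> [->|[n _ <-]]; [exists 0%N|exists n.+1].
    by move=> [[|n] _ <-]; [left|right; exists n].
  rewrite -openC; apply/open_cellP => y ny.
  have [i yxi] : exists i, kval y i <> kval x i by apply: kval_neq => yx; apply: ny; left.
  have yi : i \in [:: i] by rewrite inE.
  have /ux[N _ hN] : nbhs x (cell [:: i] x) by apply/nbhs_cellP; exists [:: i].
  have /fcl : finite_set (u @` `I_N) by apply: finite_image; exact: finite_II.
  rewrite -openC => /open_cellP/(_ y)[|J yJ]; first by move=> [n _ nz]; apply: ny; right; exists n.
  exists (i :: J) => z /agree_cons[zi Jz].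
  move=> [zx|[n _ nz]]; first by apply: yxi; rewrite zi zx.
  have [nN|Nn] := ltnP n N.
    by apply: (yJ z Jz); exists n.
  by apply: yxi; rewrite zi -nz -(hN n Nn i yi).
apply: nux; have {}fin : finite_set ((x |` range u) `\ x) by apply: sub_finite_set fin => z [].
have /fcl := fin; rewrite -openC => oF.
have uF : \forall n \near \oo, (~` ((x |` range u) `\ x)) (u n).
  by apply: ux; apply: open_nbhs_nbhs; split=> // -[_]; apply.
apply: filterS uF => n /= nF; apply: contrapT => nx; apply: nF; split=> //.
by right; exists n.
Qed.

End rich_space.

(** * No copy of the space of ultrafilters *)

Lemma ultra_fmap S T (f : S -> T) (F : set_system S) : UltraFilter F -> UltraFilter [set A | F (f @^-1` A)].
Proof.
move=> UF; have PF : ProperFilter [set A | F (f @^-1` A)] by exact: (fmap_proper_filter f (F := F)).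
split=> // G PG FG; apply/seteqP; split=> // A GA /=.
have [//|/(FG (~` A)) GnA] := in_ultra_setVsetC (f @^-1` A) UF.
have [x [Ax nAx]] : exists x, (A `&` ~` A) x by exact: (@filter_ex _ G _ _ (filterI GA GnA)).
by exfalso; exact: nAx.
Qed.

Lemma sum_single (R : realType) (h : nat -> R) N m : (m < N)%N -> (forall k, k <> m -> h k = 0) ->
  \sum_(k < N) h k = h m.
Proof.
move=> mN hk; rewrite (bigD1 (Ordinal mN)) //= big1 ?addr0 // => k km; apply: hk => E.
by move/eqP: km; apply; apply: val_inj.
Qed.

Section beta.
Import finmap.
Implicit Types (U V : betaN) (A : set nat).

Lemma betaN_eq U V : (forall A, beta_filter U A -> beta_filter V A) -> U = V.
Proof.
case: U V => [F UF] [G UG] /= FG; have E : G = F by apply: max_filter.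
by move: UG FG; rewrite E => UG _; congr BetaN; exact: Prop_irrelevance.
Qed.

Definition beta_point n := BetaN (principal_filter_ultra n).

Lemma beta_pointE n A : beta_filter (beta_point n) A <-> A n.
Proof. exact: principal_filterP. Qed.

Lemma betaN_open (O : set betaN) U : open O -> O U ->
  exists2 A, beta_filter U A & forall V, beta_filter V A -> O V.
Proof.
move=> [D sD <-] [B DB BU]; have [E' _ EB] := sD _ DB.
pose E : {fset (set nat)} := E'; subst B.
exists (\bigcap_(A in [set` E]) id A).
  have UF := beta_ultra U; apply: filter_bigI => A AE; exact: (BU A AE).
move=> V VE; exists (\bigcap_(i in [set` E]) [set F | beta_filter F i]); [exact: DB|move=> A EA /=].
by have VF := beta_ultra V; apply: filterS VE => n; apply.
Qed.

End beta.

Section rich_beta.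
Context (R : realType) {d : Order.disp_t} (W : orderType d) (w1 : is_omega1 W).
Local Notation I := (nat + W)%type.
Local Notation X := (I -> bool).
Variables (K : set X) (rK : rich R K).
Local Notation T := (subcube K).

Section no_embedding.
Variable f : betaN -> T.
Hypothesis finj : injective f.
Hypothesis fcont : forall O, open O -> open (f @^-1` O).
Let xi n := f (beta_point n).
Implicit Types (U V : betaN) (A : set nat).

Let lim U J : beta_filter U [set n | cell J (f U) (xi n)].
Proof.
have /(betaN_open (U := U))[|A UA AO] := fcont (open_clop (clop_cell J (f U))); first by [].
by have UF := beta_ultra U; apply: filterS UA => n An; apply: AO; apply/beta_pointE.
Qed.

Let lim_eq U y : (forall J, beta_filter U [set n | cell J y (xi n)]) -> f U = y.
Proof.
move=> Uy; apply: kval_inj; apply/funext => i; have UF := beta_ultra U.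
have [n [h1 h2]] := @filter_ex _ _ _ _ (filterI (Uy [:: i]) (lim U [:: i])).
by rewrite (h1 i) ?(h2 i) //= inE.
Qed.

(** Otherwise points with indices in [A] and outside [A] agree on ever more coordinates and have a
    common limit. It is the image of two ultrafilters, only one of which contains [A], against
    injectivity. *)
Let sep A : exists J, forall n m, cell J (xi n) (xi m) -> A n -> A m.
Proof.
apply: contrapT => nJ; pose S := {nm : nat * nat | A nm.1 /\ ~ A nm.2}.
have [J|F [UF [y yP]]] := @subcube_twin_ulim _ _ (rich_closed rK) S
    (fun t => xi (projT1 t).1) (fun t => xi (projT1 t).2).
  apply: contrapT => nt; apply: nJ; exists J => n m nm An; apply: contrapT => nAm.
  by apply: nt; exists (exist _ (n, m) (conj An nAm)).
have UF1 := ultra_fmap (fun t : S => (projT1 t).1) UF.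
have UF2 := ultra_fmap (fun t : S => (projT1 t).2) UF.
have E1 : f (BetaN UF1) = y by apply: lim_eq => J; apply: (@filterS _ F _ _ _ _ (yP J)) => t [].
have E2 : f (BetaN UF2) = y by apply: lim_eq => J; apply: (@filterS _ F _ _ _ _ (yP J)) => t [].
have /finj/(congr1 beta_filter) /= E : f (BetaN UF1) = f (BetaN UF2) by rewrite E1.
have F1 : F [set t | A (projT1 t).1] by apply: (@filterS _ F _ setT) filterT => -[t []].
have F2 : F [set t | A (projT1 t).2] by have : [set B | F ((fun t : S => (projT1 t).1) @^-1` B)] A by []; rewrite E.
by have [[t [h1 h2]] /= h3] := @filter_ex _ F _ _ F2.
Qed.

Let sepC A : exists2 C, clop setT C & forall U, C (kval (f U)) <-> beta_filter U A.
Proof.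
have [J JA] := sep A.
exists [set x | exists n, A n /\ agree [set` J] (kval (xi n)) x].
  by exists J => // x y xy [n [An nx]]; exists n; split=> //; exact: agree_trans xy.
move=> U; have UF := beta_ultra U; split=> [[n [An nU]]|UA].
  apply: filterS (lim U J) => m Um; apply: JA An; exact: agree_trans nU Um.
have [n [Un An]] := @filter_ex _ _ _ _ (filterI (lim U J) UA).
by exists n; split=> //; exact: agree_sym.
Qed.

Lemma no_betaN : False.
Proof.
(* The combinations are the sums of the Dirac measures at the three points with
   indices in {3n, 3n+1, 3n+2}.  For a set A0 of indices in one residue class, the
   indicator of A0 minus that of a translate A1 of A0 in another class kills them. *)
have xinj : injective xi.
  move=> m n /finj/(congr1 (fun U => beta_filter U [set m])) E.
  have : beta_filter (beta_point m) [set m] by apply/beta_pointE.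
  by rewrite E => /beta_pointE.
have [w _] := omega1_least w1.
have [||p [q [_ npq tw]]] := twins_continuous rK (c := fun n k => (k %/ 3 == n)%N%:R) w xinj.
- move=> n; exists (n.*2 + n + 3)%N => k nk; rewrite gtn_eqF // leq_divRL //; lia.
- move=> r t tk n; have := tk (n * 3)%N; rewrite (bigD1 n) //= mulnK // eqxx mulr1 big1 ?addr0 // => m mn.
  by rewrite (_ : _ == _ = false) ?mulr0 //; apply/negbTE; rewrite eq_sym; apply: contra mn => /eqP mn; apply/eqP/val_inj.
(* A twin outside the closure of the points would be separated, by a clopen set, from this closure
   and from the other twin; the indicator of that set is killed. *)
have range_f x y : (x = p /\ y = q \/ x = q /\ y = p) -> exists U, f U = x.
  move=> xy; have [clx|nclx] := pselect (closure (range xi) x).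
    pose G := filter_from [set: seq I] (fun J => [set n | cell J x (xi n)]).
    have PG : ProperFilter G.
      apply: filter_from_proper => [|J _].
        apply: filter_from_filter; first by exists [::].
        by move=> J J' _ _; exists (J ++ J') => // n /agree_cat.
      have [|z [[n _ <-] xn]] := clx (cell J x); first by apply/nbhs_cellP; exists J.
      by exists n.
    have [F [UF GF]] := ultraFilterLemma PG.
    by exists (BetaN UF); apply: lim_eq => J; apply: GF; exists J.
  exfalso; have nxy : x <> y by case: xy => -[-> ->] //; exact: nesym.
  have [C cC [Cx nCy SC]] := closed_separate (@closed_closure _ _) nclx nxy.
  have : (\1_C (kval p) : R) = \1_C (kval q).
    apply: (tw (fun x => \1_C (kval x))); first exact: continuous_indic.
    move=> n N _; rewrite big1 // => k _; rewrite indicE memNset ?mulr0 //.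
    by apply: SC; apply: subset_closure; exists k.
  case: xy => -[<- <-]; rewrite !indicE.
    by rewrite mem_set // memNset // => /eqP; rewrite oner_eq0.
  by rewrite memNset // mem_set // => /esym/eqP; rewrite oner_eq0.
have [U Up] := range_f p q ltac:(by left); have [V Vq] := range_f q p ltac:(by right).
have UF := beta_ultra U; have VF := beta_ultra V.
have [A [UA nVA]] : exists A, beta_filter U A /\ ~ beta_filter V A.
  apply: contrapT => nA; apply: npq; rewrite -Up -Vq; congr f; apply: betaN_eq => A UA.
  by apply: contrapT => nVA; apply: nA; exists A.
pose cls i := [set n : nat | n %% 3 = i]%N.
have mod3 F : UltraFilter F -> exists2 i, (i < 3)%N & F (cls i).
  move=> FF; have [|n0] := in_ultra_setVsetC (cls 0%N) FF; first by exists 0%N.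
  have [|n1] := in_ultra_setVsetC (cls 1%N) FF; first by exists 1%N.
  exists 2%N => //; apply: filterS2 n0 n1 => n /=; rewrite /cls /=; have := ltn_pmod n (isT : 0 < 3)%N; lia.
have [i i3 Ui] := mod3 _ UF; have [j j3 Vj] := mod3 _ VF.
(* A residue class that belongs to neither ultrafilter: the translate [A1] placed there does not
   disturb the separation of the twins by [A0]. *)
have [l [l3 li lj]] : exists l, [/\ (l < 3)%N, l <> i & l <> j].
  have [|h0] := pselect (0%N <> i /\ 0%N <> j); first by move=> [? ?]; exists 0%N.
  have [|h1] := pselect (1%N <> i /\ 1%N <> j); first by move=> [? ?]; exists 1%N.
  by exists 2%N; split=> // E; subst; [apply: h1|apply: h0]; lia.
pose A0 := A `&` cls i; pose A1 := [set n | n %% 3 = l /\ A0 (n %/ 3 * 3 + i)]%N.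
have UA0 : beta_filter U A0 by exact: filterI.
have nVA0 : ~ beta_filter V A0 by move=> VA; apply: nVA; apply: filterS VA => n [].
have dj (F : set_system nat) B B' : ProperFilter F -> F B -> B `&` B' = set0 -> ~ F B'.
  by move=> PF FB BB FB'; have [n] := @filter_ex _ F _ _ (filterI FB FB'); rewrite BB.
have nUA1 : ~ beta_filter U A1.
  apply: dj Ui _; apply/seteqP; split=> // n [ni [nl _]]; apply: li; by rewrite -ni -nl.
have nVA1 : ~ beta_filter V A1.
  apply: dj Vj _; apply/seteqP; split=> // n [nj [nl _]]; apply: lj; by rewrite -nj -nl.
have [C0 cC0 C0P] := sepC A0; have [C1 cC1 C1P] := sepC A1.
pose g (x : T) : R := \1_C0 (kval x) - \1_C1 (kval x).
have cg : continuous g by move=> x; exact: (cvgB (@continuous_indic _ K R _ cC0 x) (@continuous_indic _ K R _ cC1 x)).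
have : g p = g q.
  apply: tw => // n N cN; rewrite /g.
  under eq_bigr => k _ do rewrite mulrBr.
  have nN r : (r < 3)%N -> (n * 3 + r < N)%N.
    move=> r3; rewrite ltnNge; apply/negP => /cN/eqP; rewrite divnMDl // divn_small // addn0 eqxx.
    by rewrite oner_eq0.
  rewrite sumrB (@sum_single _ (fun k => (k %/ 3 == n)%N%:R * \1_C0 (kval (xi k))) N (n * 3 + i)%N) ?nN //; last first.
    move=> k kn; have [kE|] := eqVneq (k %/ 3)%N n; last by rewrite mul0r.
    rewrite indicE memNset ?mulr0 // => /C0P/beta_pointE[_ ki]; apply: kn.
    by rewrite (divn_eq k 3) kE ki.
  rewrite (@sum_single _ (fun k => (k %/ 3 == n)%N%:R * \1_C1 (kval (xi k))) N (n * 3 + l)%N) ?nN //; last first.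
    move=> k kn; have [kE|] := eqVneq (k %/ 3)%N n; last by rewrite mul0r.
    rewrite indicE memNset ?mulr0 // => /C1P/beta_pointE[kl _]; apply: kn.
    by rewrite (divn_eq k 3) kE kl.
  rewrite !divnMDl // !divn_small // !addn0 eqxx !mul1r.
  apply/eqP; rewrite subr_eq0; apply/eqP; rewrite !indicE; congr (_ %:R); congr nat_of_bool.
  apply/asbool_equiv_eq; split=> /= [/C0P/beta_pointE h|/C1P/beta_pointE[_]].
    apply/C1P/beta_pointE; split; first by rewrite modnMDl modn_small.
    by rewrite divnMDl // divn_small // addn0.
  by rewrite divnMDl // divn_small // addn0 => h; apply/C0P/beta_pointE.
rewrite /g -Up -Vq !indicE (mem_set ((C0P U).2 UA0)).
rewrite !memNset; [|by move=> /C1P|by move=> /C0P|by move=> /C1P].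
by rewrite subrr subr0 => /eqP; rewrite oner_eq0.
Qed.

End no_embedding.

Lemma rich_efimov : efimov T.
Proof.
split; [exact: rich_infinite rK|exact: subcube_compact (rich_closed rK)|exact: subcube_hausdorff|
  exact: (rich_no_cvg_seq w1 rK)|].
move=> [f [finj fP]]; apply: (no_betaN finj) => O oO; apply/fP; by exists O.
Qed.

End rich_beta.

(** * Cardinality and weight *)

Section almost_inclusion.
Implicit Types A B : set nat.

Definition unb A := forall N, exists2 n, (N <= n)%N & A n.

Definition almost_sub A B := exists N, forall n, (N <= n)%N -> A n -> B n.

Lemma almost_sub_trans A B C : almost_sub A B -> almost_sub B C -> almost_sub A C.
Proof.
move=> [N NP] [M MP]; exists (maxn N M) => n; rewrite geq_max => /andP[Nn Mn] An.
by apply: MP => //; exact: NP.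
Qed.

Lemma unb_almost_sub A B : unb A -> almost_sub A B -> unb B.
Proof.
move=> uA [N NP] M; have [n] := uA (maxn M N); rewrite geq_max => /andP[Mn Nn] An.
by exists n => //; exact: NP.
Qed.

Lemma pseudo_intersection (B : nat -> set nat) :
  (forall k, unb [set n | forall j, (j <= k)%N -> B j n]) ->
  exists2 A, unb A & forall j, almost_sub A (B j).
Proof.
move=> uB; have /choice[s sP] : forall k, exists n, (k <= n)%N /\ forall j, (j <= k)%N -> B j n.
  by move=> k; have [n kn Bn] := uB k k; exists n.
exists (range s) => [N|j]; first by exists (s N); [have [] := sP N|exists N].
exists (\max_(k < j) s k).+1 => n jn [k _ kn]; rewrite -kn; have [_] := sP k; apply.
rewrite leqNgt; apply/negP => kj; move: jn; rewrite -kn ltnNge.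
by rewrite (leq_bigmax (F := fun i : 'I_j => s i) (Ordinal kj)).
Qed.

End almost_inclusion.

Section omega1_unions.
Context {d : Order.disp_t} (W : orderType d) (w1 : is_omega1 W).

Lemma omega1_bigcup_le T (F : W -> set T) : (forall a, countable (F a)) ->
  (\bigcup_a F a #<= [set: W])%card.
Proof.
move=> cF; have [w _] := omega1_least w1; have [j jinj] := omega1_pairing w1.
have /choice[g gP] : forall a, exists g : T -> nat, {in F a &, injective g}.
  by move=> a; exact/countable_injP.
pose a x := select w [set a | F a x].
have aP x : (\bigcup_a F a) x -> F (a x) x.
  by move=> [b _ Fb]; apply: (@selectP _ w [set a | F a x]); exists b.
apply: (@card_le_fun _ _ _ _ (fun x => j (g (a x) x) (a x))) => // x y /aP Fx /aP Fy /jinj[gxy axy].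
by apply: (gP (a x)); rewrite ?inE //; [rewrite axy|rewrite gxy axy].
Qed.

End omega1_unions.

Section rich_card.
Context (R : realType) {d : Order.disp_t} (W : orderType d) (w1 : is_omega1 W).
Local Notation I := (nat + W)%type.
Local Notation X := (I -> bool).
Variables (K : set X) (rK : rich R K).
Local Notation T := (subcube K).

Lemma rich_card_le : ([set: T] #<= [set: set W])%card.
Proof.
have [h hinj _] : exists2 h : I -> W, injective h & forall k, [set: W] (h k).
  apply: card_le_inj; rewrite (_ : setT = \bigcup_a low a).
    by apply: (omega1_bigcup_le w1) => a; exact: countable_low.
  have [w _] := omega1_least w1.
  apply/seteqP; split=> // -[n|c] _; first by exists w.
  by have [a ca] := omega1_unbounded w1 c; exists a.
apply: (@card_le_fun _ _ _ _ (fun x => h @` [set i | kval x i])) => // x y _ _ E.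
apply: kval_inj; apply/funext => i.
have imp u v : h @` [set i | kval u i] = h @` [set i | kval v i] -> kval u i -> kval v i.
  move=> uv ui; have : (h @` [set i | kval u i]) (h i) by exists i.
  by rewrite uv => -[k vk /hinj <-].
by apply/idP/idP; exact: imp.
Qed.

Section splitting.
Variable e : nat -> T.
Hypothesis einj : injective e.

(** Otherwise every cell around an ultralimit of the points with indices in [A] contains almost all
    of these points, which makes a subsequence converge. *)
Lemma sequence_splits A : unb A -> exists2 C, clop setT C &
  unb (A `&` [set n | C (kval (e n))]) /\ unb (A `\` [set n | C (kval (e n))]).
Proof.
move=> uA; apply: contrapT => nC.
have /choice[s sP] : forall N, exists n, (N <= n)%N /\ A n by move=> N; have [n] := uA N; exists n.
have [F [UF Foo]] := ultraFilterLemma (@eventually_filter : ProperFilter \oo).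
have [y yP] := subcube_ulim (rich_closed rK) (e \o s) UF.
apply: (rich_no_cvg_seq w1 rK); exists (e \o s), y; split.
  move=> B /nbhs_cellP[J JB].
  suff [N NP] : almost_sub A [set n | cell J y (e n)].
    exists N => // n /= Nn; apply: JB; have [sn An] := sP n; apply: NP => //.
    exact: leq_trans sn.
  apply: contrapT => nalm; apply: nC; exists [set x | agree [set` J] (kval y) x]; first exact: clop_cell.
  split=> N.
    have [n [/= Nn yn]] : exists n, ([set n | (N <= n)%N] `&` [set n | cell J y (e (s n))]) n.
      by apply: (@filter_ex _ F); apply: filterI (yP J); apply: Foo; exact: nbhs_infty_ge.
    by have [sn An] := sP n; exists (s n) => //; exact: leq_trans sn.
  apply: contrapT => nn; apply: nalm; exists N => n Nn An; apply: contrapT => nc.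
  by apply: nn; exists n.
move=> [N _ NP].
have [sn _] := sP N; have [sn' _] := sP (s N).+1.
have : e (s N) = e (s (s N).+1).
  have -> : e (s N) = y by exact: NP N (leqnn N).
  by apply/esym; apply: (NP (s N).+1); exact: leqW.
by move=> /einj E; move: sn'; rewrite -E ltnn.
Qed.

Lemma embed_branches : exists2 y : (W -> bool) -> T, injective y & forall b, setT (y b).
Proof.
have /choice[N NP] : forall A, exists C, unb A -> clop setT C /\
   (unb (A `&` [set n | C (kval (e n))]) /\ unb (A `\` [set n | C (kval (e n))])).
  by move=> A; have [/sequence_splits[C ? ?]|nA] := pselect (unb A); [exists C|exists setT].
pose side v A := A `&` (if v then [set n | N A (kval (e n))] else ~` [set n | N A (kval (e n))]).
have unb_side v A : unb A -> unb (side v A) by move=> /NP[_ []]; case: v.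
(* A tree of infinite sets of indices: [f b a] depends on [b] below [a] only, and is
   almost contained in the halves of the earlier sets chosen by [b]. *)
pose Q (b : W -> bool) a (f : W -> set nat) A := unb A /\
  forall c, (c < a)%O -> almost_sub A (side (b c) (f c)).
have Qloc (b b' : W -> bool) a f f' : (forall c, (c < a)%O -> b c = b' c /\ f c = f' c) -> Q b a f = Q b' a f'.
  by move=> E; apply/seteqP; split=> A [uA hA]; split=> // c ca; have [bc fc] := E c ca; have := hA c ca; rewrite bc fc.
(* [f] satisfies an equation, not only a property, so branches that agree below [a] yield the same
   set at [a]. *)
have /choice[f fE] : forall b : W -> bool, exists f, forall a, f a = select setT (Q b a f).
  move=> b; have [|f fP] := @omega1_choice _ W w1 _ setT (fun a f A => A = select setT (Q b a f)).
    by move=> a h k hk A; rewrite (Qloc b b a h k) // => c /hk.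
  by exists f => a; apply: fP; eexists.
have fQ b a : Q b a (f b) (f b a).
  elim/(omega1_ind w1): a => a ih; rewrite [X in Q _ _ _ X]fE; apply: selectP.
  have [[c0 c0a]|na] := pselect (exists c, (c < a)%O); last first.
    by exists setT; split=> [M|c ca]; [exists M|exfalso; apply: na; exists c].
  have [c cE] := countable_enum (ex_intro [set c | (c < a)%O] c0 c0a) (countable_below w1 a).
  have ca k : (c k < a)%O by have : range c (c k) by [exists k]; rewrite cE.
  (* The halves decrease modulo finite sets, so the one at the largest of the first [k.+1] elements
     is almost contained in the others. *)
  have fin k : exists2 m, (m < a)%O & forall j, (j <= k)%N -> almost_sub (side (b m) (f b m)) (side (b (c j)) (f b (c j))).
    have step u v : (u < a)%O -> (v <= u)%O -> almost_sub (side (b u) (f b u)) (side (b v) (f b v)).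
      rewrite le_eqVlt => ua /orP[/eqP ->|vu]; first by exists 0%N.
      have [_ /(_ v vu)] := ih u ua; apply: almost_sub_trans; by exists 0%N => n _ [].
    elim: k => [|k [m ma mP]].
      by exists (c 0%N) => // j; rewrite leqn0 => /eqP ->; exists 0%N.
    exists (Order.max m (c k.+1)); first by rewrite gt_max ma ca.
    have mx : (Order.max m (c k.+1) < a)%O by rewrite gt_max ma ca.
    move=> j; rewrite leq_eqVlt => /orP[/eqP ->|jk].
      by apply: step => //; rewrite le_max lexx orbT.
    by apply: almost_sub_trans (mP j jk); apply: step => //; rewrite le_max lexx.
  have [k|A uA AP] := @pseudo_intersection (fun k => side (b (c k)) (f b (c k))).
    have [m ma mP] := fin k; apply: unb_almost_sub (unb_side (b m) (f b m) _) _; first by have [] := ih m ma.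
    elim: k mP => [|k ihk] mP.
      have [M MP] := mP 0%N isT; exists M => n Mn nm j; rewrite leqn0 => /eqP ->; exact: MP.
    have [|M MP] := ihk; first by move=> j jk; apply: mP; exact: leqW.
    have [M' MP'] := mP k.+1 (leqnn _); exists (maxn M M') => n; rewrite geq_max => /andP[Mn Mn'] nm j.
    by rewrite leq_eqVlt => /orP[/eqP ->|jk]; [exact: MP'|exact: MP].
  exists A; split=> // u ua; have [k _ <-] : range c u by rewrite cE.
  exact: AP.
(* An ultrafilter containing the chosen halves and all final segments of [nat] converges to a point
   from which [b] can be read off. *)
have limit b : exists y : T, forall a, N (f b a) (kval y) <-> b a.
  pose F := filter_from [set: W * nat] (fun ak => [set n | (ak.2 <= n)%N /\ side (b ak.1) (f b ak.1) n]).
  have step u v : (v <= u)%O -> almost_sub (side (b u) (f b u)) (side (b v) (f b v)).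
    rewrite le_eqVlt => /orP[/eqP ->|vu]; first by exists 0%N.
    have [_ /(_ v vu)] := fQ b u; apply: almost_sub_trans; by exists 0%N => n _ [].
  have PF : ProperFilter F.
    apply: filter_from_proper => [|[a k] _ /=].
      have [w _] := omega1_least w1.
      apply: filter_from_filter; first by exists (w, 0%N).
      move=> [u k] [v l] _ _; have [M MP] := step (Order.max u v) u ltac:(by rewrite le_max lexx).
      have [M' MP'] := step (Order.max u v) v ltac:(by rewrite le_max lexx orbT).
      exists (Order.max u v, maxn (maxn k l) (maxn M M')) => // n /= [].
      rewrite !geq_max => /andP[/andP[kn ln] /andP[Mn Mn']] sn.
      by split; split=> //; [exact: MP|exact: MP'].
    by have [n kn sn] := unb_side (b a) (f b a) (fQ b a).1 k; exists n.
  have [H [UH FH]] := ultraFilterLemma PF; have [y yP] := subcube_ulim (rich_closed rK) e UH.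
  exists y => a; have [cN _] := NP _ (fQ b a).1; have [J _ dN] := cN.
  have [n [/= yn [_ [_ sn]]]] : exists n, ([set n | cell J y (e n)] `&` [set n | (0 <= n)%N /\ side (b a) (f b a) n]) n.
    by apply: (@filter_ex _ H); apply: filterI (yP J) _; apply: FH; exists (a, 0%N).
  case: (b a) sn => /= sn; split=> //; first by move=> _; exact: dN (agree_sym yn) sn.
  by move=> yN; exfalso; apply: sn; exact: dN yn yN.
have [y yP] := choice limit; exists y => // b b' yy; apply: contrapT => nbb.
(* At the first difference [a] the two branches still use the same set of indices, hence the same
   splitting clopen set, and the limits lie on different sides of it. *)
have [a /= nba amin] : exists2 a, b a <> b' a & forall c, b c <> b' c -> (a <= c)%O.
  apply: (omega1_min w1 (A := [set a | b a <> b' a])); apply: contrapT => nex; apply: nbb; apply/funext => a.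
  by apply: contrapT => nba; apply: nex; exists a.
have below c : (c < a)%O -> b c = b' c.
  by move=> ca; apply: contrapT => /amin; rewrite leNgt ca.
have fbb c : (c <= a)%O -> f b c = f b' c.
  elim/(omega1_ind w1): c => c ih ca; rewrite !fE; congr select; apply: Qloc => v vc.
  by split; [apply: below; exact: lt_le_trans ca|apply: ih => //; apply: le_trans ca; exact: ltW].
apply: nba; apply/idP/idP => /yP; rewrite ?yy ?fbb // => h; apply/yP.
  by [].
by rewrite yy fbb.
Qed.

End splitting.

Lemma rich_card : ([set: T] #= [set: set W])%card.
Proof.
rewrite card_eq_le rich_card_le /=.
have /infiniteP/card_le_inj[e einj _] := rich_infinite rK.
have [y yinj _] := embed_branches einj.
apply: (@card_le_fun _ _ _ _ (fun A : set W => y (fun a => `[< A a >]))) => // A B _ _ /yinj E.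
by apply/seteqP; split=> a Aa; apply/asboolP; [rewrite -(congr1 (fun h => h a) E)|rewrite (congr1 (fun h => h a) E)]; apply/asboolP.
Qed.

(** Choose points other than [x] in a decreasing neighbourhood base at [x]; there are no isolated
    points. *)
Lemma countable_basis_cvg_seq (B : set (set T)) : basis B -> countable B -> False.
Proof.
move=> [oB bB] cB; apply: (rich_no_cvg_seq w1 rK).
have [x _] := rich_point rK xpred0.
have [A0 [BA0 _] _] := bB x setT filterT.
have [b bE] := countable_enum (ex_intro B A0 BA0) cB.
have bO k : open (b k) by apply: oB; rewrite -bE; exists k.
pose V n := [set y | forall k, (k <= n)%N -> b k x -> b k y].
have nV n : nbhs x (V n).
  elim: n => [|n ih].
    have [bx|nbx] := pselect (b 0%N x).
      by apply: (@filterS _ _ _ (b 0%N)) (open_nbhs_nbhs (conj (bO _) bx)) => y by_ k; rewrite leqn0 => /eqP ->.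
    by apply: (@filterS _ _ _ setT) filterT => y _ k; rewrite leqn0 => /eqP ->.
  have [bx|nbx] := pselect (b n.+1 x).
    apply: filterS2 (open_nbhs_nbhs (conj (bO _) bx)) ih => y by_ Vy k.
    by rewrite leq_eqVlt => /orP[/eqP ->|kn] //; exact: Vy.
  apply: filterS ih => y Vy k.
  by rewrite leq_eqVlt => /orP[/eqP ->|kn] //; exact: Vy.
have /choice[u uP] : forall n, exists y, V n y /\ y <> x.
  move=> n; apply: contrapT => nex.
  suff : isolated [set: T] x by rewrite (rich_crowded rK).
  split; first by rewrite inE.
  exists (V n) => //; rewrite setIT; apply/seteqP; split=> y; last by move=> -> ; exact: nbhs_singleton (nV n).
  by move=> Vy; apply: contrapT => yx; apply: nex; exists y.
exists u, x; split.
  move=> A /bB[C [BC Cx] CA]; move: BC Cx CA; rewrite -bE => -[k _ <-] bx bA.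
  by exists k => // n /= kn; apply: bA; have [Vn _] := uP n; exact: Vn.
by move=> [N _ NP]; have [_ /(_ (NP N (leqnn N)))] := uP N.
Qed.

(** No base is countable, so each has at least the size of W; the cells are indexed by clopen sets
    supported below elements of W, countably many for each. *)
Lemma rich_weight : weight_eq T W.
Proof.
have lower (B : set (set T)) : basis B -> ([set: W] #<= B)%card.
  move=> bB; apply: (omega1_card_le w1) => C cC; apply: contrapT => nex.
  apply: (countable_basis_cvg_seq bB); apply: sub_countable cC; apply: subset_card_le => A BA.
  by apply: contrapT => nC; apply: nex; exists A.
split=> //.
pose B : set (set T) := [set A | exists J x, A = cell J x].
have bB : basis B.
  split=> [_ [J [x ->]]|x A /nbhs_cellP[J JA]]; first exact: open_clop (clop_cell J x).
  by exists (cell J x) => //; split; [exists J, x|exact: cell_id].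
exists B => //; rewrite card_eq_le lower // andbT.
apply: card_le_trans (omega1_bigcup_le w1 (F := fun a => (fun C => [set x : T | C (kval x)]) @` [set C | clop (low a) C]) _).
  apply: subset_card_le => _ [J [x ->]]; have [a Ja] := lowe_seq w1 J.
  have [b ab] := omega1_unbounded w1 a; exists b => //.
  exists [set y | agree [set` J] (kval x) y] => //; apply: clop_agrees.
  exact: subset_trans Ja (lowe_low ab).
by move=> a; apply: card_le_trans (card_image_le _ _) _; apply: countable_clop; exact: countable_low.
Qed.

End rich_card.

(** * Quotients of function spaces *)

Section Cp_theory.
Context (R : realType) (X : topologicalType).
Implicit Types (f g : Cp R X) (x : X).

Definition ev f x : R := (f : continuousType X R) x.

Definition mkCp (f : X -> R) (cf : continuous f) : Cp R X := mkcts cf : continuousType X R.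

Lemma ev_mkCp (f : X -> R) (cf : continuous f) x : ev (mkCp cf) x = f x.
Proof. by []. Qed.

Lemma ev_cont f : continuous (ev f).
Proof. exact: cts_fun. Qed.

Lemma ev0 x : ev 0 x = 0. Proof. by []. Qed.
Lemma evD f g x : ev (f + g) x = ev f x + ev g x. Proof. by []. Qed.
Lemma evZ a f x : ev (a *: f) x = a * ev f x. Proof. by []. Qed.
Lemma evB f g x : ev (f - g) x = ev f x - ev g x. Proof. by []. Qed.

Lemma continuous_ev x : continuous (fun f : Cp R X => ev f x).
Proof.
move=> f; apply: (@cvg_comp _ _ _ (fun g : Cp R X => (g : continuousType X R) : {ptws X -> R}) (fun g : {ptws X -> R} => g x)).
  exact: (@initial_continuous (continuousType X R) {ptws X -> R} id f).
exact: (@proj_continuous X (fun=> R) x).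
Qed.

Lemma nbhs_CpP f (A : set (Cp R X)) : nbhs f A <->
  exists (s : seq X) (e : R), 0 < e /\ forall g, (forall x, x \in s -> `|ev f x - ev g x| < e) -> A g.
Proof.
split=> [|[s [e [e0 sA]]]]; last first.
  apply: (@filterS _ _ _ [set g | forall x, x \in s -> `|ev f x - ev g x| < e]) => //.
  elim: s {sA} => [|x s ih]; first by apply: (@filterS _ _ _ setT) filterT => g _ x.
  have h : nbhs f [set g | `|ev f x - ev g x| < e].
    by have /cvgrPdist_lt := @continuous_ev x f; apply.
  apply: filterS2 h ih => g h ih y; rewrite inE => /orP[/eqP -> //|]; exact: ih.
pose B (se : seq X * R) := [set g | forall x, x \in se.1 -> `|ev f x - ev g x| < se.2].
(* This filter converges to [f] at every point, hence in the topology of pointwise convergence, so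
   each neighbourhood of [f] contains some [B se]. *)
pose F := filter_from [set se | 0 < se.2] B.
have FF : Filter F.
  apply: filter_from_filter; first by exists ([::], 1) => /=.
  move=> [s e] [s' e'] /= e0 e0'; exists (s ++ s', Num.min e e') => /=; first by rewrite lt_min e0.
  move=> g h; split=> x xs; apply: lt_le_trans (h x _) _ => /=; rewrite ?mem_cat ?xs ?orbT //.
    by rewrite ge_min lexx.
  by rewrite ge_min lexx orbT.
rewrite nbhsE => -[A' [[G oG GE] A'f] A'A]; subst A'.
have : F ((fun g : Cp R X => (g : continuousType X R) : {ptws X -> R}) @^-1` G).
  have h : forall x, (fun g : {ptws X -> R} => g x) @ ((fun g : Cp R X => (g : continuousType X R) : {ptws X -> R}) @ F) --> ev f x.
    move=> x; apply/cvgrPdist_lt => e e0; exists ([:: x], e) => // g /=; apply; exact: mem_head.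
  have fF : Filter ((fun g : Cp R X => (g : continuousType X R) : {ptws X -> R}) @ F) by exact: fmap_filter.
  have /(_ G) := (@pointwise_cvgP X R _ ((f : continuousType X R) : X -> R) fF).2 h.
  by apply; apply: open_nbhs_nbhs.
move=> [[s e] /= e0 sG]; exists s, e; split=> // g gs; apply: A'A; exact: sG.
Qed.

End Cp_theory.

Section quotient_theory.
Context (R : realType) (V : preTopologicalLmodType R) (Z : submodClosed V).
Local Open Scope quotient_scope.
Local Notation Q := (linear_quotient Z).

Definition lq (v : V) : Q := \pi_(@Quotient.quot V (submod_zmod Z)) v.

Lemma lq_surj q : exists v, lq v = q.
Proof. by exists (repr (q : @Quotient.quot V (submod_zmod Z))); rewrite /lq reprK. Qed.

Lemma lqP u v : lq u = lq v <-> u - v \in Z.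
Proof.
rewrite -[u - v \in Z]/((u - v) \in (submod_zmod Z : {pred V})).
by rewrite Quotient.idealrBE; split=> [uv|/eqP]; [apply/eqP; exact: uv|].
Qed.

Lemma lqD u v : lq (u + v) = lq u + lq v.
Proof. exact: (@Quotient.pi_add V (submod_zmod Z)). Qed.

Lemma lqZ a v : lq (a *: v) = a *: lq v.
Proof.
apply/esym/lqP; rewrite -scalerBr; apply: (rpredZ (s := Z) a).
by apply/lqP; rewrite /lq reprK.
Qed.

Lemma lq0 : lq 0 = 0.
Proof. by rewrite -(scale0r 0) lqZ scale0r. Qed.

Lemma lq_sum n (F : 'I_n -> V) : lq (\sum_i F i) = \sum_i lq (F i).
Proof.
elim/big_ind2 : _ => // [|u a v b <- <-]; last by rewrite lqD.
by rewrite -(scale0r 0) lqZ scale0r.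
Qed.

Lemma lq_open (O : set Q) : open O <-> open (lq @^-1` O).
Proof. by []. Qed.

Lemma hausdorff_lq_closed v : hausdorff_space Q -> v \notin Z ->
  exists2 A, nbhs v A & forall z, z \in Z -> ~ A z.
Proof.
rewrite open_hausdorff => hQ vZ.
have [|[A B] /= [Av B0] [oA oB /eqP AB]] := hQ (lq v) (lq 0).
  by apply/eqP => /lqP; rewrite subr0; exact/negP.
exists (lq @^-1` A); first by apply: open_nbhs_nbhs; split; [exact/lq_open|rewrite inE in Av].
move=> z zZ Az; have zE : lq z = lq 0 by apply/lqP; rewrite subr0.
rewrite inE in B0; have : (A `&` B) (lq 0) by split=> //; rewrite -zE.
by rewrite AB.
Qed.

End quotient_theory.

Lemma countable_infinite_enum T (A : set T) : countable A -> infinite_set A ->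
  exists2 xi : nat -> T, injective xi & range xi = A.
Proof.
move=> cA /infiniteP iA; have /card_bijP[f [g fK gK]] : ([set: nat] #= A)%card by rewrite card_eq_le iA.
exists (fun n => val (f (SigSub (in_setT n)))) => [k l /val_inj/(can_inj fK)/(congr1 val) //|].
apply/seteqP; split=> [_ [n _ <-]|x Ax]; first exact: set_valP.
exists (val (g (SigSub (mem_set Ax)))) => //.
rewrite (_ : SigSub _ = g (SigSub (mem_set Ax))); first by rewrite gK.
exact: val_inj.
Qed.

Section subspaces.
Context (F : fieldType) (n : nat) (E : set 'rV[F]_n).
Hypothesis E0 : E 0.
Hypothesis ED : forall a u v, E u -> E v -> E (a *: u + v).

Lemma subspace_rows m (M : 'M[F]_(m, n)) u : (forall i, E (row i M)) -> (u <= M)%MS -> E u.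
Proof.
move=> EM /submxP[D ->]; rewrite mulmx_sum_row.
by elim/big_rec : _ => // i v _ Ev; exact: ED.
Qed.

(** Take a matrix of maximal rank with rows in [E]; a vector of [E] outside its row space would
    increase the rank. *)
Lemma subspace_matrix : exists m (M : 'M[F]_(m, n)), (forall i, E (row i M)) /\ forall v, E v -> (v <= M)%MS.
Proof.
pose P r := `[< exists m (M : 'M[F]_(m, n)), (forall i, E (row i M)) /\ \rank M = r >].
have exP : exists r, P r.
  by exists 0%N; apply/asboolP; exists 0%N, 0; split; [case|rewrite mxrank0].
have ubP r : P r -> (r <= n)%N by move=> /asboolP[m [M [_ <-]]]; exact: rank_leq_col.
case: (ex_maxnP exP ubP) => r /asboolP[m [M [EM rM]]] rmax.
exists m, M; split=> // v Ev; have [//|vM] := boolP (v <= M)%MS.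
have : P (\rank (col_mx M v)).
  apply/asboolP; exists (m + 1)%N, (col_mx M v); split=> // i.
  case: (fintype.splitP i) => j ij.
    by rewrite (_ : i = lshift 1 j) ?rowKu //; exact: val_inj.
  rewrite (_ : i = rshift m j) ?rowKd; last exact: val_inj.
  by rewrite (_ : row j v = v) //; apply/rowP => l; rewrite mxE (ord1 j).
move=> /rmax; rewrite -rM leqNgt => /negP[]; rewrite -addsmxE.
by apply: rank_ltmx; rewrite ltmxE addsmxSl addsmx_sub submx_refl.
Qed.

End subspaces.

Section functionals.
Context (R : realType) (X : topologicalType).
Local Notation V := (Cp R X).
Implicit Types (mu : seq (R * X)) (f g h : V) (Z : submodClosed V).

Definition ev_at mu f : R := \sum_(ax <- mu) ax.1 * ev f ax.2.

Lemma ev_at_lin mu a f g : ev_at mu (a *: f + g) = a * ev_at mu f + ev_at mu g.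
Proof.
rewrite /ev_at mulr_sumr -big_split; apply: eq_bigr => ax _.
by rewrite evD evZ mulrDr mulrCA.
Qed.

Lemma ev_at0 mu : ev_at mu 0 = 0.
Proof. by rewrite /ev_at big1 // => ax _; rewrite ev0 mulr0. Qed.

Lemma ev_at_sum mu n (a : 'I_n -> R) (F : 'I_n -> V) :
  ev_at mu (\sum_i a i *: F i) = \sum_i a i * ev_at mu (F i).
Proof.
elim/big_ind2 : _ => [|x f y g hf hg|i _]; first exact: ev_at0.
  by rewrite -[f]scale1r ev_at_lin mul1r hf hg.
by rewrite -[_ *: _]addr0 ev_at_lin ev_at0 addr0.
Qed.

(** A basic neighbourhood involves finitely many points. Evaluated at these, [f] is not in the image
    of [Z], and a column of the cokernel matrix gives the weights of a functional;
    finite-dimensional linear algebra takes the place of Hahn-Banach. *)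
Lemma separating_functional Z f (A : set V) : nbhs f A -> (forall z, z \in Z -> ~ A z) ->
  exists mu, (forall z, z \in Z -> ev_at mu z = 0) /\ ev_at mu f <> 0.
Proof.
move=> /nbhs_CpP[s [e [e0 sA]]] ZA; pose n := size s.
pose phi h : 'rV[R]_n := \row_i ev h (tnth (in_tuple s) i).
have phi_lin a g h : phi (a *: g + h) = a *: phi g + phi h by apply/rowP => i; rewrite !mxE evD evZ.
pose E := phi @` [set` Z].
have E0 : E 0 by exists 0; [exact: rpred0|apply/rowP => i; rewrite !mxE ev0].
have ED a u v : E u -> E v -> E (a *: u + v).
  move=> [g gZ <-] [h hZ <-]; exists (a *: g + h); last exact: phi_lin.
  by apply: rpredD => //; exact: rpredZ.
have [m [M [EM ME]]] := subspace_matrix E.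
have nfM : ~~ (phi f <= M)%MS.
  apply/negP => /(subspace_rows E0 ED EM)[h hZ hf]; apply: (ZA h hZ); apply: sA => x xs.
  have xi : (index x s < n)%N by rewrite index_mem.
  move/rowP/(_ (Ordinal xi)): hf; rewrite !mxE (tnth_nth x) /= nth_index // => ->.
  by rewrite subrr normr0.
have [j fj] : exists j, (phi f *m cokermx M) 0 j <> 0.
  apply: contrapT => nj; move/negP: nfM; apply; rewrite submxE; apply/eqP/rowP => j; rewrite [RHS]mxE.
  by apply: contrapT => fj; apply: nj; exists j.
have muE h : ev_at [seq (cokermx M i j, tnth (in_tuple s) i) | i <- enum 'I_n] h = (phi h *m cokermx M) 0 j.
  rewrite /ev_at big_map big_enum /= [RHS]mxE; apply: eq_bigr => i _; by rewrite [phi h _ _]mxE mulrC.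
exists [seq (cokermx M i j, tnth (in_tuple s) i) | i <- enum 'I_n].
split=> [z zZ|]; last by rewrite muE.
have : (phi z <= M)%MS by apply: ME; exists z.
by rewrite muE submxE => /eqP ->; rewrite mxE.
Qed.

(** The functionals in [L] map into a finite-dimensional space; preimages of vectors spanning the
    image span the quotient. *)
Lemma finite_codimension Z (L : seq (seq (R * X))) :
  (forall f, (forall mu, mu \in L -> ev_at mu f = 0) -> f \in Z) ->
  finite_dimensional (linear_quotient Z).
Proof.
move=> LZ; pose n := size L.
pose phi h : 'rV[R]_n := \row_(i < n) ev_at (nth [::] L i) h.
have phi_lin a g h : phi (a *: g + h) = a *: phi g + phi h by apply/rowP => i; rewrite !mxE ev_at_lin.
pose E := range phi.
have E0 : E 0 by exists 0 => //; apply/rowP => i; rewrite !mxE ev_at0.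
have ED a u v : E u -> E v -> E (a *: u + v).
  by move=> [g _ <-] [h _ <-]; exists (a *: g + h).
have [m [M [EM ME]]] := subspace_matrix E.
have /choice[e eE] : forall i, exists h, phi h = row i M.
  by move=> i; have [h _ hE] := EM i; exists h.
exists m, (fun i => lq Z (e i)) => q; have [h <-] := lq_surj q.
have /submxP[D hD] : (phi h <= M)%MS by apply: ME; exists h.
exists (fun i => D 0 i); under eq_bigr => i _ do rewrite -lqZ.
rewrite -lq_sum; apply/lqP; apply: LZ => mu muL.
have idx : (index mu L < n)%N by rewrite index_mem.
rewrite -scaleN1r addrC ev_at_lin ev_at_sum mulN1r addrC; apply/eqP; rewrite subr_eq0; apply/eqP.
move/rowP/(_ (Ordinal idx)): hD; rewrite mulmx_sum_row summxE !mxE /= nth_index // => ->.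
apply: eq_bigr => i _; rewrite -eE !mxE /= nth_index //.
Qed.

(** In infinite codimension the functionals found so far have a common zero outside [Z]. As [Z] is
    closed, a new functional annihilates [Z] but not this zero. *)
Lemma triangular_functionals Z : hausdorff_space (linear_quotient Z) ->
  ~ finite_dimensional (linear_quotient Z) ->
  exists (mu : nat -> seq (R * X)) (f : nat -> V),
    [/\ forall n z, z \in Z -> ev_at (mu n) z = 0,
        forall n, ev_at (mu n) (f n) <> 0 &
        forall i n, (i < n)%N -> ev_at (mu i) (f n) = 0].
Proof.
move=> hZ fd.
have /choice[step stepP] : forall L : seq (seq (R * X)), exists nf : seq (R * X) * V,
    [/\ forall z, z \in Z -> ev_at nf.1 z = 0, ev_at nf.1 nf.2 <> 0 &
      forall mu, mu \in L -> ev_at mu nf.2 = 0].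
  move=> L; have [f fZ fL] : exists2 f, f \notin Z & forall mu, mu \in L -> ev_at mu f = 0.
    apply: contrapT => nf; apply: fd; apply: (@finite_codimension Z L) => f fL.
    by apply: contrapT => /negP fZ; apply: nf; exists f.
  have [A Af AZ] := hausdorff_lq_closed hZ fZ.
  have [mu [muZ muf]] := separating_functional Af AZ.
  by exists (mu, f).
pose L := fix L n := if n is n'.+1 then (step (L n')).1 :: L n' else [::].
exists (fun n => (step (L n)).1), (fun n => (step (L n)).2); split=> [n|n|i n lt_in].
- by have [] := stepP (L n).
- by have [] := stepP (L n).
- have [_ _] := stepP (L n); apply.
  elim: n lt_in => // n ih; rewrite ltnS leq_eqVlt inE => /orP[/eqP ->|/ih ->]; by rewrite ?eqxx ?orbT.
Qed.

End functionals.

Section rich_quotients.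
Context (R : realType) {d : Order.disp_t} (W : orderType d) (w1 : is_omega1 W).
Local Notation I := (nat + W)%type.
Variables (K : set (I -> bool)) (rK : rich R K).
Local Notation T := (subcube K).
Variable Z : submodClosed (Cp R T).
Hypothesis hZ : hausdorff_space (linear_quotient Z).
Hypothesis infZ : ~ finite_dimensional (linear_quotient Z).

(** The functionals are finitely supported measures. Listing their atoms without repetition turns
    them into independent coefficient vectors, which every member of [Z] kills. *)
Lemma quotient_twins a0 : exists p q : T, [/\ agree (low a0) (kval p) (kval q), p <> q &
  forall f, f \in Z -> ev f p = ev f q].
Proof.
have [mu [f [muZ muf muf0]]] := triangular_functionals hZ infZ.
have [e einj _] : exists2 e : nat -> T, injective e & forall k, setT (e k).
  by apply: card_le_inj; apply/infiniteP; exact: rich_infinite rK.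
(* The points [e k] ensure that the set is infinite, so that it has an injective enumeration by
   [nat]. *)
pose P : set T := range e `|` \bigcup_n [set x | x \in map snd (mu n)].
have [xi xinj xiP] : exists2 xi : nat -> T, injective xi & range xi = P.
  apply: countable_infinite_enum.
    rewrite (_ : P = \bigcup_n (if n is n'.+1 then [set x | x \in map snd (mu n')] else range e)).
      apply: bigcup_countable => // -[|n] _; last exact/finite_set_countable/finite_seq.
      by apply: card_le_trans (card_image_le _ _) _; exact: countableP.
    apply/seteqP; split=> x; first by move=> [ex|[n _ xn]]; [exists 0%N|exists n.+1].
    by move=> [[|n] _ xn]; [left|right; exists n].
  apply/infiniteP; apply: (card_le_fun (f := e)) => [k _|k l _ _ /einj //]; by left; exists k.
pose c n k : R := \sum_(ax <- mu n) ax.1 * (ax.2 == xi k)%:R.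
have /choice[M MP] : forall n, exists M, forall ax, ax \in mu n -> exists2 k, (k < M)%N & xi k = ax.2.
  move=> n; have: forall ax, ax \in mu n -> exists k, xi k = ax.2.
    move=> ax axn; have [k _ kE] : range xi ax.2 by rewrite xiP; right; exists n => //; apply/mapP; exists ax.
    by exists k.
  elim: (mu n) => [|ax s ih] h; first by exists 0%N.
  have [|M MP] := ih; first by move=> bx bxs; apply: h; rewrite inE bxs orbT.
  have [k kE] := h ax (mem_head _ _); exists (maxn M k.+1) => bx; rewrite inE => /orP[/eqP ->|/MP[l lM lE]].
    by exists k => //; rewrite leq_max ltnSn orbT.
  by exists l => //; rewrite leq_max lM.
have cM n k : (M n <= k)%N -> c n k = 0.
  move=> Mk; rewrite /c big_seq big1 // => ax axn; have [l lM <-] := MP n ax axn.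
  case: eqP => [/xinj E|_]; last by rewrite mulr0.
  by move: lM; rewrite E ltnNge Mk.
have cE n N (h : Cp R T) : (M n <= N)%N -> \sum_(k < N) c n k * ev h (xi k) = ev_at (mu n) h.
  move=> MN; under eq_bigr => k _ do rewrite mulr_suml.
  rewrite exchange_big /= /ev_at big_seq [RHS]big_seq; apply: eq_bigr => ax axn.
  have [l lM lE] := MP n ax axn.
  rewrite (@sum_single _ (fun k => ax.1 * (ax.2 == xi k)%:R * ev h (xi k)) N l).
  - by rewrite lE eqxx mulr1.
  - exact: leq_trans MN.
  - by move=> k kl; rewrite -lE; case: eqP => [/xinj/esym //|_]; rewrite mulr0 mul0r.
(* At [f p] all functionals but the last vanish, which isolates the last coefficient. *)
have free p (t : 'I_p -> R) : (forall h, \sum_(n < p) t n * ev_at (mu n) h = 0) -> forall n, t n = 0.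
  elim: p t => [|p ih] t tE; first by case.
  have tp : t ord_max = 0.
    have := tE (f p); rewrite big_ord_recr /= big1 ?add0r => [/eqP|n _]; last by rewrite muf0 ?mulr0.
    by rewrite mulf_eq0 => /orP[/eqP //|/eqP /muf].
  have ihn := ih (fun n => t (widen_ord (leqnSn p) n)).
  move=> n; have [np|pn] := ltnP n p.
    rewrite (_ : n = widen_ord (leqnSn p) (Ordinal np)); last exact: val_inj.
    apply: ihn => h; have := tE h; by rewrite big_ord_recr /= tp mul0r addr0.
  by rewrite (_ : n = ord_max) //; apply: val_inj; apply/eqP; rewrite eqn_leq pn -ltnS ltn_ord.
have [||p [q [pq npq tw]]] := twins_continuous rK (c := c) a0 xinj.
- by move=> n; exists (M n); exact: cM.
- move=> p t tk; apply: free => h; pose N := \max_(n < p) M n.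
  transitivity (\sum_(k < N) (\sum_(n < p) t n * c n k) * ev h (xi k)); last first.
    by rewrite big1 // => k _; rewrite tk mul0r.
  apply/esym.
  under eq_bigr => k _ do rewrite mulr_suml.
  rewrite exchange_big /=; apply: eq_bigr => n _; rewrite -(cE n N).
    by rewrite mulr_sumr; apply: eq_bigr => k _; rewrite mulrA.
  exact: (leq_bigmax (F := fun n : 'I_p => M n)).
exists p, q; split=> // h hZ'; apply: tw; first exact: ev_cont.
move=> n N cN; rewrite -(@sum_widen _ (fun k => c n k * ev h (xi k)) N (maxn N (M n))) ?leq_maxl //.
  by rewrite cE ?leq_maxr // muZ.
by move=> k Nk; rewrite cN ?mul0r.
Qed.

Lemma cell_separate (S : seq T) x : x \notin S -> exists2 C, clop setT C &
  C (kval x) /\ forall z, z \in S -> ~ C (kval z).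
Proof.
move=> xS; have cS : closed [set` S].
  move: [set` S] (finite_seq S); apply/accessible_finite_set_closed/hausdorff_accessible; exact: subcube_hausdorff.
rewrite -openC in cS; move/open_cellP: cS => /(_ x)[|J JS]; first exact/negP.
by exists [set y | agree [set` J] (kval x) y]; [exact: clop_cell|split=> // z zS /JS; apply].
Qed.

(** The difference of the values at the twins is constant on classes modulo [Z] and defines a
    continuous functional on the quotient. *)
Lemma gap_open p q (O : set R) : (forall f, f \in Z -> ev f p = ev f q) -> open O ->
  open [set r : linear_quotient Z | forall f, lq Z f = r -> O (ev f p - ev f q)].
Proof.
move=> Zpq oO; apply/lq_open.
rewrite (_ : _ @^-1` _ = (fun f : Cp R T => ev f p - ev f q) @^-1` O).
  apply: open_comp oO => f _.
  exact: (cvgB (@continuous_ev R T p f) (@continuous_ev R T q f)).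
apply/seteqP; split=> f /=; first by apply.
move=> fO g /lqP /Zpq; rewrite !evB => E; suff -> : ev g p - ev g q = ev f p - ev f q by [].
lra.
Qed.

(** Representatives of a countable dense set are uniformly continuous, so countably many coordinates
    govern them. Twins that agree there have gap 0 for all of them, while the classes with nonzero
    gap form a nonempty open set. *)
Lemma quotient_not_separable : ~ separable_space (linear_quotient Z).
Proof.
move=> [D cD dD]; have [w _] := omega1_least w1.
have [D0 | [g0 Dg0]] : D = set0 \/ D !=set0 by have [->|/set0P] := eqVneq D set0; [left|right].
  by have [x [_]] := dD setT (ex_intro _ 0 Logic.I) openT; rewrite D0.
have [g gE] := countable_enum (ex_intro D g0 Dg0) cD.
have [h hE] := choice (fun n => lq_surj (g n)).
have /choice[J JP] : forall nk : nat * nat, exists J : seq I, forall x y : T, cell J x y ->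
    `|ev (h nk.1) x - ev (h nk.1) y| < nk.2.+1%:R^-1.
  move=> [n k] /=; apply: (continuous_uniform (rich_closed rK)); [exact: ev_cont|by rewrite invr_gt0].
have /choice[b bP] := fun nk => lowe_seq w1 (J nk).
have [|a aP] := @countable_ub _ _ w1 (range b).
  by apply: card_le_trans (card_image_le _ _) _; exact: countableP.
have [p [q [pq npq Zpq]]] := quotient_twins a.
have hpq n : ev (h n) p = ev (h n) q.
  apply/eqP; rewrite -subr_eq0 -normr_le0; apply/ler_addgt0Pr => e e0; rewrite add0r.
  have [k ke] : exists k, k.+1%:R^-1 < e.
    by have [k _ kP] := near_infty_natSinv_lt (PosNum e0); exists k; exact: kP k (leqnn k).
  apply: ltW; apply: lt_trans ke; apply: (JP (n, k)); apply: agree_sub pq => i iJ.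
  by apply: (lowe_low (aP (b (n, k)) _)); [exists (n, k)|exact: bP].
have gap f f' : lq Z f = lq Z f' -> ev f p - ev f q = ev f' p - ev f' q.
  by move=> /lqP /Zpq; rewrite !evB; lra.
have [|C cC [Cp Cq]] := cell_separate (S := [:: q]) (x := p); first by rewrite inE; apply/eqP.
have [|r []] := dD _ _ (gap_open Zpq (@open_neq R 0)).
  exists (lq Z (mkCp (@continuous_indic _ K R _ cC))) => f /gap ->; rewrite !ev_mkCp !indicE mem_set //.
  by rewrite memNset ?subr0 /= ?oner_neq0 //; apply: Cq; exact: mem_head.
rewrite -gE => /[swap] -[n _ <-] /(_ (h n) (hE n)) /=.
by rewrite hpq subrr eqxx.
Qed.

(** The balls of radius [1 / (n + 1)] around 0 contain the classes of basic neighbourhoods in the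
    function space. These test countably many points in all, collected in [Phi]. *)
Lemma quotient_not_metrisable : ~ metrisable R (linear_quotient Z).
Proof.
move=> [dist [_ _ _ distP]].
have /choice[se seP] : forall n : nat, exists se : seq T * R, 0 < se.2 /\ forall g, (forall x, x \in se.1 -> `|ev (0 : Cp R T) x - ev g x| < se.2) -> dist 0 (lq Z g) < n.+1%:R^-1.
  move=> n; have : nbhs (0 : linear_quotient Z) [set r | dist 0 r < n.+1%:R^-1].
    by apply/distP; exists n.+1%:R^-1 => //; rewrite invr_gt0.
  rewrite nbhsE => -[G [oG G0] Gd]; have : nbhs (0 : Cp R T) (lq Z @^-1` G).
    apply: open_nbhs_nbhs; split; first exact/lq_open.
    by rewrite /= lq0.
  by move=> /nbhs_CpP[s [e [e0 sG]]]; exists (s, e); split=> // g gs; apply: Gd; exact: sG.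
pose Phi : set T := \bigcup_n [set` (se n).1].
have [|a aP] := low_separates w1 (S := Phi).
  by apply: bigcup_countable => // n _; exact/finite_set_countable/finite_seq.
have [p0 [q0 [pq0 npq0 Zpq0]]] := quotient_twins a.
(* The twins agree on coordinates that separate [Phi], so at most one of them is in [Phi]; [p] is
   one that is not. *)
have [p [q [npq pPhi Zpq]]] : exists p q, [/\ p <> q, ~ Phi p & forall f, f \in Z -> ev f p = ev f q].
  have [Pp|nPp] := pselect (Phi p0); last by exists p0, q0.
  exists q0, p0; split; [exact: nesym| |by move=> f /Zpq0].
  by move=> Pq; apply: npq0; exact: aP.
have : nbhs (0 : linear_quotient Z) [set r | forall f, lq Z f = r -> ev f p - ev f q < 1].
  apply: open_nbhs_nbhs; split; first exact: (@gap_open p q [set x : R | x < 1] Zpq (@open_lt R 1)).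
  move=> f f0; have : f \in Z by rewrite -[f]subr0; apply/lqP; rewrite f0 lq0.
  by move=> /Zpq ->; rewrite subrr ltr01.
move=> /distP[e e0 eP].
have [n _ nP] := near_infty_natSinv_lt (PosNum e0).
(* The indicator of [C] vanishes at the points tested by the n-th neighbourhood, so its class is
   close to 0, yet its gap is 1. *)
have [|C cC [Cp Cq]] := cell_separate (S := q :: (se n).1) (x := p).
  rewrite inE; apply/norP; split; first exact/eqP.
  by apply/negP => pn; apply: pPhi; exists n.
pose f := mkCp (@continuous_indic _ K R _ cC).
have fe : dist 0 (lq Z f) < e.
  apply: lt_trans (nP n (leqnn n)); have [e1 sP] := seP n; apply: sP => x xs.
  rewrite ev0 ev_mkCp indicE memNset ?subrr ?normr0 //.
  by apply: Cq; rewrite inE xs orbT.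
have := eP _ fe f erefl; rewrite !ev_mkCp !indicE mem_set // memNset; last by apply: Cq; exact: mem_head.
by rewrite subr0 ltxx.
Qed.

End rich_quotients.

Theorem theoremA (R : realType) (d : Order.disp_t) (W : orderType d) :
  is_omega1 W -> diamond W ->
  exists K : topologicalType,
    [/\ compact [set: K], hausdorff_space K, has_clopen_basis K,
        separable_space K & crowded K] /\
    [/\ weight_eq K W, ([set: K] #= [set: set W])%card,
        forall Z : submodClosed (Cp R K),
          hausdorff_space (linear_quotient Z) ->
          ~ finite_dimensional (linear_quotient Z) ->
          ~ separable_space (linear_quotient Z),
        forall Z : submodClosed (Cp R K),
          hausdorff_space (linear_quotient Z) ->
          ~ finite_dimensional (linear_quotient Z) ->
          ~ metrisable R (linear_quotient Z)
      & efimov K].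
Proof.
move=> w1 dW; have [K rK] := exists_rich R w1 dW; exists (subcube K).
split; first split.
- exact: subcube_compact (rich_closed rK).
- exact: subcube_hausdorff.
- exact: subcube_clopen_basis.
- exact: (rich_separable rK).
- exact: rich_crowded rK.
split.
- exact: (rich_weight w1 rK).
- exact: (rich_card w1 rK).
- exact: (quotient_not_separable w1 rK).
- exact: (quotient_not_metrisable w1 rK).
- exact: (rich_efimov w1 rK).
Qed.
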